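(* Let $1\le k<d$ be integers. Suppose $f\in C_c(\mathbb{R}^d)$ and let $Tf$ be its $k$-plane transform, as defined in the context. Suppose $\mu$ is a compactly supported nonnegative Borel measure on $\mathbb{R}^{(k+1)(d-k)}$ satisfying $$\mu\big(B(y,r)\big)\le c_2\, r^\alpha$$ for some $\alpha\in\big((k+1)(d-k)-k,\ (k+1)(d-k)\big)$, some $c_2>0$, all $y\in\mathbb{R}^{(k+1)(d-k)}$, and all $r>0$. Fix $\epsilon$ with $0<\epsilon<\alpha-(k+1)(d-k)+k$, and define $q$ by $$\frac12-\frac1q=\frac{\alpha-(k+1)(d-k)+k-\epsilon}{2(d-k)}.$$ Then there is the estimate $$\|Tf\|_{L^2(\mu)}\le C\,\|f\|_{L^2_x(L^{q'}_{x'})},$$ where $q'$ is the exponent conjugate to $q$. Here $C$ depends only on $c_2$, $\epsilon$, and the diameter of the support of $\mu$.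
   Context: Write $y=(y_i^j)$, where $i=0,\dots,k$ and $j=1,\dots,d-k$, for an element of $\mathbb{R}^{(k+1)(d-k)}$; $B(y,r)$ is the ball of center $y$ and radius $r$ there. For $f\in C_c(\mathbb{R}^d)$ (continuous with compact support), the $k$-plane transform $Tf$ is the function of $y\in\mathbb{R}^{(k+1)(d-k)}$ given by $$Tf(y)=\int_{[0,1]^k} f\Big(x_1,\dots,x_k,\ y_0^1+\sum_{i=1}^k x_i y_i^1,\ \dots,\ y_0^{d-k}+\sum_{i=1}^k x_i y_i^{d-k}\Big)\,dx .$$ Elements of $\mathbb{R}^d$ are written $(x,x')\in\mathbb{R}^k\times\mathbb{R}^{d-k}$, and $$\|f\|_{L^2_x(L^{q'}_{x'})}=\Big(\int_{\mathbb{R}^k}\|f(x,\cdot)\|_{L^{q'}(\mathbb{R}^{d-k})}^2\,dx\Big)^{1/2}.$$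
   Formalization: The formal theorem assumes 1 ≤ q ≤ ∞; when k > d−k the equation defining q can give 1/q < 0, so that q' < 1, and there the estimate fails (concentrate f near x' = 0, with μ Lebesgue measure on a ball). *)

(* Defs.v *)
From HB Require Import structures.
From mathcomp Require Import all_boot all_order all_algebra.
From mathcomp Require Import complex.
From mathcomp Require Import all_classical all_reals all_analysis.
From mathcomp Require Import measurable_realfun.

Set Implicit Arguments.
Unset Strict Implicit.
Unset Printing Implicit Defensive.

Import Order.TTheory GRing.Theory Num.Theory.
Import numFieldNormedType.Exports.

Local Open Scope classical_set_scope.
Local Open Scope ring_scope.

(* [T] with the sigma-algebra generated by its open sets *)
Notation borel T := (g_sigma_algebraType (@open T)).

Section lebesgue_rV.
Variable R : realType.

Definition rV_cons n (p : R * 'rV[R]_n) : 'rV[R]_n.+1 :=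
  \row_(i < n.+1) if unlift ord0 i is Some j then p.2 ord0 j else p.1.

Definition rV_uncons n (v : 'rV[R]_n.+1) : R * 'rV[R]_n :=
  (v ord0 ord0, \row_j v ord0 (lift ord0 j)).

Lemma rV_cons0 n (p : R * 'rV[R]_n) : rV_cons p ord0 ord0 = p.1.
Proof. by rewrite mxE unlift_none. Qed.

Lemma rV_consS n (p : R * 'rV[R]_n) j :
  rV_cons p ord0 (lift ord0 j) = p.2 ord0 j.
Proof. by rewrite mxE liftK. Qed.

Lemma rV_consK n : cancel (@rV_cons n) (@rV_uncons n).
Proof.
move=> [a v]; rewrite /rV_uncons rV_cons0; congr pair.
by apply/rowP => j; rewrite mxE rV_consS.
Qed.

Lemma open_rVE n (A : set 'rV[R]_n) : open A ->
  let B (i : 'rV[rat]_n * nat) : set 'rV[R]_n :=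
    ball (map_mx ratr i.1 : 'rV[R]_n) (i.2.+1%:R^-1) in
  A = \bigcup_(i in [set i | B i `<=` A]) B i.
Proof.
move=> oA B; apply/seteqP; split => [x Ax|x [i /= + Bx]]; last exact.
have /nbhs_ballP[e /= e0 xeA] := open_nbhs_nbhs (conj oA Ax).
have [N _ /(_ N (leqnn N)) /= Ne] := near_infty_natSinv_lt (PosNum (divr_gt0 e0 (ltr0n R 2))).
have N0 : 0 < N.+1%:R^-1 :> R by rewrite invr_gt0.
have /choice[q qP] : forall j : 'I_n, exists q : rat,
    `|x ord0 j - ratr q| < N.+1%:R^-1.
  move=> j.
  have /rat_in_itvoo[q /itvP qx] : x ord0 j - N.+1%:R^-1 < x ord0 j + N.+1%:R^-1.
    by rewrite ltrBlDr -addrA ltrDl addr_gt0.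
  by exists q; rewrite distrC ltr_distl !qx.
have Bx : B (\row_j q j, N) x.
  by split => // i j; rewrite /ball/= !mxE !ord1 distrC.
exists (\row_j q j, N) => //= y By; apply: xeA.
rewrite (splitr e); apply: (@ball_triangle _ _ (map_mx ratr (\row_j q j) : 'rV[R]_n)).
  by apply: ball_sym; apply: le_ball Bx; rewrite /= ltW.
by apply: le_ball By; rewrite /= ltW.
Qed.

Lemma measurable_rV_cons n : measurable_fun [set: measurableTypeR R * borel 'rV[R]_n]
  (@rV_cons n : _ -> borel 'rV[R]_n.+1).
Proof.
apply: (@measurability _ _ _ (borel 'rV[R]_n.+1) _ _ open erefl).
move=> _ [A oA <-]; rewrite setTI (open_rVE oA) preimage_bigcup.
rewrite bigcup_mkcond; apply: countable_bigcupT_measurable => //= -[q N].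
case: ifPn => // _.
set c : 'rV[R]_n.+1 := map_mx ratr q; set e := N.+1%:R^-1.
rewrite [X in measurable X](_ : _ =
  ball (c ord0 ord0) e `*` (ball (\row_j c ord0 (lift ord0 j)) e : set 'rV[R]_n)).
  apply: measurableX; first by rewrite ball_itv; exact: measurable_itv.
  by apply: sub_sigma_algebra; exact: ball_open.
apply/seteqP; split => [[a v] [e0 /= cav]|[a v] /= [ca [e0 cv]]].
  split; first by have := cav ord0 ord0; rewrite rV_cons0.
  split=> // i j; rewrite (ord1 i) mxE.
  by have := cav ord0 (lift ord0 j); rewrite rV_consS.
split => // i j; rewrite (ord1 i).
have [j' ->|->] := unliftP ord0 j; last by rewrite rV_cons0.
by rewrite rV_consS; have := cv ord0 j'; rewrite mxE.
Qed.

Lemma measurable_rV_uncons n : measurable_fun [set: borel 'rV[R]_n.+1]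
  (@rV_uncons n : _ -> (measurableTypeR R * borel 'rV[R]_n)%type).
Proof.
apply: measurable_fun_pair.
- apply: (measurability _ (RGenOpens.measurableE R)).
  move=> _ [_ [a [b ->] <-]]; rewrite setTI; apply: sub_sigma_algebra.
  have /continuousP := @coord_continuous R 1 n.+1 ord0 ord0.
  by apply; exact: interval_open.
- apply: (@measurability _ _ _ (borel 'rV[R]_n) _ _ open erefl) => _ [A oA <-]; rewrite setTI.
  apply: sub_sigma_algebra => /=; move: A oA; apply/continuousP => v A /=.
  move=> /nbhs_ballP[e /= e0 eA]; apply/nbhs_ballP; exists e => //= w [_ vw].
  by apply: eA; split => // i j; rewrite !mxE; exact: vw.
Qed.

HB.instance Definition _ n := isMeasurableFun.Build _ _ _ _
  (@rV_cons n : measurableTypeR R * borel 'rV[R]_n -> borel 'rV[R]_n.+1)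
  (@measurable_rV_cons n).

Section lebesgue_cons.
Variables (n : nat) (m : {sigma_finite_measure set (borel 'rV[R]_n) -> \bar R}).

Definition lebesgue_cons : set (borel 'rV[R]_n.+1) -> \bar R :=
  pushforward (@lebesgue_measure R \x m)%E
    (@rV_cons n : measurableTypeR R * borel 'rV[R]_n -> borel 'rV[R]_n.+1).

Let lebesgue_cons0 : lebesgue_cons set0 = 0%E.
Proof. exact: measure0. Qed.

Let lebesgue_cons_ge0 A : (0 <= lebesgue_cons A)%E.
Proof. exact: measure_ge0. Qed.

Let lebesgue_cons_sigma_additive : semi_sigma_additive lebesgue_cons.
Proof. exact: measure_semi_sigma_additive. Qed.

HB.instance Definition _ := isMeasure.Build _ _ _ lebesgue_cons
  lebesgue_cons0 lebesgue_cons_ge0 lebesgue_cons_sigma_additive.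

Let lebesgue_cons_sigma_finite : sigma_finite setT lebesgue_cons.
Proof.
have /sigma_finiteP[F [FT ndF Foo]] := sigma_finiteT (@lebesgue_measure R).
have /sigma_finiteP[G [GT ndG Goo]] := sigma_finiteT m.
exists (fun i => @rV_uncons n @^-1` (F i `*` G i)).
  rewrite -preimage_bigcup (_ : \bigcup_i _ = setT) ?preimage_setT//.
  apply/seteqP; split => // -[a v] _.
  have : [set: measurableTypeR R] a by [].
  rewrite FT => -[i _ Fia].
  have : [set: borel 'rV[R]_n] v by [].
  rewrite GT => -[j _ Gjv]; exists (maxn i j) => //; split.
    by move: Fia; exact/subsetPset/ndF/leq_maxl.
  by move: Gjv; exact/subsetPset/ndG/leq_maxr.
move=> i; have [mF Fi] := Foo i; have [mG Gi] := Goo i; split.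
  rewrite -[X in measurable X]setTI; apply: measurable_rV_uncons => //.
  exact: measurableX.
rewrite /lebesgue_cons /pushforward -comp_preimage.
rewrite (_ : _ \o _ = id) ?preimage_id; last exact/funext/rV_consK.
by rewrite product_measure1E// lte_mul_pinfty// ge0_fin_numE.
Qed.

HB.instance Definition _ := Measure_isSigmaFinite.Build _ _ _ lebesgue_cons
  lebesgue_cons_sigma_finite.

End lebesgue_cons.

Fixpoint lebesgue_rV n : {sigma_finite_measure set (borel 'rV[R]_n) -> \bar R} :=
  if n is n'.+1 then lebesgue_cons (lebesgue_rV n')
  else @dirac _ (borel 'rV[R]_0) (0 : 'rV[R]_0) R.

Definition rV_box n (A : 'I_n -> set R) : set 'rV[R]_n :=
  [set v | forall i, A i (v ord0 i)].

Lemma measurable_rV_box n (A : 'I_n -> set R) : (forall i, measurable (A i)) ->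
  measurable (rV_box A : set (borel 'rV[R]_n)).
Proof.
elim: n A => [A _|n ih A mA].
  rewrite [X in measurable X](_ : _ = setT)//.
  by apply/seteqP; split => // v _ [].
rewrite [X in measurable X](_ : _ = @rV_uncons n @^-1`
    (A ord0 `*` rV_box (fun i => A (lift ord0 i)))).
  rewrite -[X in measurable X]setTI; apply: measurable_rV_uncons => //.
  by apply: measurableX; [exact: mA|exact: (ih _ (fun i => mA (lift ord0 i)))].
apply/seteqP; split => [v Av|v [/= A0 AS] i].
  by split => //= i; rewrite mxE; exact: Av.
have [j ->|->//] := unliftP ord0 i.
by have := AS j; rewrite mxE.
Qed.

Lemma lebesgue_rV_box n (A : 'I_n -> set R) : (forall i, measurable (A i)) ->
  lebesgue_rV n (rV_box A) = (\prod_(i < n) lebesgue_measure (A i))%E.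
Proof.
elim: n A => [A _|n ih A mA].
  by rewrite big_ord0 /= diracE mem_set// => -[].
rewrite big_ord_recl -ih//.
rewrite -product_measure1E; [|exact: mA|exact: measurable_rV_box].
rewrite /= /lebesgue_cons /pushforward.
congr (_ _); apply/seteqP; split => [[a v] /= Av|[a v] /= [A0 AS] i].
  split; first by have := Av ord0; rewrite rV_cons0.
  by move=> i; have := Av (lift ord0 i); rewrite rV_consS.
by have [j ->|->] := unliftP ord0 i; rewrite ?rV_consS ?rV_cons0//; exact: AS.
Qed.

End lebesgue_rV.
Arguments lebesgue_rV : clear implicits.

Section euclidean.
Variables (R : realType) (m n : nat).

(* The library norm and balls on matrices are those of the sup norm. *)
Definition enorm (A : 'M[R]_(m, n)) : R :=
  Num.sqrt (\sum_i \sum_j A i j ^+ 2).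

Definition eball (y : 'M[R]_(m, n)) (r : R) : set 'M[R]_(m, n) :=
  [set z | enorm (z - y) < r].

(* [sup] is real-valued: the diameter of the empty set is 0. *)
Definition ediam (S : set 'M[R]_(m, n)) : R :=
  sup [set r | exists y z, [/\ S y, S z & r = enorm (y - z)]].

End euclidean.

Definition measure_support (T : ptopologicalType) (R : realType)
    (mu : {measure set (borel T) -> \bar R}) : set T :=
  [set y | forall U : set T, open U -> U y -> (0 < mu U)%E].

Section kplane.
Variables (R : realType).

(* [R[i]^o] carries the metric topology of the complex numbers. *)
Definition continuous_compact_support (T : topologicalType) (f : T -> R[i]) :=
  continuous (f : T -> R[i]^o) /\ compact (closure [set x | f x != 0]).

Variables (k m : nat).

Definition unit_cube : set 'rV[R]_k := rV_box (fun=> `[0, 1]%classic).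

Implicit Types (x : 'rV[R]_k) (y : 'M[R]_(k.+1, m)).
Implicit Types f : 'rV[R]_k * 'rV[R]_m -> R[i].

(* The coefficient y_i^j is the entry [y i j]; row 0 is the base point y_0. *)
Definition kplane_point y x : 'rV[R]_m :=
  \row_j (y ord0 j + \sum_(i < k) x ord0 i * y (lift ord0 i) j).

(* The Lebesgue integral of the library is real-valued, hence the splitting
   into real and imaginary parts. *)
Definition kplane_transform f y : R[i] :=
  let F x := f (x, kplane_point y x) in
  Complex (\int[lebesgue_rV R k]_(x in unit_cube) complex.Re (F x))
          (\int[lebesgue_rV R k]_(x in unit_cube) complex.Im (F x)).

Definition mixed_norm (p : \bar R) f : \bar R :=
  Lnorm (lebesgue_rV R k) 2%:E (fun x : borel 'rV[R]_k =>
    Lnorm (lebesgue_rV R m) p (fun x' : borel 'rV[R]_m =>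
      (Normc.normc (f (x, x')))%:E)).

Definition L2_norm (mu : {measure set (borel 'M[R]_(k.+1, m)) -> \bar R})
    (g : 'M[R]_(k.+1, m) -> R[i]) : \bar R :=
  Lnorm mu 2%:E (fun y : borel 'M[R]_(k.+1, m) => (Normc.normc (g y))%:E).

End kplane.

(* Main.v *)
Require Import Defs.
From HB Require Import structures.
From mathcomp Require Import all_boot all_order all_algebra.
From mathcomp Require Import complex.
From mathcomp Require Import all_classical all_reals all_analysis.
From mathcomp Require Import measurable_realfun.
From mathcomp Require Import ring lra zify.
Import Order.TTheory GRing.Theory Num.Theory numFieldNormedType.Exports.
Local Open Scope classical_set_scope.
Local Open Scope ring_scope.
Set Implicit Arguments.
Unset Strict Implicit.
Unset Printing Implicit Defensive.

(** Put m = d - k, N = (k+1) m and let p be the exponent conjugate to q; the relation defining q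
    then reads m (2/p - 1) = alpha - N + k - eps. Write T for the transform. The proof is a
    Littlewood-Paley decomposition in the parameter y, carried out with averages and finite
    differences instead of the Fourier transform.

    Let A_j average a function of y over the cube y + [0, 2^-j]^N and put S_j = A_j^2. The operator
    1 - (1 - S_j)^k ([smooth]) reproduces the uniformly continuous function T F in the limit of
    large j, and mu is finite, so it is enough to bound in L^2(mu) the term at scale 0 and the
    increments from j to j+1. By [smoothB] and [smoothE] an increment is a sum of terms A_a A_a (1 -
    S_a)^i (1 - S_b)^k T F with i < k and a, b in {j, j+1}. All these operators commute. With r =
    2^-j, three estimates are combined, up to constants:

    (a) the outer average passes from mu to Lebesgue measure on a slab: the square of the L^2(mu)
    norm of A H is at most r^(alpha - N) times the integral of H^2 ([frostman_average], from the
    ball condition);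

    (b) the k cancellations give a factor ((j+1) r)^k in the square of the L^2 norm of the transform
    over the slab ([slab_energy_diffs_le]);

    (c) the inner average becomes an average of F along each fibre, and there passes from L^p to L^2
    at the cost r^(-m (2/p - 1)) ([fibre_sqnorm_avg], a Bernstein inequality).

    The product is (j+1)^k r^eps, whose square roots are summable.

    The heart is (b). The integral of (T F)^2 over the slab is a double integral over x, x' of a
    pairing of the fibres F(x, .) and F(x', .). After the substitution u = y_0 + x z, where z is the
    matrix of the direction rows, F(x, u) is tested against the integral of F(x', u + (x' - x) z)
    over a cube of matrices z. Row i of z moves the point by (x'_i - x_i) z_i, so a difference of
    F(x', .) with a step of size r can be traded for a translation of z_i by about r / |x'_i - x_i|,
    which changes the cube only by a proportion min(1, r / |x'_i - x_i|). There are k rows, and one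
    difference is spent on each ([sqnorm_cube_average]). Schur's test ([slab_energy_le]) together
    with the bound of the integral of min(1, r / |t|) by a multiple of (j+1) r ([integral_gain])
    then gives (b). *)

(** * Integration tools: bounded integrands, Fubini, Cauchy-Schwarz, Jensen *)

Section bounded_integrands.
Context d (T : measurableType d) (R : realType).
Variable mu : {measure set T -> \bar R}.
Implicit Types (f g : T -> R) (A : set T).

Lemma integrable_indic_fin A : measurable A -> (mu A < +oo)%E ->
  mu.-integrable setT (fun x => (\1_A x)%:E).
Proof.
move=> mA Aoo; apply/integrableP; split; first exact/measurable_EFinP.
under eq_integral do rewrite /= ger0_norm//.
by rewrite integral_indic// setIT.
Qed.

Lemma integrable_bounded_support f A (M : R) :
  measurable_fun setT f -> measurable A -> (mu A < +oo)%E ->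
  (forall x, `|f x| <= M * \1_A x) -> mu.-integrable setT (EFin \o f).
Proof.
move=> mf mA Aoo fM; apply: (@le_integrable _ _ _ mu setT measurableT _
    (EFin \o (fun x => M * \1_A x))) => //.
- exact/measurable_EFinP.
- move=> x _ /=; rewrite lee_fin; apply: (le_trans (fM x)); exact: ler_norm.
- apply/(eq_integrable measurableT (fun x => (M%:E * (\1_A x)%:E)%E)) => //.
  apply: integrableZl => //; exact: integrable_indic_fin.
Qed.

Lemma Rintegral_bounded_support f A (M : R) :
  measurable_fun setT f -> measurable A -> (mu A < +oo)%E ->
  (forall x, `|f x| <= M * \1_A x) ->
  `|\int[mu]_x f x| <= M * fine (mu A).
Proof.
move=> mf mA Aoo fM.
have fi := integrable_bounded_support mf mA Aoo fM.
have A0 : mu A \is a fin_num by rewrite ge0_fin_numE.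
apply: (le_trans (le_normr_Rintegral _ fi)) => //.
have -> : M * fine (mu A) = \int[mu]_x (M * \1_A x).
  rewrite RintegralZl//; last exact: integrable_indic_fin.
  by rewrite /Rintegral integral_indic// setIT.
apply: le_Rintegral => //.
- exact: (integrable_norm fi).
- apply/(eq_integrable measurableT (fun x => (M%:E * (\1_A x)%:E)%E)) => //.
  apply: integrableZl => //; exact: integrable_indic_fin.
Qed.

End bounded_integrands.

Section sections_integrals.
Context d1 d2 (T1 : measurableType d1) (T2 : measurableType d2) (R : realType).
Variable m1 : {sigma_finite_measure set T1 -> \bar R}.
Variable m2 : {sigma_finite_measure set T2 -> \bar R}.

Lemma measurable_Rintegral2 (f : T1 * T2 -> R) :
  measurable_fun setT f -> measurable_fun setT (fun x => \int[m2]_y f (x, y)).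
Proof.
move=> mf; apply: measurableT_comp => //.
rewrite [X in measurable_fun _ X](_ : _ = fun x =>
   (\int[m2]_y ((EFin \o f)^\+ (x, y)) - \int[m2]_y ((EFin \o f)^\- (x, y)))%E); last first.
  apply/funext => x; rewrite integralE.
  by f_equal; [|f_equal]; apply: eq_integral => y _; rewrite ?(funeposE,funenegE).
apply: emeasurable_funB.
  apply: (@measurable_fun_fubini_tonelli_F _ _ _ _ _ m2 (EFin \o f)^\+%E) => //.
  exact/measurable_funepos/measurable_EFinP.
apply: (@measurable_fun_fubini_tonelli_F _ _ _ _ _ m2 (EFin \o f)^\-%E) => //.
exact/measurable_funeneg/measurable_EFinP.
Qed.

(** Domination by a multiple of the indicator of a rectangle of finite measure makes f and each of
    its sections integrable, so that [fine] loses nothing in the inner integrals. *)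
Lemma Rintegral_Fubini (f : T1 * T2 -> R) (A : set T1) (B : set T2) (M : R) :
  measurable_fun setT f -> measurable A -> measurable B ->
  (m1 A < +oo)%E -> (m2 B < +oo)%E ->
  (forall x y, `|f (x, y)| <= M * (\1_A x * \1_B y)) ->
  \int[m1]_x \int[m2]_y f (x, y) = \int[m2]_y \int[m1]_x f (x, y) /\
  \int[m1]_x \int[m2]_y f (x, y) = \int[(m1 \x m2)%E]_z f z.
Proof.
move=> mf mA mB Aoo Boo fM.
have ABoo : ((m1 \x m2) (A `*` B) < +oo)%E.
  by rewrite product_measure1E// lte_mul_pinfty// ge0_fin_numE.
have fi : (m1 \x m2)%E.-integrable setT (EFin \o f).
  apply: (@integrable_bounded_support _ _ _ _ _ (A `*` B) M) => //.
    exact: measurableX.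
  move=> [x y]; apply: (le_trans (fM x y)).
  rewrite !indicE in_setX/=; case: (x \in A); case: (y \in B) => /=;
    by rewrite ?(mulr1,mulr0,mul0r).
have mB2 x : measurable_fun setT (fun y => f (x, y)) by apply: measurableT_comp.
have mA2 y : measurable_fun setT (fun x => f (x, y)) by apply: measurableT_comp.
have ix x : m2.-integrable setT (fun y => (f (x, y))%:E).
  apply: (@integrable_bounded_support _ _ _ _ _ B `|M|) => // y.
  apply: (le_trans (fM x y)); rewrite !indicE.
  have := ler_norm M; have := normr_ge0 M.
  by case: (x \in A); case: (y \in B) => /=; rewrite ?(mulr1,mulr0,mul0r).
have iy y : m1.-integrable setT (fun x => (f (x, y))%:E).
  apply: (@integrable_bounded_support _ _ _ _ _ A `|M|) => // x.
  apply: (le_trans (fM x y)); rewrite !indicE.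
  have := ler_norm M; have := normr_ge0 M.
  by case: (x \in A); case: (y \in B) => /=; rewrite ?(mulr1,mulr0,mul0r).
have e1 : (\int[m1]_x (\int[m2]_y f (x, y))%:E = \int[m1]_x \int[m2]_y (f (x, y))%:E)%E.
  apply: eq_integral => x _.
  by rewrite /Rintegral fineK//; exact: integrable_fin_num.
have e2 : (\int[m2]_y (\int[m1]_x f (x, y))%:E = \int[m2]_y \int[m1]_x (f (x, y))%:E)%E.
  apply: eq_integral => y _.
  by rewrite /Rintegral fineK//; exact: integrable_fin_num.
split.
  rewrite [LHS]/Rintegral [RHS]/Rintegral e1 e2; congr fine.
  exact: (Fubini fi).
rewrite [LHS]/Rintegral e1 [RHS]/Rintegral; congr fine.
exact: (integral12_prod_meas1 fi).
Qed.

End sections_integrals.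

Section schwarz.
Context d (T : measurableType d) (R : realType).
Variable mu : {measure set T -> \bar R}.
Implicit Types (f g : T -> R).
Local Open Scope ereal_scope.

Lemma Lnorm2E f : 'N[mu]_2%:E[EFin \o f] = sqrte (\int[mu]_x ((f x ^+ 2)%R)%:E).
Proof.
rewrite unlock poweR12_sqrt; last by apply: integral_ge0 => x _; exact: poweR_ge0.
congr sqrte; apply: eq_integral => x _ /=.
by rewrite powR_mulrn// -normrX ger0_norm// sqr_ge0.
Qed.

Lemma integral_cauchy_schwarz f g :
  measurable_fun setT f -> measurable_fun setT g ->
  (\int[mu]_x (`|f x * g x|%R)%:E) ^+ 2 <=
  (\int[mu]_x ((f x ^+ 2)%R)%:E) * (\int[mu]_x ((g x ^+ 2)%R)%:E).
Proof.
move=> mf mg.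
have i0 (h : T -> R) : 0 <= \int[mu]_x ((h x ^+ 2)%R)%:E.
  by apply: integral_ge0 => x _; rewrite lee_fin sqr_ge0.
have := @hoelder _ _ _ mu f g 2 2 mf mg.
rewrite ltr0n => /(_ isT isT).
have -> : (2^-1 + 2^-1 = 1 :> R)%R by rewrite [RHS]splitr div1r.
move=> /(_ erefl); rewrite !Lnorm2E Lnorm1 => H.
rewrite -[leRHS]sqr_sqrte ?mule_ge0// lee_sqr ?sqrte_ge0//.
  by rewrite sqrteM.
by apply: integral_ge0.
Qed.

(** Cauchy-Schwarz for the product of sqrt(a) and sqrt(a) f. The integral on the left is
    real-valued, so the case where |a f| has infinite integral is treated apart. *)
Lemma integral_cauchy_schwarz_weight (a : T -> R) f :
  measurable_fun setT a -> measurable_fun setT f -> (forall x, 0 <= a x)%R ->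
  ((\int[mu]_x (a x * f x))%R%:E) ^+ 2 <=
  (\int[mu]_x (a x)%:E) * (\int[mu]_x ((a x * f x ^+ 2)%R)%:E).
Proof.
move=> ma mf a0.
have mra : measurable_fun setT (Num.sqrt \o a).
  by apply: measurableT_comp ma; apply: continuous_measurable_fun; exact: sqrt_continuous.
have mrf : measurable_fun setT (fun x => Num.sqrt (a x) * f x)%R.
  by apply: measurable_funM.
have := integral_cauchy_schwarz mra mrf.
under eq_integral do rewrite /= mulrA -expr2 sqr_sqrtr//.
under [X in _ <= X * _]eq_integral do rewrite /= sqr_sqrtr//.
under [X in _ <= _ * X]eq_integral do rewrite exprMn sqr_sqrtr//.
apply: le_trans.
set I := (X in _ <= X ^+ 2).
have I0 : 0 <= I by exact: integral_ge0.
have [Iy|Iy] := eqVneq I +oo; first by rewrite Iy expe2 (expe2 +oo) mulyy leey.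
have Ifin : I \is a fin_num by rewrite ge0_fin_numE// lt_neqAle Iy leey.
have fi : mu.-integrable setT (EFin \o (fun x => a x * f x)%R).
  apply/integrableP; split; first by apply/measurable_EFinP; exact: measurable_funM.
  by rewrite ltey.
have : `|(\int[mu]_x (a x * f x))%R|%:E <= I.
  have := le_normr_Rintegral measurableT fi.
  by rewrite -lee_fin => /le_trans; apply; rewrite /Rintegral fineK.
rewrite -(fineK Ifin) !expe2 -!EFinM !lee_fin -!expr2 => h.
by rewrite -real_normK ?num_real// ler_sqr// ?nnegrE// fine_ge0.
Qed.

End schwarz.

Section jensen.
Context d (T : measurableType d) (R : realType).
Variable mu : {measure set T -> \bar R}.
Hypothesis mu1 : mu setT = 1%E.
Local Open Scope ereal_scope.

(** Obtained from Hoelder's inequality against the constant 1 rather than from convexity; p = 1 is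
    separate because its conjugate exponent is infinite. *)
Lemma jensen_powR (f : T -> R) (p : R) : (1 <= p)%R -> measurable_fun setT f ->
  ((`|\int[mu]_x f x| `^ p)%R)%:E <= \int[mu]_x ((`|f x| `^ p)%R)%:E.
Proof.
move=> p1 mf.
have p0 : (0 < p)%R by exact: lt_le_trans p1.
have I0 : 0 <= \int[mu]_x ((`|f x| `^ p)%R)%:E.
  by apply: integral_ge0 => x _; rewrite lee_fin powR_ge0.
have key : \int[mu]_x (`|f x|%R)%:E <= (\int[mu]_x ((`|f x| `^ p)%R)%:E) `^ p^-1.
  move: p1; rewrite le_eqVlt => /predU1P[p1|p1].
    rewrite -p1 invr1 poweRe1; last first.
      by apply: integral_ge0 => x _; rewrite lee_fin powR_ge0.
    by under [leRHS]eq_integral do rewrite powRr1//.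
  have q0 : (0 < (1 - p^-1)^-1)%R by rewrite invr_gt0 subr_gt0 invf_lt1.
  have := @hoelder _ _ _ mu f (cst 1%R) p (1 - p^-1)^-1 mf (measurable_cst _) p0 q0.
  rewrite invrK addrC subrK => /(_ erefl).
  rewrite [X in _ * X](_ : _ = 1) ?mule1; last first.
    rewrite [LHS](_ : _ = 'N[mu]_(1 - p^-1)^-1%:E[cst 1]) //.
    by rewrite Lnorm_cst1 mu1 poweR1r.
  rewrite Lnorm1 unlock; congr (_ <= _).
  by apply: eq_integral => x _ /=; rewrite mulr1.
have [Iy|Iy] := eqVneq (\int[mu]_x ((`|f x| `^ p)%R)%:E) +oo; first by rewrite Iy leey.
have Ifin : \int[mu]_x ((`|f x| `^ p)%R)%:E \is a fin_num by rewrite ge0_fin_numE// lt_neqAle Iy leey.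
have fi : mu.-integrable setT (EFin \o f).
  apply/integrableP; split; first exact/measurable_EFinP.
  by apply: (le_lt_trans key); rewrite -(fineK Ifin) poweR_EFin ltry.
have : (`|\int[mu]_x f x|%R)%:E <= (\int[mu]_x ((`|f x| `^ p)%R)%:E) `^ p^-1.
  apply: le_trans key.
  have := le_normr_Rintegral measurableT fi.
  rewrite -lee_fin => /le_trans; apply; rewrite /Rintegral fineK//.
  exact: (integrable_fin_num measurableT (integrable_norm fi)).
rewrite -(fineK Ifin) poweR_EFin !lee_fin => h.
have /(ge0_ler_powR (ltW p0)) := h; rewrite !nnegrE powR_ge0 normr_ge0 => /(_ isT isT).
by rewrite -powRrM mulVf ?gt_eqF// powRr1// fine_ge0.
Qed.

End jensen.

(** * Borel structure of matrix spaces and invariance under translation *)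

Section matrix_measurability.
Context (R : realType).

Lemma mx_continuous (T : topologicalType) a b (g : T -> 'M[R]_(a, b)) :
  (forall i j, continuous (fun t => g t i j)) -> continuous g.
Proof.
move=> cg t A /nbhs_ballP[e /= e0 eA].
have H : \forall s \near t, forall i j, ball (g t i j) e (g s i j).
  apply: filter_forall => i; apply: filter_forall => j.
  exact: (cvg_ball (cg i j t) e0).
by apply: filterS H => s gs; apply: eA; split.
Qed.

Lemma continuous_borel (T : ptopologicalType) (f : T -> R) : continuous f ->
  measurable_fun setT (f : borel T -> R).
Proof.
move=> /continuousP cf; apply: (measurability _ (RGenOpens.measurableE R)).
move=> _ [_ [a [b ->] <-]]; rewrite setTI; apply: sub_sigma_algebra.
by apply: cf; exact: interval_open.
Qed.

Lemma measurable_coord a b i j :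
  measurable_fun setT (fun v : borel 'M[R]_(a, b) => v i j).
Proof.
apply: (@continuous_borel 'M[R]_(a, b) (fun v => v i j)).
exact: coord_continuous.
Qed.

(** Flattening the matrix to a row vector makes [open_rVE] available: an open set is a countable
    union of rational cubes, and membership in a cube is a finite set of conditions on entries. *)
Lemma measurable_mx d (T : measurableType d) a b (g : T -> 'M[R]_(a, b)) :
  (forall i j, measurable_fun setT (fun t => g t i j)) ->
  measurable_fun setT (g : T -> borel 'M[R]_(a, b)).
Proof.
move=> mg; apply: (@measurability _ _ _ (borel 'M[R]_(a, b)) _ _ open erefl).
move=> _ [A oA <-]; rewrite setTI.
have oA' : open (vec_mx @^-1` A : set 'rV[R]_(a * b)).
  apply: open_comp => // v _; apply: mx_continuous => i j.
  under eq_fun do rewrite mxE.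
  exact: coord_continuous.
rewrite (_ : g @^-1` A = (mxvec \o g) @^-1` (vec_mx @^-1` A)); last first.
  by apply/seteqP; split => t /=; rewrite mxvecK.
rewrite (open_rVE oA') preimage_bigcup bigcup_mkcond.
apply: countable_bigcupT_measurable => //= -[q N]; case: ifPn => // _.
set c : 'rV[R]__ := map_mx ratr q; set e := N.+1%:R^-1.
rewrite [X in measurable X](_ : _ =
  \bigcap_(ij in [set: 'I_a * 'I_b]) [set t | ball (c ord0 (mxvec_index ij.1 ij.2)) e (g t ij.1 ij.2)]).
  apply: fin_bigcap_measurable => // -[i j] _.
  rewrite -[X in measurable X]setTI.
  apply: (mg i j _ (ball (c ord0 (mxvec_index i j)) e)) => //.
  by rewrite ball_itv; exact: measurable_itv.
apply/seteqP; split => [t /= [_ ct] [i j] _ /=|t /= ct].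
  by have := ct ord0 (mxvec_index i j); rewrite mxvecE.
split => [|i0 l]; first by rewrite invr_gt0.
rewrite (ord1 i0); case/mxvec_indexP: l => i j; rewrite mxvecE.
by have := ct (i, j) I.
Qed.

(** Continuity speaks of the product topology, measurability of the product of the two Borel
    sigma-algebras. The passage between them goes through the concatenated row vector. *)
Lemma continuous_borel_prod k m (f : 'rV[R]_k * 'rV[R]_m -> R) : continuous f ->
  measurable_fun setT (f : borel 'rV[R]_k * borel 'rV[R]_m -> R).
Proof.
move=> cf.
have cl : continuous (lsubmx : 'rV[R]_(k + m) -> 'rV[R]_k).
  apply: mx_continuous => i j; under eq_fun do rewrite mxE.
  exact: coord_continuous.
have cr : continuous (rsubmx : 'rV[R]_(k + m) -> 'rV[R]_m).
  apply: mx_continuous => i j; under eq_fun do rewrite mxE.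
  exact: coord_continuous.
pose g (v : 'rV[R]_(k + m)) := f (lsubmx v, rsubmx v).
rewrite (_ : f = g \o (fun p => row_mx p.1 p.2)); last first.
  by apply/funext => -[x u]; rewrite /g /= row_mxKl row_mxKr.
apply: (@measurableT_comp _ _ _ _ (borel 'rV[R]_(k + m)) _).
  apply: continuous_borel => v; apply: continuous_comp; last exact: cf.
  exact: (cvg_pair (cl v) (cr v)).
apply: measurable_mx => i j; case: (split_ordP j) => l ->.
  under eq_fun do rewrite row_mxEl.
  exact: (measurableT_comp (measurable_coord _ _) measurable_fst).
under eq_fun do rewrite row_mxEr.
exact: (measurableT_comp (measurable_coord _ _) measurable_snd).
Qed.

End matrix_measurability.

Section measure_preserving.
Context d (T : measurableType d) (R : realType).

Definition measure_preserving (mu : set T -> \bar R) (s : T -> T) :=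
  measurable_fun setT s /\ forall A, measurable A -> mu (s @^-1` A) = mu A.

Variable mu : {measure set T -> \bar R}.

Lemma ge0_integral_preserving s (f : T -> \bar R) :
  measure_preserving mu s -> measurable_fun setT f -> (forall x, 0 <= f x)%E ->
  (\int[mu]_x f (s x) = \int[mu]_x f x)%E.
Proof.
move=> [ms smu] mf f0.
pose s' : {mfun T >-> T} := HB.pack s (isMeasurableFun.Build _ _ _ _ s ms).
have := @ge0_integral_pushforward _ _ _ _ _ s' ms mu setT f measurableT mf.
rewrite preimage_setT /= => <- //.
by apply: (@eq_measure_integral _ _ _ _ mu (pushforward mu s')) => A mA _; exact: smu.
Qed.

Lemma Rintegral_preserving s (f : T -> R) :
  measure_preserving mu s -> measurable_fun setT f ->
  \int[mu]_x f (s x) = \int[mu]_x f x.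
Proof.
move=> smu mf; rewrite /Rintegral; congr fine; rewrite integralE [RHS]integralE.
have mp : measurable_fun setT (EFin \o f)^\+%E.
  exact/measurable_funepos/measurable_EFinP.
have mn : measurable_fun setT (EFin \o f)^\-%E.
  exact/measurable_funeneg/measurable_EFinP.
rewrite -(ge0_integral_preserving smu mp) // -(ge0_integral_preserving smu mn) //.
by f_equal; [|f_equal]; apply: eq_integral => x _; rewrite ?(funeposE,funenegE).
Qed.

End measure_preserving.

Lemma measure_preserving_prod (R : realType) d1 d2 (T1 : measurableType d1)
    (T2 : measurableType d2) (m1 : {sigma_finite_measure set T1 -> \bar R})
    (m2 : {sigma_finite_measure set T2 -> \bar R}) s1 s2 :
  measure_preserving m1 s1 -> measure_preserving m2 s2 ->
  measure_preserving (m1 \x m2)%E (fun p => (s1 p.1, s2 p.2)).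
Proof.
move=> s1m s2m; have [ms1 _] := s1m; have [ms2 s2m2] := s2m; split.
  by apply: measurable_fun_pair; apply: measurableT_comp.
move=> A mA; rewrite /product_measure1 /=.
rewrite -[RHS](ge0_integral_preserving s1m)//; last exact: measurable_fun_xsection.
apply: eq_integral => x _ /=.
rewrite -(s2m2 (xsection A (s1 x))); last exact: measurable_xsection.
by congr (m2 _); apply/seteqP; split => y; rewrite /xsection /= !inE.
Qed.

Section translations.
Context (R : realType).

(** The translated measure agrees with Lebesgue measure on half-open intervals, which determine
    it. *)
Lemma lebesgue_measure_translate (a : R) :
  measure_preserving (@lebesgue_measure R) (fun x => x + a).
Proof.
have ms : measurable_fun setT (fun x : measurableTypeR R => x + a : measurableTypeR R).
  exact: measurable_funD.
split=> // A mA; symmetry.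
pose s' : {mfun measurableTypeR R >-> measurableTypeR R} :=
  HB.pack (fun x : measurableTypeR R => x + a : measurableTypeR R)
    (isMeasurableFun.Build _ _ _ _ _ ms).
apply: (lebesgue_measure_unique (mu := pushforward (@lebesgue_measure R) s')) => // X.
case=> -[b c] /= _ <-.
rewrite /pushforward /=.
rewrite (_ : _ @^-1` _ = `](b - a), (c - a)]%classic); last first.
  apply/seteqP; split => x /=; rewrite !in_itv /=; rewrite ltrBlDr lerBrDr; exact.
rewrite !lebesgue_measure_itv /= !lte_fin ltrD2r.
by case: ifP => //; rewrite -!EFinB opprB addrA subrK.
Qed.

Lemma measurable_translate a b (v : 'M[R]_(a, b)) :
  measurable_fun setT (fun w : borel 'M[R]_(a, b) => (w + v : borel 'M[R]_(a, b))).
Proof.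
apply: measurable_mx => i j; under eq_fun do rewrite mxE.
by apply: measurable_funD => //; exact: measurable_coord.
Qed.

Lemma lebesgue_rV_translate n (v : 'rV[R]_n) :
  measure_preserving (lebesgue_rV R n) (fun w => w + v).
Proof.
elim: n v => [v|n ih v].
  split; first exact: measurable_translate.
  by move=> A mA /=; congr (dirac _ _); apply/seteqP; split => w /=; rewrite !thinmx0.
split; first exact: measurable_translate.
move=> A mA.
rewrite /= /lebesgue_cons /pushforward.
have [_ /= h] := measure_preserving_prod (lebesgue_measure_translate (v ord0 ord0))
  (ih (\row_j v ord0 (lift ord0 j))).
have mA' : measurable (@rV_cons R n @^-1` A : set (measurableTypeR R * borel 'rV[R]_n)).
  by rewrite -[X in measurable X]setTI; apply: measurable_rV_cons.
rewrite -[RHS](h _ mA').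
congr (_ _); apply/seteqP; split => -[x w] /=;
  (rewrite (_ : rV_cons _ + _ = rV_cons (x + v ord0 ord0, w + \row_j v ord0 (lift ord0 j))) //);
  apply/rowP => j; rewrite !mxE; case: unliftP => [l ->|->] //=; by rewrite !mxE.
Qed.

End translations.

(** * Lebesgue measure on matrices *)

Section lebesgue_mx.
Context (R : realType) (m : nat).

Definition mx_cons n (p : 'rV[R]_m * 'M[R]_(n, m)) : 'M[R]_(n.+1, m) :=
  \matrix_(i < n.+1, j < m)
    if unlift ord0 i is Some l then p.2 l j else p.1 ord0 j.

Definition mx_uncons n (z : 'M[R]_(n.+1, m)) : 'rV[R]_m * 'M[R]_(n, m) :=
  (\row_j z ord0 j, \matrix_(i, j) z (lift ord0 i) j).

Lemma mx_cons0 n (p : 'rV[R]_m * 'M[R]_(n, m)) j : mx_cons p ord0 j = p.1 ord0 j.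
Proof. by rewrite mxE unlift_none. Qed.

Lemma mx_consS n (p : 'rV[R]_m * 'M[R]_(n, m)) i j :
  mx_cons p (lift ord0 i) j = p.2 i j.
Proof. by rewrite mxE liftK. Qed.

Lemma mx_consK n : cancel (@mx_cons n) (@mx_uncons n).
Proof.
move=> [w z]; rewrite /mx_uncons; congr pair.
  by apply/rowP => j; rewrite mxE mx_cons0.
by apply/matrixP => i j; rewrite mxE mx_consS.
Qed.

Lemma mx_unconsK n : cancel (@mx_uncons n) (@mx_cons n).
Proof.
move=> z; apply/matrixP => i j; rewrite mxE.
by case: unliftP => [l ->|->]; rewrite mxE.
Qed.

Lemma measurable_mx_cons n : measurable_fun setT
  (@mx_cons n : borel 'rV[R]_m * borel 'M[R]_(n, m) -> borel 'M[R]_(n.+1, m)).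
Proof.
apply: measurable_mx => i j; case: (unliftP ord0 i) => [l ->|->].
  under eq_fun do rewrite mx_consS.
  exact: (measurableT_comp (measurable_coord _ _) measurable_snd).
under eq_fun do rewrite mx_cons0.
exact: (measurableT_comp (measurable_coord _ _) measurable_fst).
Qed.

Lemma measurable_mx_uncons n : measurable_fun setT
  (@mx_uncons n : borel 'M[R]_(n.+1, m) -> (borel 'rV[R]_m * borel 'M[R]_(n, m))%type).
Proof.
apply: measurable_fun_pair; apply: measurable_mx => i j;
  by under eq_fun do rewrite mxE; exact: measurable_coord.
Qed.

HB.instance Definition _ n := isMeasurableFun.Build _ _ _ _
  (@mx_cons n : borel 'rV[R]_m * borel 'M[R]_(n, m) -> borel 'M[R]_(n.+1, m))
  (@measurable_mx_cons n).

Section cons.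
Variables (n : nat) (mu : {sigma_finite_measure set (borel 'M[R]_(n, m)) -> \bar R}).

Definition lebesgue_mx_cons : set (borel 'M[R]_(n.+1, m)) -> \bar R :=
  pushforward (lebesgue_rV R m \x mu)%E
    (@mx_cons n : borel 'rV[R]_m * borel 'M[R]_(n, m) -> borel 'M[R]_(n.+1, m)).

Let lebesgue_mx_cons0 : lebesgue_mx_cons set0 = 0%E.
Proof. exact: measure0. Qed.

Let lebesgue_mx_cons_ge0 A : (0 <= lebesgue_mx_cons A)%E.
Proof. exact: measure_ge0. Qed.

Let lebesgue_mx_cons_sigma_additive : semi_sigma_additive lebesgue_mx_cons.
Proof. exact: measure_semi_sigma_additive. Qed.

HB.instance Definition _ := isMeasure.Build _ _ _ lebesgue_mx_cons
  lebesgue_mx_cons0 lebesgue_mx_cons_ge0 lebesgue_mx_cons_sigma_additive.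

Let lebesgue_mx_cons_sigma_finite : sigma_finite setT lebesgue_mx_cons.
Proof.
have /sigma_finiteP[F [FT ndF Foo]] := sigma_finiteT (lebesgue_rV R m).
have /sigma_finiteP[G [GT ndG Goo]] := sigma_finiteT mu.
exists (fun i => @mx_uncons n @^-1` (F i `*` G i)).
  rewrite -preimage_bigcup (_ : \bigcup_i _ = setT) ?preimage_setT//.
  apply/seteqP; split => // -[w z] _.
  have : [set: borel 'rV[R]_m] w by [].
  rewrite FT => -[i _ Fiw].
  have : [set: borel 'M[R]_(n, m)] z by [].
  rewrite GT => -[j _ Gjz]; exists (maxn i j) => //; split.
    by move: Fiw; exact/subsetPset/ndF/leq_maxl.
  by move: Gjz; exact/subsetPset/ndG/leq_maxr.
move=> i; have [mF Fi] := Foo i; have [mG Gi] := Goo i; split.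
  rewrite -[X in measurable X]setTI; apply: measurable_mx_uncons => //.
  exact: measurableX.
rewrite /lebesgue_mx_cons /pushforward -comp_preimage.
rewrite (_ : _ \o _ = id) ?preimage_id; last exact/funext/mx_consK.
by rewrite product_measure1E// lte_mul_pinfty// ge0_fin_numE.
Qed.

HB.instance Definition _ := Measure_isSigmaFinite.Build _ _ _ lebesgue_mx_cons
  lebesgue_mx_cons_sigma_finite.

End cons.

(** Built row by row, so that the base point (row 0) and each direction row can be integrated out
    separately. *)
Fixpoint lebesgue_mx n : {sigma_finite_measure set (borel 'M[R]_(n, m)) -> \bar R} :=
  if n is n'.+1 then lebesgue_mx_cons (lebesgue_mx n')
  else @dirac _ (borel 'M[R]_(0, m)) (0 : 'M[R]_(0, m)) R.

Lemma lebesgue_mx_translate n (v : 'M[R]_(n, m)) :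
  measure_preserving (lebesgue_mx n) (fun w => w + v).
Proof.
elim: n v => [v|n ih v].
  split; first exact: measurable_translate.
  by move=> A mA /=; congr (dirac _ _); apply/seteqP; split => w /=; rewrite !flatmx0.
split; first exact: measurable_translate.
move=> A mA.
rewrite /= /lebesgue_mx_cons /pushforward.
have [_ /= h] := measure_preserving_prod (lebesgue_rV_translate (mx_uncons v).1)
  (ih (mx_uncons v).2).
have mA' : measurable (@mx_cons n @^-1` A : set (borel 'rV[R]_m * borel 'M[R]_(n, m))).
  by rewrite -[X in measurable X]setTI; apply: measurable_mx_cons.
rewrite -[RHS](h _ mA').
congr (_ _); apply/seteqP; split => -[x w] /=;
  (rewrite (_ : mx_cons _ + _ = mx_cons (x + (mx_uncons v).1, w + (mx_uncons v).2)) //);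
  apply/matrixP => i j; rewrite !mxE; case: unliftP => [l ->|->] //=; by rewrite !mxE.
Qed.

Lemma ge0_integral_lebesgue_mxS n (f : borel 'M[R]_(n.+1, m) -> \bar R) :
  measurable_fun setT f -> (forall z, 0 <= f z)%E ->
  (\int[lebesgue_mx n.+1]_z f z =
   \int[lebesgue_rV R m]_w \int[lebesgue_mx n]_z f (mx_cons (w, z)))%E.
Proof.
move=> mf f0.
rewrite [LHS](_ : _ = (\int[pushforward (lebesgue_rV R m \x lebesgue_mx n)
    (@mx_cons n : borel 'rV[R]_m * borel 'M[R]_(n, m) -> borel 'M[R]_(n.+1, m))]_z f z)%E) //.
rewrite (ge0_integral_pushforward (@measurable_mx_cons n)) ?preimage_setT//.
rewrite fubini_tonelli1//; last by move=> x; exact: f0.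
exact: (measurableT_comp mf (@measurable_mx_cons n)).
Qed.

Lemma Rintegral_lebesgue_mxS n (f : borel 'M[R]_(n.+1, m) -> R) (A : set (borel 'rV[R]_m))
    (B : set (borel 'M[R]_(n, m))) (M : R) :
  measurable_fun setT f -> measurable A -> measurable B ->
  (lebesgue_rV R m A < +oo)%E -> (lebesgue_mx n B < +oo)%E ->
  (forall w z, `|f (mx_cons (w, z))| <= M * (\1_A w * \1_B z)) ->
  \int[lebesgue_mx n.+1]_z f z =
  \int[lebesgue_mx n]_z \int[lebesgue_rV R m]_w f (mx_cons (w, z)).
Proof.
move=> mf mA mB Aoo Boo fM.
have mfc : measurable_fun setT (fun p : borel 'rV[R]_m * borel 'M[R]_(n, m) => f (mx_cons p)).
  exact: (measurableT_comp mf (@measurable_mx_cons n)).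
have [<- ->] := Rintegral_Fubini (m1 := lebesgue_rV R m) (m2 := lebesgue_mx n)
  mfc mA mB Aoo Boo fM.
rewrite /Rintegral; congr fine.
rewrite [LHS](_ : _ = (\int[pushforward (lebesgue_rV R m \x lebesgue_mx n)
    (@mx_cons n : borel 'rV[R]_m * borel 'M[R]_(n, m) -> borel 'M[R]_(n.+1, m))]_z (f z)%:E)%E) //.
have mp : measurable_fun setT (EFin \o f)^\+%E.
  exact/measurable_funepos/measurable_EFinP.
have mn : measurable_fun setT (EFin \o f)^\-%E.
  exact/measurable_funeneg/measurable_EFinP.
rewrite [LHS]integralE [RHS]integralE !(ge0_integral_pushforward (@measurable_mx_cons n)) //.
rewrite preimage_setT.
by f_equal; [|f_equal]; apply: eq_integral => x _;
  rewrite /= ?(funeposE,funenegE).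
Qed.

Definition mx_box n (A : 'I_n -> 'I_m -> set R) : set (borel 'M[R]_(n, m)) :=
  [set z | forall i j, A i j (z i j)].

Lemma mx_boxS n (A : 'I_n.+1 -> 'I_m -> set R) :
  @mx_cons n @^-1` mx_box A =
  rV_box (A ord0) `*` mx_box (fun i => A (lift ord0 i)).
Proof.
apply/seteqP; split => [[w z] /= Awz|[w z] /= [Aw Az] i j].
  split => [j|i j]; first by have := Awz ord0 j; rewrite mx_cons0.
  by have := Awz (lift ord0 i) j; rewrite mx_consS.
by case: (unliftP ord0 i) => [l ->|->]; rewrite ?mx_consS ?mx_cons0.
Qed.

Lemma measurable_mx_box n (A : 'I_n -> 'I_m -> set R) :
  (forall i j, measurable (A i j)) -> measurable (mx_box A).
Proof.
move=> mA.
rewrite [X in measurable X](_ : _ = \bigcap_(ij in [set: 'I_n * 'I_m])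
    ((fun z : borel 'M[R]_(n, m) => z ij.1 ij.2) @^-1` A ij.1 ij.2)).
  apply: fin_bigcap_measurable => // -[i j] _.
  by rewrite -[X in measurable X]setTI; apply: measurable_coord => //; exact: mA.
by apply/seteqP; split => [z Az [i j] _|z Az i j]; [exact: Az|exact: (Az (i, j))].
Qed.

Lemma lebesgue_mx_box n (A : 'I_n -> 'I_m -> set R) :
  (forall i j, measurable (A i j)) ->
  lebesgue_mx n (mx_box A) = (\prod_(i < n) \prod_(j < m) lebesgue_measure (A i j))%E.
Proof.
elim: n A => [A _|n ih A mA].
  by rewrite big_ord0 /= diracE mem_set// => -[].
rewrite big_ord_recl -ih//.
rewrite -(lebesgue_rV_box (mA ord0)) -(product_measure1E (lebesgue_rV R m) (lebesgue_mx n)).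
- by rewrite /= /lebesgue_mx_cons /pushforward mx_boxS.
- exact: (measurable_rV_box (mA ord0)).
- exact: (measurable_mx_box (fun i => mA (lift ord0 i))).
Qed.

End lebesgue_mx.

(** * One averaged row turns a difference into a gain *)

Section row_smoothing.
Context (R : realType) (m : nat).
Local Notation leb := (lebesgue_rV R m).
Local Notation V := (borel 'rV[R]_m).

Definition sqnorm (H : 'rV[R]_m -> R) : \bar R := (\int[leb]_u (H u ^+ 2)%R%:E)%E.

Lemma sqnorm_ge0 H : (0 <= sqnorm H)%E.
Proof. by apply: integral_ge0 => u _; rewrite lee_fin sqr_ge0. Qed.

Lemma measurable_affine d (T : measurableType d) (f g : T -> V) (h : T -> R) :
  measurable_fun setT f -> measurable_fun setT g -> measurable_fun setT h ->
  measurable_fun setT (fun x => (f x + h x *: (g x : 'rV[R]_m) : V)).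
Proof.
move=> mf mg mh; apply: measurable_mx => i j; under eq_fun do rewrite !mxE.
apply: measurable_funD; first exact: (measurableT_comp (measurable_coord i j) mf).
by apply: measurable_funM => //; exact: (measurableT_comp (measurable_coord i j) mg).
Qed.

Lemma measurable_addV d (T : measurableType d) (f g : T -> V) :
  measurable_fun setT f -> measurable_fun setT g ->
  measurable_fun setT (fun x => (f x + g x : V)).
Proof.
move=> mf mg; apply: measurable_mx => i j; under eq_fun do rewrite !mxE.
apply: measurable_funD; first exact: (measurableT_comp (measurable_coord i j) mf).
exact: (measurableT_comp (measurable_coord i j) mg).
Qed.

Lemma sqnorm_translate (H : 'rV[R]_m -> R) v : measurable_fun setT (H : V -> R) ->
  sqnorm (fun u => H (u + v)) = sqnorm H.
Proof.
move=> mH; rewrite /sqnorm.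
have mH2 : measurable_fun setT (fun u : V => (H u ^+ 2)%:E).
  by apply/measurable_EFinP; exact: measurable_funX.
rewrite -[RHS](ge0_integral_preserving (lebesgue_rV_translate v) mH2)//.
by move=> u; rewrite lee_fin sqr_ge0.
Qed.

(** Young's inequality, L^1 against L^2: Cauchy-Schwarz with weight |b|, then Tonelli and
    translation invariance. The scale t of the shift disappears because for each w the function K is
    merely translated. *)
Lemma sqnorm_average (b K : 'rV[R]_m -> R) (B : set V) (Mb MK t beta : R) :
  measurable_fun setT (b : V -> R) -> measurable_fun setT (K : V -> R) ->
  measurable B -> (leb B < +oo)%E -> (forall w, `|b w| <= Mb * \1_B w) ->
  (forall u, `|K u| <= MK) ->
  (\int[leb]_w (`|b w|%R)%:E <= beta%:E)%E ->
  (sqnorm (fun u => \int[leb]_w (b w * K (u + t *: w)))%R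
    <= (beta ^+ 2)%:E * sqnorm K)%E.
Proof.
move=> mb mK mB Boo bM KM bbeta.
have mKj : measurable_fun setT (fun p : V * V => K (p.1 + t *: p.2)).
  apply: (measurableT_comp mK).
  exact: (measurable_affine (h := cst t) measurable_fst measurable_snd).
have mKw u : measurable_fun setT (fun w : V => K (u + t *: w)).
  by apply: (@measurableT_comp _ _ _ _ _ _ (fun p : V * V => K (p.1 + t *: p.2)) _ (pair u)).
have mab : measurable_fun setT (fun w : V => `|b w|) by apply: measurableT_comp.
have beta0 : 0 <= beta.
  by rewrite -lee_fin; apply: le_trans bbeta; exact: integral_ge0.
have h1 (u : V) : (((\int[leb]_w (b w * K (u + t *: w))%R) ^+ 2)%:E <=
    beta%:E * \int[leb]_w (`|b w| * K (u + t *: w) ^+ 2)%R%:E)%E.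
  have mabK : measurable_fun setT (fun w : V => `|b w| * `|K (u + t *: w)|).
    by apply: measurable_funM => //; apply: measurableT_comp.
  apply: (@le_trans _ _ ((\int[leb]_w (`|b w| * `|K (u + t *: w)|))%R%:E ^+ 2)%E).
    rewrite expe2 -EFinM lee_fin -expr2 -real_normK ?num_real// ler_sqr ?nnegrE//; last first.
      by apply: Rintegral_ge0 => w _; exact: mulr_ge0.
    under [leRHS]eq_Rintegral do rewrite -normrM.
    apply: le_normr_Rintegral => //.
    apply: (integrable_bounded_support (A := B) (M := Mb * MK)) => //.
      exact: measurable_funM.
    move=> w; rewrite normrM mulrAC.
    by apply: ler_pM.
  have mnK : measurable_fun setT (fun w : V => `|K (u + t *: w)|).
    exact: measurableT_comp.
  apply: (le_trans (@integral_cauchy_schwarz_weight _ _ _ leb _ _ mab mnK _)) => //.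
  apply: lee_pmul => //; try exact: integral_ge0.
  by under eq_integral do rewrite real_normK ?num_real//.
have mbK : measurable_fun setT (fun p : V * V => `|b p.2| * K (p.1 + t *: p.2) ^+ 2).
  apply: measurable_funM; first exact: (measurableT_comp mab measurable_snd).
  exact: measurable_funX.
have mI : measurable_fun setT
    (fun u : V => \int[leb]_w (`|b w| * K (u + t *: w) ^+ 2)%R%:E)%E.
  apply: (@measurable_fun_fubini_tonelli_F _ _ _ _ _ leb
    (fun p : V * V => (`|b p.2| * K (p.1 + t *: p.2) ^+ 2)%R%:E)).
    exact/measurable_EFinP.
  by move=> p; rewrite lee_fin mulr_ge0// sqr_ge0.
have I0 (u : V) : (0 <= \int[leb]_w (`|b w| * K (u + t *: w) ^+ 2)%R%:E)%E.
  by apply: integral_ge0 => w _; rewrite lee_fin mulr_ge0// sqr_ge0.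
apply: (@le_trans _ _ (\int[leb]_u (beta%:E * \int[leb]_w (`|b w| * K (u + t *: w) ^+ 2)%R%:E))%E).
  apply: ge0_le_integral => //.
  - by move=> u _; rewrite lee_fin sqr_ge0.
  - apply/measurable_EFinP; apply: measurable_funX.
    apply: (measurable_Rintegral2 leb (f := fun p : V * V => b p.2 * K (p.1 + t *: p.2))).
    apply: measurable_funM => //.
    exact: (measurableT_comp mb measurable_snd).
  - by apply: emeasurable_funM.
rewrite ge0_integralZl//.
rewrite expr2 EFinM -muleA; apply: lee_pmul => //; first exact: integral_ge0.
rewrite (@fubini_tonelli _ _ _ _ _ leb leb (fun p : V * V => (`|b p.2| * K (p.1 + t *: p.2) ^+ 2)%R%:E)); last 2 first.
- exact/measurable_EFinP.
- by move=> p; rewrite lee_fin mulr_ge0// sqr_ge0.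
rewrite /fubini_G /=.
have mK2 v : measurable_fun setT (fun u : V => (K (u + v) ^+ 2)%:E).
  apply/measurable_EFinP; apply: measurable_funX.
  exact: (measurableT_comp mK (measurable_translate v)).
have step (w : V) : (\int[leb]_u (`|b w| * K (u + t *: w) ^+ 2)%R%:E =
    (`|b w|%R)%:E * sqnorm K)%E.
  rewrite -(sqnorm_translate (t *: w))// /sqnorm -ge0_integralZl//.
  by move=> u _; rewrite lee_fin sqr_ge0.
under eq_integral do rewrite step.
rewrite ge0_integralZr//; [|exact/measurable_EFinP|exact: sqnorm_ge0].
by apply: lee_pmul => //; [exact: integral_ge0|exact: sqnorm_ge0].
Qed.

End row_smoothing.

(** The Weierstrass product inequality, each factor truncated at 0 because disjoint intervals have
    overlap 0 and not a negative one. *)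
Lemma prod_onem_ge (R : realDomainType) n (a : 'I_n -> R) :
  (forall i, 0 <= a i) -> 1 - \sum_i a i <= \prod_i Num.max 0 (1 - a i) <= 1.
Proof.
elim: n a => [|n ih] a a0; first by rewrite !big_ord0 subr0 lexx.
rewrite !big_ord_recl.
have /andP[] := ih (fun i => a (lift ord0 i)) (fun i => a0 _).
have S0 : 0 <= \sum_i a (lift ord0 i) by apply: sumr_ge0.
have P0 : 0 <= \prod_i Num.max 0 (1 - a (lift ord0 i)).
  by apply: prodr_ge0 => i _; rewrite le_max lexx.
move: S0 P0; set P := \prod_i _; set S := \sum_i _ => S0 P0 h1 h2.
have a00 := a0 ord0.
have M0 : 0 <= Num.max 0 (1 - a ord0) by rewrite le_max lexx.
have M1 : Num.max 0 (1 - a ord0) <= 1 by rewrite ge_max ler01 gerBl.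
have Ma : 1 - a ord0 <= Num.max 0 (1 - a ord0) by rewrite le_max lexx orbT.
move: M0 M1 Ma; set M := Num.max _ _ => M0 M1 Ma.
by apply/andP; split; nra.
Qed.

Section box_difference.
Context (R : realType) (m : nat).
Local Notation leb := (lebesgue_rV R m).
Local Notation V := (borel 'rV[R]_m).

Definition cube_at (c : 'rV[R]_m) (l : R) : set V :=
  rV_box (fun j => `[c ord0 j, c ord0 j + l]%classic).

Lemma measurable_cube_at c l : measurable (cube_at c l).
Proof. by apply: measurable_rV_box => i; exact: measurable_itv. Qed.

Lemma lebesgue_cube_at c l : 0 <= l -> leb (cube_at c l) = (l ^+ m)%:E.
Proof.
move=> l0; rewrite lebesgue_rV_box; last by move=> i; exact: measurable_itv.
under eq_bigr do rewrite lebesgue_measure_itv /= lte_fin ltrDl.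
rewrite (_ : (l ^+ m) = \prod_(i < m) l); last by rewrite prodr_const card_ord.
rewrite -prodEFin; apply: eq_bigr => i _; case: ltP => [|l0'].
  by rewrite -EFinB addrC addKr.
by congr EFin; apply/eqP; rewrite eq_le l0 l0'.
Qed.

Lemma lebesgue_cube_overlap c a l : 0 < l ->
  leb (cube_at c l `&` cube_at (c + a) l) =
  (l ^+ m * \prod_i Num.max 0 (1 - `|a ord0 i| / l))%:E.
Proof.
move=> l0; set lhs := (LHS).
pose I j : set R := `[Num.max (c ord0 j) (c ord0 j + a ord0 j),
               Num.min (c ord0 j) (c ord0 j + a ord0 j) + l]%classic.
have -> : lhs = leb (rV_box I).
  congr (leb _); apply/seteqP; split => [v [/= v1 v2] j|v /= vI].
    have := v1 j; have := v2 j; rewrite /= !in_itv /= mxE => /andP[u1 u3] /andP[u2 u4].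
    by rewrite /I /= in_itv /= ge_max u1 u2 minElt; case: ifP => _; rewrite ?u3 ?u4.
  have vI' j : [&& c ord0 j <= v ord0 j, c ord0 j + a ord0 j <= v ord0 j,
      v ord0 j <= c ord0 j + l & v ord0 j <= c ord0 j + a ord0 j + l].
    have := vI j; rewrite /I /= in_itv /= ge_max => /andP[/andP[-> ->] /=] vm.
    by apply/andP; split; apply: (le_trans vm); rewrite lerD2r ge_min lexx ?orbT.
  by split => j; have /and4P[u1 u2 u3 u4] := vI' j; rewrite /= in_itv /= ?mxE; apply/andP.
rewrite lebesgue_rV_box; last by move=> i; exact: measurable_itv.
rewrite (_ : (l ^+ m) = \prod_(i < m) l); last by rewrite prodr_const card_ord.
rewrite -big_split -prodEFin; apply: eq_bigr => i _ /=.
rewrite lebesgue_measure_itv /= lte_fin.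
set ci := c ord0 i; set ai := a ord0 i.
have e : Num.min ci (ci + ai) + l - Num.max ci (ci + ai) = l * (1 - `|ai| / l).
  rewrite mulrBr mulr1 mulrCA divff ?gt_eqF// mulr1.
  case: (ltP 0 ai) => h.
    by rewrite gtr0_norm// min_l ?max_r ?lerDl ?ltW//; ring.
  by rewrite ler0_norm// min_r ?max_l ?gerDl//; ring.
case: ltP => [|h].
  rewrite -subr_gt0 e pmulr_rgt0// => h; rewrite [Num.max 0 _]max_r ?ltW//.
  by rewrite -EFinB e.
rewrite [Num.max 0 _]max_l ?mulr0// -(pmulr_rle0 _ l0) -e subr_le0.
exact: h.
Qed.

(** The symmetric difference of two cubes of volume l^m has twice the measure of l^m minus the
    overlap. The overlap is a product over the coordinates, and [prod_onem_ge] bounds its deficit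
    both by 1 and by the sum of the relative shifts. *)
Lemma integral_cube_difference c a l : 0 < l ->
  (\int[leb]_w (`|\1_(cube_at c l) w - \1_(cube_at (c + a) l) w|%R)%:E <=
   (2 * l ^+ m * Num.min 1 (\sum_i `|a ord0 i| / l))%:E)%E.
Proof.
move=> l0; set A := cube_at c l; set B := cube_at (c + a) l.
have mA : measurable A by exact: measurable_cube_at.
have mB : measurable B by exact: measurable_cube_at.
have mAB : measurable (A `&` B) by exact: measurableI.
have Aoo : leb A = (l ^+ m)%:E by apply: lebesgue_cube_at; exact: ltW.
have Boo : leb B = (l ^+ m)%:E by apply: lebesgue_cube_at; exact: ltW.
have ABoo : leb (A `&` B) = (l ^+ m * \prod_i Num.max 0 (1 - `|a ord0 i| / l))%:E.
  exact: lebesgue_cube_overlap.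
have -> : (\int[leb]_w (`|\1_A w - \1_B w|%R)%:E = leb (A `\` B) + leb (B `\` A))%E.
  have := integral_indic leb measurableT (measurableD mA mB).
  have := integral_indic leb measurableT (measurableD mB mA).
  rewrite !setIT => <- <-.
  have mi C : measurable C -> measurable_fun setT (fun w : V => (\1_C w)%:E : \bar R).
    by move=> mC; apply/measurable_EFinP; exact: measurable_indic.
  rewrite -ge0_integralD//; try by apply: mi; exact: measurableD.
  apply: eq_integral => w _; rewrite -EFinD; congr EFin.
  rewrite !indicE !in_setD.
  by case: (w \in A); case: (w \in B); rewrite /= ?subrr ?subr0 ?sub0r ?normrN ?normr0 ?normr1 ?addr0 ?add0r.
have P := prod_onem_ge (fun i => divr_ge0 (normr_ge0 (a ord0 i)) (ltW l0)).
have mD C D : measurable C -> measurable D -> (leb C < +oo)%E ->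
    (leb (C `\` D) = leb C - leb (C `&` D))%E by move=> mC mD Coo; exact: measureD.
rewrite mD ?Aoo ?ltry// mD ?Boo ?ltry// [B `&` A]setIC ABoo.
rewrite -!EFinB -EFinD lee_fin.
move: P; set S := \sum_i _; set P := \prod_i _ => /andP[P1 P2].
have lm : 0 < l ^+ m by exact: exprn_gt0.
have P0 : 0 <= P by apply: prodr_ge0 => i _; rewrite le_max lexx.
by rewrite minElt; case: ifP => _; nra.
Qed.

End box_difference.

Lemma ge0_le_integralT d (T : measurableType d) (R : realType)
    (mu : {measure set T -> \bar R}) (f g : T -> \bar R) :
  (forall x, 0 <= f x)%E -> measurable_fun setT f -> measurable_fun setT g ->
  (forall x, f x <= g x)%E -> (\int[mu]_x f x <= \int[mu]_x g x)%E.
Proof.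
by move=> f0 mf mg fg; apply: ge0_le_integral => //.
Qed.

Section difference_smoothing.
Context (R : realType) (m : nat).
Local Notation leb := (lebesgue_rV R m).
Local Notation V := (borel 'rV[R]_m).

(** For r > 0 this is min(1, r / |t|), arranged so that t = 0 gives 1. *)
Definition gain (r t : R) : R := if `|t| <= r then 1 else r / `|t|.

Lemma gain_ge0 r t : 0 < r -> 0 <= gain r t.
Proof. by move=> r0; rewrite /gain; case: ifP => // _; rewrite divr_ge0// ltW. Qed.

(** The factor 2 l^m comes from [integral_cube_difference]. The factor 1 + m B / l serves both
    branches of [gain]: in the second one, each of the m coordinates contributes B r / (|t| l). *)
Definition row_const (B l : R) : R := 2 * l ^+ m * (1 + m%:R * B / l).

Lemma row_const_ge0 B l : 0 <= B -> 0 < l -> 0 <= row_const B l.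
Proof.
move=> B0 l0; have h : 0 <= m%:R * B / l by rewrite divr_ge0// ?mulr_ge0// ltW.
by have lm := exprn_gt0 m l0; rewrite /row_const; nra.
Qed.

Lemma sqnormB_le (f g : 'rV[R]_m -> R) :
  measurable_fun setT (f : V -> R) -> measurable_fun setT (g : V -> R) ->
  (sqnorm (fun u => f u - g u)%R <= 2%:E * sqnorm f + 2%:E * sqnorm g)%E.
Proof.
move=> mf mg; rewrite /sqnorm.
have m2 (h : V -> R) : measurable_fun setT h ->
    measurable_fun setT (fun u : V => (h u ^+ 2)%R%:E).
  by move=> mh; apply/measurable_EFinP; exact: measurable_funX.
have p2 (h : V -> R) x : (0 <= (h x ^+ 2)%R%:E :> \bar R)%E by rewrite lee_fin sqr_ge0.
have e2 (h : V -> R) : measurable_fun setT h -> (2%:E * \int[leb]_u (h u ^+ 2)%R%:E =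
    \int[leb]_u (2 * h u ^+ 2)%R%:E)%E.
  by move=> mh; rewrite -ge0_integralZl//; exact: m2.
have m22 (h : V -> R) : measurable_fun setT h ->
    measurable_fun setT (fun u : V => (2 * h u ^+ 2)%R%:E).
  move=> mh; apply/measurable_EFinP; apply: measurable_funM => //.
  exact: measurable_funX.
rewrite !e2// -ge0_integralD//; try exact: (m22 f); try exact: (m22 g);
  try by move=> x _; rewrite lee_fin mulr_ge0// sqr_ge0.
apply: ge0_le_integralT => //.
- by move=> x; rewrite lee_fin sqr_ge0.
- by apply: (m2 (fun u => f u - g u)); exact: measurable_funB.
- by apply: emeasurable_funD; [exact: (m22 f)|exact: (m22 g)].
- move=> u; rewrite -EFinD lee_fin -subr_ge0.
  by rewrite (_ : _ - _ = (f u + g u) ^+ 2) ?sqr_ge0//; ring.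
Qed.

Lemma eq_sqnorm (f g : 'rV[R]_m -> R) : f =1 g -> sqnorm f = sqnorm g.
Proof. by move=> /funext ->. Qed.

Section row.
Variables (c : 'rV[R]_m) (l B r : R) (v : 'rV[R]_m).
Hypotheses (l0 : 0 < l) (B0 : 0 <= B) (r0 : 0 < r).
Hypothesis vB : forall j, `|v ord0 j| <= B * r.

(** For t other than 0, shifting K by v amounts to shifting the averaging variable w by v / t. The
    difference therefore falls on the indicator of the cube, whose change is small in L^1 as soon as
    v / t is small, and [sqnorm_average] concludes. *)
Lemma sqnorm_row_difference (K : 'rV[R]_m -> R) (M t : R) :
  measurable_fun setT (K : V -> R) -> (forall u, `|K u| <= M) ->
  (sqnorm (fun u => \int[leb]_w (\1_(cube_at c l) w * (K (u + t *: w) - K (u + t *: w + v))))%R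
   <= ((row_const B l * gain r t) ^+ 2)%:E * sqnorm K)%E.
Proof.
move=> mK KM.
have Foo c' : (leb (cube_at c' l) < +oo)%E by rewrite lebesgue_cube_at ?ltry// ltW.
have mC (c' : 'rV[R]_m) : measurable (cube_at c' l) by exact: measurable_cube_at.
have mKw u : measurable_fun setT (fun w : V => K (u + t *: w)).
  apply: (measurableT_comp mK).
  by apply: (measurable_affine (f := cst u) (g := id) (h := cst t)) => //.
have mKwv u : measurable_fun setT (fun w : V => K (u + t *: w + v)).
  by under eq_fun do rewrite addrAC; exact: mKw.
have i1 c' (g : V -> R) : measurable_fun setT g -> (forall w, `|g w| <= M) ->
    leb.-integrable setT (EFin \o (fun w : V => \1_(cube_at c' l) w * g w)).
  move=> mg gM; apply: (integrable_bounded_support (M := M) _ (mC c') (Foo c')).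
    by apply: measurable_funM => //; apply: measurable_indic; exact: mC.
  move=> w; rewrite normrM mulrC (ger0_norm (_ : 0 <= \1__ w))//.
  by apply: ler_wpM2r.
have lm0 : 0 < l ^+ m by exact: exprn_gt0.
have mBl : 0 <= m%:R * B / l by rewrite divr_ge0// ?mulr_ge0// ltW.
have mul1 (c' : 'rV[R]_m) (g : 'rV[R]_m -> R) : measurable_fun setT (g : V -> R) -> (forall w, `|g w| <= M) -> forall t',
    (sqnorm (fun u => \int[leb]_w (\1_(cube_at c' l) w * g (u + t' *: w)))%R
     <= ((l ^+ m) ^+ 2)%:E * sqnorm g)%E.
  move=> mg gM t'.
  have mi : measurable_fun setT (\1_(cube_at c' l) : V -> R).
    by apply: measurable_indic; exact: mC.
  have := @sqnorm_average R m \1_(cube_at c' l) g (cube_at c' l) 1 M t' (l ^+ m) mi mg (mC c') (Foo c') _ gM.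
  apply.
  - by move=> w; rewrite ger0_norm// mul1r.
  - under eq_integral do rewrite ger0_norm//.
    rewrite (integral_indic leb measurableT (mC c')) setIT.
    by rewrite [X in (X <= _)%E](lebesgue_cube_at c' (ltW l0)).
pose Kv u := K (u + v).
have mKv : measurable_fun setT (Kv : V -> R).
  exact: (measurableT_comp mK (measurable_translate v)).
have KvM u : `|Kv u| <= M by exact: KM.
have mKvw u : measurable_fun setT (fun w : V => Kv (u + t *: w)) by exact: mKwv.
have iK c' u := i1 c' _ (mKw u) (fun w => KM _).
have iKv c' u := i1 c' _ (mKvw u) (fun w => KvM _).
have split_int u : \int[leb]_w (\1_(cube_at c l) w * (K (u + t *: w) - K (u + t *: w + v))) =
    \int[leb]_w (\1_(cube_at c l) w * K (u + t *: w)) -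
    \int[leb]_w (\1_(cube_at c l) w * Kv (u + t *: w)).
  rewrite -(RintegralB measurableT (iK c u) (iKv c u)).
  by under eq_Rintegral do rewrite mulrBr.
rewrite (eq_sqnorm split_int).
(* At t = 0 the shift cannot be moved onto w. There [gain] is 1, and bounding the two terms of the
   difference separately already gives (2 l^m)^2. *)
have [t0|t0] := eqVneq t 0.
  have -> : gain r t = 1 by rewrite /gain t0 normr0 ltW.
  have mA (g : 'rV[R]_m -> R) : measurable_fun setT (g : V -> R) -> measurable_fun setT
      (fun u : V => \int[leb]_w (\1_(cube_at c l) w * g (u + t *: w))).
    move=> mg.
    apply: (measurable_Rintegral2 leb (f := fun p : V * V => \1_(cube_at c l) p.2 * g (p.1 + t *: p.2))).
    apply: measurable_funM.
      exact: (measurableT_comp (measurable_indic (mC c)) measurable_snd).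
    apply: (measurableT_comp mg).
    exact: (measurable_affine (h := cst t) measurable_fst measurable_snd).
  apply: (le_trans (sqnormB_le (mA _ mK) (mA _ mKv))).
  have h1 := mul1 c K mK KM t; have h2 := mul1 c Kv mKv KvM t.
  rewrite (_ : sqnorm Kv = sqnorm K) in h2; last exact: sqnorm_translate.
  apply: (@le_trans _ _ (2%:E * (((l ^+ m) ^+ 2)%:E * sqnorm K) + 2%:E * (((l ^+ m) ^+ 2)%:E * sqnorm K))%E).
    by apply: leeD; apply: lee_wpmul2l => //; rewrite lee_fin.
  rewrite !muleA -!EFinM -ge0_muleDl ?lee_fin ?mulr_ge0 ?sqr_ge0 ?(ltW lm0)// -EFinD.
  apply: lee_pmul => //; first by rewrite lee_fin; nra.
    exact: sqnorm_ge0.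
  rewrite lee_fin mulr1 /row_const !exprMn.
  have : 1 <= (1 + m%:R * B / l) ^+ 2 by nra.
  have := sqr_ge0 (l ^+ m); nra.
(* Since t w + v = t (w + a), the shifted term is an average of K itself over the cube translated by
   a. *)
pose a := t^-1 *: v.
have shift u : \int[leb]_w (\1_(cube_at c l) w * Kv (u + t *: w)) =
    \int[leb]_w (\1_(cube_at (c + a) l) w * K (u + t *: w)).
  rewrite -(Rintegral_preserving (lebesgue_rV_translate a)
    (f := fun w => \1_(cube_at (c + a) l) w * K (u + t *: w))); last first.
    by apply: measurable_funM => //; exact: measurable_indic.
  apply: eq_Rintegral => w _; congr (_ * _).
    rewrite !indicE; congr (_%:R); congr nat_of_bool.
    apply/idP/idP; rewrite !inE => H j; have := H j; rewrite /= !in_itv /= !mxE;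
      by rewrite addrAC !lerD2r.
  by rewrite /Kv /a scalerDr scalerA mulfV// scale1r addrA.
have comb u : \int[leb]_w (\1_(cube_at c l) w * K (u + t *: w)) -
    \int[leb]_w (\1_(cube_at c l) w * Kv (u + t *: w)) =
    \int[leb]_w ((\1_(cube_at c l) w - \1_(cube_at (c + a) l) w) * K (u + t *: w)).
  rewrite shift -(RintegralB measurableT (iK c u) (iK (c + a) u)).
  by apply: eq_Rintegral => w _; rewrite mulrBl.
rewrite (eq_sqnorm comb).
have mU : measurable (cube_at c l `|` cube_at (c + a) l) by exact: measurableU.
apply: (@le_trans _ _ (((2 * l ^+ m * Num.min 1 (\sum_i `|a ord0 i| / l)) ^+ 2)%:E * sqnorm K)%E).
  apply: (sqnorm_average (B := cube_at c l `|` cube_at (c + a) l) (Mb := 1) (MK := M)) => //.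
  - by apply: measurable_funB; exact: measurable_indic.
  - apply: (le_lt_trans (measureU2 _ _ _)) => //.
    by apply: lte_add_pinfty; exact: Foo.
  - move=> w; rewrite mul1r !indicE in_setU.
    by case: (w \in _); case: (w \in _); rewrite /= ?subrr ?subr0 ?sub0r ?normrN ?normr0 ?normr1.
  - exact: integral_cube_difference.
have S0 : 0 <= \sum_i `|a ord0 i| / l.
  by apply: sumr_ge0 => i _; rewrite divr_ge0// ltW.
apply: lee_pmul => //; [by rewrite lee_fin sqr_ge0|exact: sqnorm_ge0|].
have gr0 := gain_ge0 t r0.
rewrite lee_fin ler_sqr ?nnegrE; last 2 first.
- by rewrite mulr_ge0// ?(mulr_ge0 _ (ltW lm0))// le_min ler01.
- by rewrite mulr_ge0// row_const_ge0.
rewrite /row_const -[leRHS](mulrA (2 * l ^+ m)) ler_pM2l ?mulr_gt0// /gain; case: ifP => ht.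
  by rewrite mulr1 ge_min; apply/orP; left; rewrite lerDl.
rewrite ge_min; apply/orP; right.
have tp : 0 < `|t| by rewrite normr_gt0.
apply: (@le_trans _ _ (\sum_(i < m) (B * r / `|t| / l))).
  apply: ler_sum => i _; rewrite ler_pM2r ?invr_gt0// mxE normrM normfV mulrC.
  by rewrite ler_pM2r// invr_gt0.
rewrite sumr_const card_ord -[leLHS]mulr_natl.
have -> : m%:R * (B * r / `|t| / l) = (m%:R * B / l) * (r / `|t|) by ring.
by rewrite ler_wpM2r ?lerDr// divr_ge0 ?ltW.
Qed.

End row.
End difference_smoothing.

(** * As many differences as rows *)

Section iterated_smoothing.
Context (R : realType) (m : nat).
Local Notation leb := (lebesgue_rV R m).
Local Notation V := (borel 'rV[R]_m).

Fixpoint diffs (vs : seq 'rV[R]_m) (H : 'rV[R]_m -> R) : 'rV[R]_m -> R :=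
  if vs is v :: vs' then fun u => diffs vs' H u - diffs vs' H (u + v) else H.

Lemma measurable_diffs vs H : measurable_fun setT (H : V -> R) ->
  measurable_fun setT (diffs vs H : V -> R).
Proof.
elim: vs => [//|v vs ih] mH /=; apply: measurable_funB; first exact: ih.
exact: (measurableT_comp (ih mH) (measurable_translate v)).
Qed.

Lemma diffs_bounded vs H (M : R) : (forall u, `|H u| <= M) ->
  forall u, `|diffs vs H u| <= 2 ^+ size vs * M.
Proof.
move=> HM; elim: vs => [|v vs ih] u /=; first by rewrite mul1r.
apply: (le_trans (ler_normB _ _)); rewrite exprS -mulrA mulr_natl mulr2n.
by apply: lerD; exact: ih.
Qed.

Definition mx_cube n (c : 'M[R]_(n, m)) (l : R) : set (borel 'M[R]_(n, m)) :=
  mx_box (fun i j => `[c i j, c i j + l]%classic).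

Lemma measurable_mx_cube n (c : 'M[R]_(n, m)) l : measurable (mx_cube c l).
Proof. by apply: measurable_mx_box => i j; exact: measurable_itv. Qed.

Lemma lebesgue_mx_cube n (c : 'M[R]_(n, m)) l : 0 <= l ->
  lebesgue_mx R m n (mx_cube c l) = (l ^+ (n * m))%:E.
Proof.
move=> l0; rewrite lebesgue_mx_box; last by move=> i j; exact: measurable_itv.
rewrite mulnC exprM (_ : (l ^+ m) ^+ n = \prod_(i < n) l ^+ m); last by rewrite prodr_const card_ord.
rewrite -prodEFin; apply: eq_bigr => i _.
rewrite (_ : l ^+ m = \prod_(i < m) l); last by rewrite prodr_const card_ord.
rewrite -prodEFin; apply: eq_bigr => j _.
rewrite lebesgue_measure_itv /= lte_fin ltrDl; case: ltP => [|l0'].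
  by rewrite -EFinB addrC addKr.
by congr EFin; apply/eqP; rewrite eq_le l0 l0'.
Qed.

Lemma indic_mx_cubeS n (c : 'M[R]_(n.+1, m)) l w z :
  \1_(mx_cube c l) (mx_cons (w, z)) =
  \1_(cube_at (mx_uncons c).1 l) w * \1_(mx_cube (mx_uncons c).2 l) z :> R.
Proof.
rewrite !indicE -natrM mulnb; congr (_%:R); congr nat_of_bool.
have /seteqP[h1 h2] := @mx_boxS R m n (fun i j => `[c i j, c i j + l]%classic).
apply/idP/andP; rewrite !inE.
  move=> /(h1 (w, z))[/= a b]; split.
    by move=> j; have := a j; rewrite /mx_uncons /= mxE.
  by move=> i j; have := b i j; rewrite /mx_uncons /= mxE.
move=> [a b]; apply: (h2 (w, z)); split.
  by move=> j; have := a j; rewrite /mx_uncons /= mxE.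
by move=> i j; have := b i j; rewrite /mx_uncons /= mxE.
Qed.

Lemma mulmx_cons n (t : 'rV[R]_n.+1) (w : 'rV[R]_m) (z : 'M[R]_(n, m)) :
  t *m mx_cons (w, z) = t ord0 ord0 *: w + (rV_uncons t).2 *m z.
Proof.
apply/rowP => j; rewrite !mxE big_ord_recl mx_cons0; congr (_ + _).
by apply: eq_bigr => i _; rewrite mx_consS !mxE.
Qed.

(** Not normalised: the total mass of the cube is l^(n m). *)
Definition cube_average n (c : 'M[R]_(n, m)) (l : R) (t : 'rV[R]_n) (G : 'rV[R]_m -> R)
    (u : 'rV[R]_m) : R :=
  \int[lebesgue_mx R m n]_z (\1_(mx_cube c l) z * G (u + t *m z)).

Lemma measurable_mulmxr d (T : measurableType d) n (t : T -> 'rV[R]_n) (z : T -> 'M[R]_(n, m)) :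
  measurable_fun setT (t : T -> borel 'rV[R]_n) ->
  measurable_fun setT (z : T -> borel 'M[R]_(n, m)) ->
  measurable_fun setT (fun x => t x *m z x : V).
Proof.
move=> mt mz; apply: measurable_mx => i j; under eq_fun do rewrite mxE.
apply: measurable_sum => l; apply: measurable_funM.
  exact: (measurableT_comp (measurable_coord i l) mt).
exact: (measurableT_comp (measurable_coord l j) mz).
Qed.

Lemma measurable_cube_average n (c : 'M[R]_(n, m)) l t G :
  measurable_fun setT (G : V -> R) -> measurable_fun setT (cube_average c l t G : V -> R).
Proof.
move=> mG.
apply: (measurable_Rintegral2 (lebesgue_mx R m n)
  (f := fun p : V * borel 'M[R]_(n, m) => \1_(mx_cube c l) p.2 * G (p.1 + t *m p.2))).
apply: measurable_funM.
  exact: (measurableT_comp (measurable_indic (measurable_mx_cube c l)) measurable_snd).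
apply: (measurableT_comp mG); apply: measurable_addV => //.
by apply: (@measurable_mulmxr _ (V * borel 'M[R]_(n, m))%type n (fun=> t) snd).
Qed.

Lemma cube_average_bounded n (c : 'M[R]_(n, m)) l t G (M : R) : 0 <= l ->
  measurable_fun setT (G : V -> R) -> (forall u, `|G u| <= M) ->
  forall u, `|cube_average c l t G u| <= M * l ^+ (n * m).
Proof.
move=> l0 mG GM u.
have e := lebesgue_mx_cube c l0.
have mz : measurable_fun setT (fun z : borel 'M[R]_(n, m) => \1_(mx_cube c l) z * G (u + t *m z)).
  apply: measurable_funM; first by apply: measurable_indic; exact: measurable_mx_cube.
  apply: (measurableT_comp mG); apply: measurable_addV => //.
  by apply: (@measurable_mulmxr _ (borel 'M[R]_(n, m)) n (fun=> t) id).
have foo : (lebesgue_mx R m n (mx_cube c l) < +oo)%E by rewrite e ltry.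
have := @Rintegral_bounded_support _ _ _ (lebesgue_mx R m n) _ _ M mz (measurable_mx_cube c l) foo.
rewrite [X in fine X]e; apply => z.
by rewrite normrM mulrC [X in _ * X]ger0_norm//; apply: ler_wpM2r.
Qed.

(** Induction on the rows, with exactly one difference per row. Row 0 of z enters through t_0 w and
    absorbs the first difference by [sqnorm_row_difference], applied to the function K in which the
    remaining differences are averaged over the remaining rows; the gains therefore multiply. *)
Lemma sqnorm_cube_average n (c : 'M[R]_(n, m)) (l B r : R) (t : 'rV[R]_n)
    (vs : seq 'rV[R]_m) (H : 'rV[R]_m -> R) (M : R) :
  0 < l -> 0 <= B -> 0 < r -> size vs = n ->
  (forall v j, v \in vs -> `|v ord0 j| <= B * r) ->
  measurable_fun setT (H : V -> R) -> (forall u, `|H u| <= M) ->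
  (sqnorm (cube_average c l t (diffs vs H))
    <= ((\prod_i (row_const m B l * gain r (t ord0 i))) ^+ 2)%:E * sqnorm H)%E.
Proof.
move=> l0 B0 r0; elim: n c t vs => [|n ih] c t [|v vs]//=.
  (* With no rows the measure is the Dirac mass at the empty matrix, and the average is H itself. *)
  move=> _ _ mH HM; rewrite big_ord0 expr1n mul1e.
  rewrite (eq_sqnorm (g := H))// => u.
  rewrite /cube_average /= /Rintegral integral_dirac//=; last first.
    apply/measurable_EFinP; apply: measurable_funM; first by apply: measurable_indic; exact: measurable_mx_cube.
    apply: (measurableT_comp mH); apply: measurable_addV => //.
    by apply: (@measurable_mulmxr _ (borel 'M[R]_(0, m)) 0 (fun=> t) id).
  by rewrite indicT mul1r mulmx0 addr0 indicE mem_set ?mul1r// => -[].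
move=> [sz] vB mH HM.
have vsB v' j : v' \in vs -> `|v' ord0 j| <= B * r.
  by move=> h; apply: vB; rewrite in_cons h orbT.
have vB0 j : `|v ord0 j| <= B * r by apply: vB; rewrite mem_head.
set c0 := (mx_uncons c).1; set c' := (mx_uncons c).2; set t' := (rV_uncons t).2.
pose K := cube_average c' l t' (diffs vs H).
have mD := measurable_diffs vs mH.
have DM := diffs_bounded vs HM.
have mK : measurable_fun setT (K : V -> R) by exact: measurable_cube_average.
have KM := cube_average_bounded c' t' (ltW l0) mD DM.
have step : (sqnorm (cube_average c l t (fun u => diffs vs H u - diffs vs H (u + v))%R) <=
    ((row_const m B l * gain r (t ord0 ord0)) ^+ 2)%:E * sqnorm K)%E.
  have := sqnorm_row_difference c0 l0 B0 r0 vB0 (t ord0 ord0) mK KM.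
  rewrite (eq_sqnorm (f := cube_average _ _ _ _) (g := fun u =>
    \int[leb]_w (\1_(cube_at c0 l) w * (K (u + t ord0 ord0 *: w) - K (u + t ord0 ord0 *: w + v)))))// => u.
  rewrite /cube_average.
  pose D' u := diffs vs H u - diffs vs H (u + v).
  have mD' : measurable_fun setT (D' : V -> R) by exact: (@measurable_diffs (v :: vs) H mH).
  have DM' u' : `|D' u'| <= 2 ^+ n.+1 * M.
    by rewrite -sz; exact: (@diffs_bounded (v :: vs) H M HM u').
  have mC0 : measurable (cube_at c0 l) by exact: measurable_cube_at.
  have mC' : measurable (mx_cube c' l) by exact: measurable_mx_cube.
  have C0oo : (leb (cube_at c0 l) < +oo)%E by rewrite lebesgue_cube_at ?ltry// ltW.
  have C'oo : (lebesgue_mx R m n (mx_cube c' l) < +oo)%E by rewrite lebesgue_mx_cube ?ltry// ltW.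
  pose f (p : V * borel 'M[R]_(n, m)) : R :=
    (\1_(cube_at c0 l) p.1 * \1_(mx_cube c' l) p.2) * D' (u + (t ord0 ord0 *: p.1 + t' *m p.2)).
  have mf : measurable_fun setT f.
    apply: measurable_funM.
      apply: measurable_funM.
        exact: (measurableT_comp (measurable_indic mC0) measurable_fst).
      exact: (measurableT_comp (measurable_indic mC') measurable_snd).
    apply: (measurableT_comp mD'); apply: measurable_addV => //.
    apply: measurable_addV; last first.
      by apply: (@measurable_mulmxr _ (V * borel 'M[R]_(n, m))%type n (fun=> t') snd).
    have := @measurable_affine R m _ (V * borel 'M[R]_(n, m))%type (cst 0) fst (cst (t ord0 ord0)).
    under eq_fun do rewrite /cst add0r.
    by apply.
  have fM w z : `|f (w, z)| <= 2 ^+ n.+1 * M * (\1_(cube_at c0 l) w * \1_(mx_cube c' l) z).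
    rewrite /f normrM mulrC [X in _ * X]ger0_norm ?mulr_ge0//.
    by apply: ler_wpM2r; rewrite ?mulr_ge0.
  have mg : measurable_fun setT (fun z : borel 'M[R]_(n.+1, m) =>
      \1_(mx_cube c l) z * D' (u + t *m z)).
    apply: measurable_funM; first by apply: measurable_indic; exact: measurable_mx_cube.
    apply: (measurableT_comp mD'); apply: measurable_addV => //.
    by apply: (@measurable_mulmxr _ (borel 'M[R]_(n.+1, m)) n.+1 (fun=> t) id).
  have fE w z : \1_(mx_cube c l) (mx_cons (w, z)) * D' (u + t *m mx_cons (w, z)) = f (w, z).
    by rewrite indic_mx_cubeS mulmx_cons.
  (* Row 0 is integrated innermost here; Fubini then brings it outside, where
     [sqnorm_row_difference] expects it. *)
  transitivity (\int[lebesgue_mx R m n]_z \int[leb]_w f (w, z)).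
    rewrite (Rintegral_lebesgue_mxS mg mC0 mC' C0oo C'oo (M := 2 ^+ n.+1 * M)); last first.
      by move=> w z; rewrite fE.
    by apply: eq_Rintegral => z _; apply: eq_Rintegral => w _; rewrite fE.
  have [<- _] := @Rintegral_Fubini _ _ _ _ _ leb (lebesgue_mx R m n) f _ _ _ mf mC0 mC' C0oo C'oo fM.
  apply: eq_Rintegral => w _.
  rewrite /f /= /K /cube_average.
  have iD a : (lebesgue_mx R m n).-integrable setT (EFin \o
      (fun z => \1_(mx_cube c' l) z * diffs vs H (a + t' *m z))).
    apply: (integrable_bounded_support _ mC' C'oo (M := 2 ^+ size vs * M)).
      apply: measurable_funM; first by apply: measurable_indic.
      apply: (measurableT_comp mD); apply: measurable_addV => //.
      by apply: (@measurable_mulmxr _ (borel 'M[R]_(n, m)) n (fun=> t') id).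
    by move=> z; rewrite normrM mulrC [X in _ * X]ger0_norm//; apply: ler_wpM2r.
  rewrite -(RintegralB measurableT (iD _) (iD _)).
  rewrite -RintegralZl//; last first.
    have := integrableB measurableT (iD (u + t ord0 ord0 *: w)) (iD (u + t ord0 ord0 *: w + v)).
    by apply: eq_integrable.
  apply: eq_Rintegral => z _.
  by rewrite /D' -mulrA -mulrBr !addrA (addrAC _ (t' *m z) v).
apply: (le_trans step).
rewrite big_ord_recl [in leRHS]exprMn [in leRHS]EFinM -muleA.
apply: lee_wpmul2l; first by rewrite lee_fin sqr_ge0.
have := ih c' t' vs sz vsB mH HM.
by under eq_bigr do rewrite mxE.
Qed.

End iterated_smoothing.

(** * The pairing of two fibres *)

Section pair_integral.
Context (R : realType) (k m : nat).
Local Notation leb := (lebesgue_rV R m).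
Local Notation V := (borel 'rV[R]_m).
Local Notation X := (borel 'rV[R]_k).
Local Notation Y := (borel 'M[R]_(k.+1, m)).
Local Notation lamb := (lebesgue_mx R m k.+1).

Lemma kplane_point_cons (w : 'rV[R]_m) (z : 'M[R]_(k, m)) x :
  kplane_point (mx_cons (w, z)) x = w + x *m z.
Proof.
apply/rowP => j; rewrite !mxE unlift_none; congr (_ + _).
by apply: eq_bigr => i _; rewrite mx_consS.
Qed.

Lemma kplane_pointD (y h : 'M[R]_(k.+1, m)) x :
  kplane_point (y + h) x = kplane_point y x + kplane_point h x.
Proof.
apply/rowP => j; rewrite !mxE addrACA; congr (_ + _).
by rewrite -big_split; apply: eq_bigr => i _; rewrite mxE mulrDr.
Qed.

Lemma measurable_kplane_point d (T : measurableType d) (y : T -> 'M[R]_(k.+1, m)) (x : T -> 'rV[R]_k) :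
  measurable_fun setT (y : T -> Y) -> measurable_fun setT (x : T -> X) ->
  measurable_fun setT (fun t => kplane_point (y t) (x t) : V).
Proof.
move=> my mx; apply: measurable_mx => i j; under eq_fun do rewrite mxE.
apply: measurable_funD; first exact: (measurableT_comp (measurable_coord _ _) my).
apply: measurable_sum => l; apply: measurable_funM.
  exact: (measurableT_comp (measurable_coord _ _) mx).
exact: (measurableT_comp (measurable_coord _ _) my).
Qed.

Definition cube0 (L : R) : set V := cube_at (const_mx (- L)) (2 * L).

Lemma cube0P L u : cube0 L u <-> forall j, `|u ord0 j| <= L.
Proof.
split => [uL j|uL j].
  have := uL j; rewrite /= in_itv /= mxE => /andP[a b].
  by rewrite ler_norml a /=; apply: (le_trans b); lra.
have := uL j; rewrite ler_norml /= in_itv /= mxE => /andP[-> b] /=.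
by apply: (le_trans b); lra.
Qed.

Lemma measurable_cube0 L : measurable (cube0 L).
Proof. exact: measurable_cube_at. Qed.

Lemma lebesgue_cube0_lty L : 0 <= L -> (leb (cube0 L) < +oo)%E.
Proof. by move=> L0; rewrite /cube0 lebesgue_cube_at ?ltry// mulr_ge0. Qed.

(** Only the direction rows are confined. The base point ranges over the whole of R^m, so the
    substitution u = w + x z in it preserves the region of integration. *)
Definition slab (c : 'M[R]_(k, m)) (l : R) : set Y :=
  [set z | mx_cube c l (mx_uncons z).2].

Lemma measurable_slab c l : measurable (slab c l).
Proof.
have := measurable_mx_cube c l => mC.
rewrite -[X in measurable X]setTI.
exact: (measurableT_comp measurable_snd (@measurable_mx_uncons R m k)).
Qed.

Lemma indic_slab c l w z : \1_(slab c l) (mx_cons (w, z)) = \1_(mx_cube c l) z :> R.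
Proof.
rewrite !indicE; congr (_%:R); congr nat_of_bool.
by apply/idP/idP; rewrite !inE /slab /mkset mx_consK.
Qed.

(** A crude bound for the entries of x z, with x in the unit cube and z in the cube of matrices. *)
Definition shear_bound (c : 'M[R]_(k, m)) (l : R) : R := \sum_i \sum_j (`|c i j| + l).

Lemma shear_bound_ge0 c l : 0 <= l -> 0 <= shear_bound c l.
Proof. by move=> l0; apply: sumr_ge0 => i _; apply: sumr_ge0 => j _; rewrite addr_ge0. Qed.

Lemma mx_cube_shear c l (x : 'rV[R]_k) z j : 0 <= l ->
  unit_cube x -> mx_cube c l z -> `|(x *m z) ord0 j| <= shear_bound c l.
Proof.
move=> l0 xc zc; rewrite mxE; apply: (le_trans (ler_norm_sum _ _ _)).
apply: ler_sum => i _; rewrite (bigD1 j)//=.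
apply: (@le_trans _ _ (`|c i j| + l)); last first.
  by rewrite lerDl; apply: sumr_ge0 => j' _; rewrite addr_ge0.
rewrite normrM.
have := xc i; rewrite /= in_itv /= => /andP[x0 x1].
rewrite (ger0_norm x0) -[leRHS]mul1r; apply: ler_pM => //.
have := zc i j; rewrite /= in_itv /= => /andP[z0 z1].
rewrite ler_norml; apply/andP; split.
  by have := ler_norm (- c i j); rewrite normrN; lra.
by have := ler_norm (c i j); lra.
Qed.

(* The pairing of the fibres over [x] and [x'] of the form [int |T F|^2]. *)
Lemma slab_pairing c l (L M1 M2 : R) (x x' : 'rV[R]_k) (F1 F2 : 'rV[R]_m -> R) :
  0 < l -> 0 <= L -> unit_cube x ->
  measurable_fun setT (F1 : V -> R) -> measurable_fun setT (F2 : V -> R) ->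
  (forall u, `|F1 u| <= M1 * \1_(cube0 L) u) -> (forall u, `|F2 u| <= M2) ->
  \int[lamb]_z (\1_(slab c l) z * (F1 (kplane_point z x) * F2 (kplane_point z x'))) =
  \int[leb]_u (F1 u * cube_average c l (x' - x) F2 u).
Proof.
move=> l0 L0 xc mF1 mF2 F1M F2M.
(* If F1 does not vanish at w + x z, then w lies in the cube of half side L'; this supplies the
   rectangle required by Fubini. *)
set L' := L + shear_bound c l.
have L'0 : 0 <= L' by rewrite addr_ge0// shear_bound_ge0// ltW.
have M10 : 0 <= M1.
  have := F1M 0; rewrite indicE mem_set ?mulr1; first exact: le_trans.
  by apply/cube0P => j; rewrite mxE normr0.
have M20 : 0 <= M2 by exact: le_trans (F2M 0).
have mC := measurable_mx_cube c l.
have Coo : (lebesgue_mx R m k (mx_cube c l) < +oo)%E.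
  by rewrite lebesgue_mx_cube ?ltry// ltW.
have mA := measurable_cube0 L'.
have Aoo := lebesgue_cube0_lty L'0.
have mBig : measurable_fun setT (fun z : Y =>
    \1_(slab c l) z * (F1 (kplane_point z x) * F2 (kplane_point z x'))).
  apply: measurable_funM; first by apply: measurable_indic; exact: measurable_slab.
  apply: measurable_funM; [apply: (measurableT_comp mF1)|apply: (measurableT_comp mF2)].
    by apply: (@measurable_kplane_point _ Y id (fun=> x)).
  by apply: (@measurable_kplane_point _ Y id (fun=> x')).
have bnd w z : `|\1_(slab c l) (mx_cons (w, z)) *
    (F1 (kplane_point (mx_cons (w, z)) x) * F2 (kplane_point (mx_cons (w, z)) x'))| <=
    M1 * M2 * (\1_(cube0 L') w * \1_(mx_cube c l) z).
  rewrite indic_slab !kplane_point_cons !normrM.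
  have [zC|zC] := boolP (z \in mx_cube c l); last first.
    by rewrite !indicE (negbTE zC) normr0 mul0r !mulr0.
  have [wA|wA] := boolP (w \in cube0 L').
    rewrite !indicE zC wA normr1 !mul1r !mulr1; apply: ler_pM => //.
    apply: (le_trans (F1M _)); rewrite -[leRHS]mulr1; apply: ler_wpM2l => //.
  suff -> : F1 (w + x *m z) = 0 by rewrite normr0 !(mul0r,mulr0) !mulr_ge0.
  apply/eqP; rewrite -normr_le0; apply: (le_trans (F1M _)).
  rewrite indicE memNset ?mulr0// => /cube0P h.
  move: wA => /negP; apply; rewrite inE; apply/cube0P => j.
  have := h j; rewrite mxE => hj.
  have := @mx_cube_shear c l x z j (ltW l0) xc (set_mem zC).
  set a := w ord0 j in hj *; set b := (x *m z) ord0 j in hj *.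
  have := ler_normB (a + b) b; rewrite addrK /L'; lra.
rewrite (Rintegral_lebesgue_mxS mBig mA mC Aoo Coo bnd).
(* change variables u = w + x z in the inner integral *)
transitivity (\int[lebesgue_mx R m k]_z \int[leb]_u
    (\1_(mx_cube c l) z * (F1 u * F2 (u + (x' - x) *m z)))).
  apply: eq_Rintegral => z _.
  have mg : measurable_fun setT (fun u : V =>
      \1_(mx_cube c l) z * (F1 u * F2 (u + (x' - x) *m z)) : R).
    apply: measurable_funM => //; apply: measurable_funM => //.
    exact: (measurableT_comp mF2 (measurable_translate _)).
  rewrite -(Rintegral_preserving (lebesgue_rV_translate (x *m z)) mg).
  apply: eq_Rintegral => w _; rewrite indic_slab !kplane_point_cons.
  by congr (_ * (_ * F2 _)); rewrite mulmxBl -addrA [x *m z + _]addrC subrK.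
have mf : measurable_fun setT (fun p : V * borel 'M[R]_(k, m) =>
    \1_(mx_cube c l) p.2 * (F1 p.1 * F2 (p.1 + (x' - x) *m p.2)) : R).
  apply: measurable_funM.
    exact: (measurableT_comp (measurable_indic mC) measurable_snd).
  apply: measurable_funM; first exact: (measurableT_comp mF1 measurable_fst).
  apply: (measurableT_comp mF2); apply: measurable_addV => //.
  by apply: (@measurable_mulmxr _ _ _ (V * borel 'M[R]_(k, m))%type k (fun=> x' - x) snd).
have bnd2 u z : `|\1_(mx_cube c l) z * (F1 u * F2 (u + (x' - x) *m z))| <=
    M1 * M2 * (\1_(cube0 L) u * \1_(mx_cube c l) z).
  rewrite !normrM [X in X * _]ger0_norm//.
  rewrite [leRHS](_ : _ = \1_(mx_cube c l) z * ((M1 * \1_(cube0 L) u) * M2)); last by ring.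
  by apply: ler_wpM2l => //; apply: ler_pM.
have [<- _] := @Rintegral_Fubini _ _ _ _ _ leb (lebesgue_mx R m k) _ _ _ _ mf
  (measurable_cube0 L) mC (lebesgue_cube0_lty L0) Coo bnd2.
apply: eq_Rintegral => u _; rewrite /cube_average -RintegralZl//; last first.
  apply: (integrable_bounded_support _ mC Coo (M := M2)).
    apply: measurable_funM; first by apply: measurable_indic.
    apply: (measurableT_comp mF2); apply: measurable_addV => //.
    by apply: (@measurable_mulmxr _ _ _ (borel 'M[R]_(k, m)) k (fun=> x' - x) id).
  by move=> z; rewrite normrM mulrC [X in _ * X]ger0_norm//; apply: ler_wpM2r.
by apply: eq_Rintegral => z _; rewrite mulrCA.
Qed.
End pair_integral.

(** * Integrals of product kernels and of the gain *)

Section product_integrals.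
Context (R : realType).

Lemma ge0_integral_lebesgue_rVS n (f : borel 'rV[R]_n.+1 -> \bar R) :
  measurable_fun setT f -> (forall z, 0 <= f z)%E ->
  (\int[lebesgue_rV R n.+1]_z f z =
   \int[@lebesgue_measure R]_a \int[lebesgue_rV R n]_v f (rV_cons (a, v)))%E.
Proof.
move=> mf f0.
rewrite [LHS](_ : _ = (\int[pushforward (@lebesgue_measure R \x lebesgue_rV R n)
    (@rV_cons R n : measurableTypeR R * borel 'rV[R]_n -> borel 'rV[R]_n.+1)]_z f z)%E) //.
rewrite (ge0_integral_pushforward (@measurable_rV_cons R n)) ?preimage_setT//.
rewrite fubini_tonelli1//; last by move=> x; exact: f0.
exact: (measurableT_comp mf (@measurable_rV_cons R n)).
Qed.

Lemma integral_rV_prod_le n (g : 'I_n -> R -> R) (K : R) :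
  (forall i, measurable_fun setT (g i)) -> (forall i s, 0 <= g i s) -> 0 <= K ->
  (forall i, \int[@lebesgue_measure R]_s (g i s)%:E <= K%:E)%E ->
  (\int[lebesgue_rV R n]_v (\prod_i g i (v ord0 i))%R%:E <= (K ^+ n)%:E)%E.
Proof.
move=> mg g0 K0; elim: n g mg g0 => [|n ih] g mg g0 gK.
  under eq_integral do rewrite big_ord0.
  by rewrite integral_dirac//= ?indicT ?mul1e ?expr0 ?diracT ?mul1e.
have P0 k (h : 'I_k -> R -> R) (v : 'rV[R]_k) : (forall i s, 0 <= h i s) ->
    0 <= \prod_i h i (v ord0 i) by move=> h0; apply: prodr_ge0.
have mP k (h : 'I_k -> R -> R) : (forall i, measurable_fun setT (h i)) ->
    measurable_fun setT (fun v : borel 'rV[R]_k => (\prod_i h i (v ord0 i))%:E).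
  move=> mh; apply/measurable_EFinP; apply: measurable_prod => i _.
  exact: (measurableT_comp (mh i) (measurable_coord _ _)).
rewrite (ge0_integral_lebesgue_rVS (mP _ _ mg)); last first.
  by move=> z; rewrite lee_fin; exact: P0.
have e (a : R) : (\int[lebesgue_rV R n]_v (\prod_i g i (rV_cons (a, v) ord0 i))%R%:E =
   (g ord0 a)%:E * \int[lebesgue_rV R n]_v (\prod_i g (lift ord0 i) (v ord0 i))%R%:E)%E.
  have mQ := mP _ _ (fun i => mg (lift ord0 i)).
  have Q0 (v : borel 'rV[R]_n) : (0 <= (\prod_i g (lift ord0 i) (v ord0 i))%R%:E :> \bar R)%E.
    by rewrite lee_fin; apply: prodr_ge0.
  rewrite -(ge0_integralZl _ measurableT mQ (fun v _ => Q0 v)) ?lee_fin//.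
  apply: eq_integral => v _; rewrite big_ord_recl rV_cons0 -EFinM; congr (_ * _)%:E.
  by apply: eq_bigr => i _; rewrite rV_consS.
under eq_integral do rewrite e.
have J0 : (0 <= \int[lebesgue_rV R n]_v (\prod_i g (lift ord0 i) (v ord0 i))%R%:E)%E.
  by apply: integral_ge0 => v _; rewrite lee_fin; apply: prodr_ge0.
have mg0 : measurable_fun setT (fun a : measurableTypeR R => (g ord0 a)%:E).
  by apply/measurable_EFinP; exact: mg.
have g00 (a : measurableTypeR R) : (0 <= (g ord0 a)%:E :> \bar R)%E by rewrite lee_fin.
rewrite (ge0_integralZr _ measurableT mg0 (fun a _ => g00 a) J0).
rewrite exprS EFinM; apply: lee_pmul => //.
- by apply: integral_ge0 => a _; rewrite lee_fin.
- by apply: (ih (fun i => g (lift ord0 i))).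
Qed.

Lemma gainE (r t : R) : gain r t =
  \1_`[- r, r]%classic t + \1_(~` `[- r, r]%classic) t * (r * `|t| `^ (- 1)).
Proof.
rewrite powR_inv1// /gain !indicE in_setC.
have -> : (t \in `[- r, r]%classic) = (`|t| <= r).
  by rewrite ler_norml; apply/idP/idP; rewrite inE /= in_itv.
by case: ifPn => _ /=; rewrite ?mul0r ?addr0 ?add0r ?mul1r.
Qed.

Lemma measurable_gain (r : R) : measurable_fun setT (gain r).
Proof.
have mi : measurable (`[- r, r]%classic : set (measurableTypeR R)) by exact: measurable_itv.
rewrite (funext (gainE r)).
apply: measurable_funD; first exact: measurable_indic.
apply: measurable_funM; first by apply: measurable_indic; exact: measurableC.
apply: measurable_funM => //.
apply: (@measurableT_comp _ _ _ _ _ _ (fun x : R => x `^ (- 1)) _ (fun t : R => `|t|)).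
  exact: measurable_powR.
exact: normr_measurable.
Qed.

(** Halving r halves the gain except where |t| is at most r, and there the gain is at most 1. This
    is the recursion behind [integral_gain]. *)
Lemma gain_half (r t : R) : 0 < r ->
  gain (r / 2) t <= 2^-1 * gain r t + \1_`[- r, r]%classic t.
Proof.
move=> r0; rewrite /gain indicE.
have -> : (t \in `[- r, r]%classic) = (`|t| <= r).
  by rewrite ler_norml; apply/idP/idP; rewrite inE /= in_itv.
have [h1|h1] := leP `|t| (r / 2); have [h2|h2] := leP `|t| r; rewrite /= ?mulr1 ?addr0; try lra.
- have : r / 2 / `|t| <= 1 by rewrite ler_pdivrMr; lra.
  lra.
Qed.

Lemma gain_le1 (r t : R) : 0 < r -> gain r t <= 1.
Proof.
move=> r0; rewrite /gain; case: ifPn => //; rewrite -ltNge => h.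
by rewrite ler_pdivrMr ?mul1r ?ltW// (lt_trans r0 h).
Qed.

(** Induction by [gain_half]: the integral is halved at each step and the measure 2 * 2^-j of an
    interval is added. The factor j+1 stands for the logarithmic divergence of 1/|t|, which never
    has to be integrated. *)
Lemma integral_gain j (a : R) :
  (\int[@lebesgue_measure R]_s (\1_`[0, 1]%classic s * gain (2^-1 ^+ j) (s - a))%R%:E
    <= (4 * j.+1%:R * 2^-1 ^+ j)%:E)%E.
Proof.
have rj0 i : 0 < 2^-1 ^+ i :> R by rewrite exprn_gt0// invr_gt0.
have mI (b c : R) : measurable (`[b, c]%classic : set (measurableTypeR R)) by exact: measurable_itv.
have m1 (b c : R) : measurable_fun setT (\1_`[b, c]%classic : measurableTypeR R -> R).
  exact: measurable_indic.
have msub : measurable_fun setT (fun s : measurableTypeR R => s - a : measurableTypeR R).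
  exact: measurable_funB.
have mgn i : measurable_fun setT (fun s : measurableTypeR R =>
    \1_`[0, 1]%classic s * gain (2^-1 ^+ i) (s - a) : R).
  by apply: measurable_funM => //; exact: (measurableT_comp (measurable_gain _) msub).
have gn0 i s : 0 <= \1_`[0, 1]%classic s * gain (2^-1 ^+ i) (s - a) :> R.
  by rewrite mulr_ge0// gain_ge0.
elim: j => [|j ih].
  apply: (@le_trans _ _ (\int[@lebesgue_measure R]_s (\1_`[0, 1]%classic s)%:E)%E).
    apply: ge0_le_integralT => //.
    - by move=> s; rewrite lee_fin.
    - exact/measurable_EFinP.
    - exact/measurable_EFinP.
    - by move=> s; rewrite lee_fin -[leRHS]mulr1; apply: ler_wpM2l => //; exact: gain_le1.
  rewrite (integral_indic _ measurableT (mI 0 1)) setIT [X in (X <= _)%E](lebesgue_measure_itv `[0, 1]).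
  by rewrite /= lte_fin ltr01 -EFinB lee_fin; lra.
have mJ : measurable_fun setT (fun s : measurableTypeR R => \1_`[- 2^-1 ^+ j, 2^-1 ^+ j]%classic (s - a) : R).
  exact: (measurableT_comp (m1 _ _) msub).
apply: (@le_trans _ _ (\int[@lebesgue_measure R]_s (((2^-1)%:E * (\1_`[0, 1]%classic s * gain (2^-1 ^+ j) (s - a))%:E)
     + (\1_`[- 2^-1 ^+ j, 2^-1 ^+ j]%classic (s - a))%:E))%E).
  apply: ge0_le_integralT => //.
  - by move=> s; rewrite lee_fin.
  - exact/measurable_EFinP.
  - apply: emeasurable_funD; last exact/measurable_EFinP.
    by apply: emeasurable_funM => //; exact/measurable_EFinP.
  - move=> s; rewrite -EFinM -EFinD lee_fin exprSr.
    have := @gain_half _ (s - a) (rj0 j).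
    have : \1_`[0, 1]%classic s <= 1 :> R by rewrite indicE lern1 leq_b1.
    have : 0 <= \1_`[0, 1]%classic s :> R by [].
    have : 0 <= \1_`[- 2^-1 ^+ j, 2^-1 ^+ j]%classic (s - a) :> R by [].
    move: (gain _ _) (gain _ _) (\1__ _) (\1__ _) => g1 g2 b1 b2 h1 h2 h3 h4; nra.
have mE : measurable_fun setT (fun s : measurableTypeR R =>
    (\1_`[0, 1]%classic s * gain (2^-1 ^+ j) (s - a))%:E).
  by apply/measurable_EFinP; exact: mgn.
have mE2 : measurable_fun setT (fun s : measurableTypeR R => ((2^-1)%:E *
    (\1_`[0, 1]%classic s * gain (2^-1 ^+ j) (s - a))%:E)%E).
  by apply: emeasurable_funM.
have mE3 : measurable_fun setT (fun s : measurableTypeR R =>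
    (\1_`[- 2^-1 ^+ j, 2^-1 ^+ j]%classic (s - a) : R)%:E).
  by apply/measurable_EFinP.
rewrite ge0_integralD//; try by move=> s _; rewrite ?mule_ge0// lee_fin.
rewrite (ge0_integralZl _ measurableT mE)//; try by move=> s _; rewrite lee_fin.
have -> : (\int[@lebesgue_measure R]_s (\1_`[- 2^-1 ^+ j, 2^-1 ^+ j]%classic (s - a))%:E
    = (2 * 2^-1 ^+ j)%:E)%E.
  rewrite (ge0_integral_preserving (lebesgue_measure_translate (- a))
    (f := fun s : measurableTypeR R => (\1_`[- 2^-1 ^+ j, 2^-1 ^+ j]%classic s : R)%:E)); last 2 first.
  - by apply/measurable_EFinP.
  - by move=> s; rewrite lee_fin.
  rewrite (integral_indic _ measurableT (mI _ _)) setIT.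
  rewrite [LHS](lebesgue_measure_itv `[- 2^-1 ^+ j, 2^-1 ^+ j]).
  by rewrite /= lte_fin gtrN// -EFinB; congr EFin; ring.
apply: (@le_trans _ _ ((2^-1)%:E * (4 * j.+1%:R * 2^-1 ^+ j)%:E + (2 * 2^-1 ^+ j)%:E)%E).
  by apply: leeD => //; apply: lee_wpmul2l => //; rewrite lee_fin invr_ge0.
rewrite -EFinM -EFinD lee_fin -[j.+2%:R]natr1 exprS.
by rewrite le_eqVlt; apply/orP; left; apply/eqP; field.
Qed.

End product_integrals.

(** * The energy of a transform over a slab *)

Section energy.
Context (R : realType) (k m : nat).
Local Notation lebk := (lebesgue_rV R k).
Local Notation leb := (lebesgue_rV R m).
Local Notation V := (borel 'rV[R]_m).
Local Notation X := (borel 'rV[R]_k).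
Local Notation Y := (borel 'M[R]_(k.+1, m)).
Local Notation lamb := (lebesgue_mx R m k.+1).
Local Notation ucube := (@unit_cube R k : set X).

Lemma measurable_unit_cube : measurable ucube.
Proof. by apply: measurable_rV_box => i; exact: measurable_itv. Qed.

Lemma lebesgue_unit_cube : lebk ucube = 1%E.
Proof.
rewrite lebesgue_rV_box; last by move=> i; exact: measurable_itv.
by apply: big1 => i _; rewrite lebesgue_measure_itv /= lte_fin ltr01 oppr0 adde0.
Qed.

Lemma lebesgue_unit_cube_lty : (lebk ucube < +oo)%E.
Proof. by rewrite lebesgue_unit_cube ltry. Qed.

(** The class of functions on which every exchange of integrals below is legitimate. Vanishing off
    the unit cube lets [ktransform] integrate over all of R^k, and the class is preserved, with
    other bounds, by fibrewise differences and averages. *)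
Definition fibre_data (F : 'rV[R]_k * 'rV[R]_m -> R) (M L : R) :=
  [/\ 0 <= L, measurable_fun setT (F : X * V -> R) &
    forall x u, `|F (x, u)| <= M * (\1_ucube x * \1_(cube0 L) u)].

Definition ktransform (F : 'rV[R]_k * 'rV[R]_m -> R) (y : 'M[R]_(k.+1, m)) : R :=
  \int[lebk]_x F (x, kplane_point y x).

Lemma fibre_data_fst F M L x : fibre_data F M L ->
  measurable_fun setT (fun u : V => F (x, u)).
Proof.
by case=> _ mF _; apply: (@measurableT_comp _ _ _ _ _ _ (F : X * V -> R) _ (pair x)).
Qed.

Lemma fibre_data_bound F M L p : fibre_data F M L -> `|F p| <= `|M|.
Proof.
case: p => x u [_ _ FM]; apply: (le_trans (FM x u)).
rewrite !indicE; have := ler_norm M; have := normr_ge0 M.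
by case: (x \in _); case: (u \in _); rewrite /= ?(mulr1, mulr0, mul0r).
Qed.

Lemma fibre_data_integrand F M L : fibre_data F M L ->
  measurable_fun setT (fun p : Y * X => F (p.2, kplane_point p.1 p.2)).
Proof.
case=> _ mF _; apply: (@measurableT_comp _ _ _ _ _ _ (F : X * V -> R) _
  (fun p : Y * X => (p.2, kplane_point p.1 p.2) : X * V)) => //.
apply: measurable_fun_pair => //.
by apply: (@measurable_kplane_point _ _ _ _ (Y * X)%type fst snd).
Qed.

Lemma measurable_ktransform F M L : fibre_data F M L ->
  measurable_fun setT (ktransform F : Y -> R).
Proof.
move=> FD.
exact: (measurable_Rintegral2 lebk (fibre_data_integrand FD)).
Qed.

Lemma fibre_data_integrand_fst F M L y : fibre_data F M L ->
  measurable_fun setT (fun x : X => F (x, kplane_point y x)).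
Proof.
move=> FD; have := fibre_data_integrand FD => H.
by apply: (@measurableT_comp _ _ _ _ _ _ (fun p : Y * X => F (p.2, kplane_point p.1 p.2)) _ (pair y)).
Qed.

Lemma fibre_data_integrand_le F M L y x : fibre_data F M L ->
  `|F (x, kplane_point y x)| <= `|M| * \1_ucube x.
Proof.
move=> [_ _ FM]; apply: (le_trans (FM _ _)).
rewrite !indicE; have := ler_norm M; have := normr_ge0 M.
by case: (x \in _); case: (_ \in _); rewrite /= ?(mulr1, mulr0, mul0r).
Qed.

Lemma fibre_data_integrable F M L y : fibre_data F M L ->
  lebk.-integrable setT (EFin \o (fun x : X => F (x, kplane_point y x))).
Proof.
move=> FD; apply: (integrable_bounded_support _ measurable_unit_cube lebesgue_unit_cube_lty).
  exact: (fibre_data_integrand_fst y FD).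
by move=> x; exact: fibre_data_integrand_le FD.
Qed.

Lemma ktransform_bounded F M L y : fibre_data F M L -> `|ktransform F y| <= `|M|.
Proof.
move=> FD.
have := Rintegral_bounded_support (fibre_data_integrand_fst y FD) measurable_unit_cube
  lebesgue_unit_cube_lty (fun x => fibre_data_integrand_le y x FD).
by rewrite [X in fine X]lebesgue_unit_cube mulr1.
Qed.

(** A bounded part of the slab outside which the integrand of the transform vanishes on the slab. *)
Definition slab0 (c : 'M[R]_(k, m)) (l L : R) : set Y :=
  @mx_uncons R m k @^-1` (cube0 (L + shear_bound c l) `*` mx_cube c l).

Lemma measurable_slab0 c l L : measurable (slab0 c l L).
Proof.
rewrite -[X in measurable X]setTI; apply: measurable_mx_uncons => //.
by apply: measurableX; [exact: measurable_cube0|exact: measurable_mx_cube].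
Qed.

Lemma lebesgue_slab0_lty c l L : 0 <= l -> 0 <= L -> (lamb (slab0 c l L) < +oo)%E.
Proof.
move=> l0 L0.
rewrite /= /lebesgue_mx_cons /pushforward /slab0 -comp_preimage.
rewrite (_ : _ \o _ = id) ?preimage_id; last exact/funext/mx_consK.
rewrite product_measure1E; [|exact: measurable_cube0|exact: measurable_mx_cube].
rewrite lte_mul_pinfty ?measure_ge0//.
  by rewrite ge0_fin_numE// lebesgue_cube0_lty// addr_ge0// shear_bound_ge0.
by rewrite lebesgue_mx_cube// ltry.
Qed.

Lemma slab_integrand_le F M L c l z x : 0 <= l -> fibre_data F M L ->
  `|\1_(slab c l) z * F (x, kplane_point z x)| <= `|M| * (\1_(slab0 c l L) z * \1_ucube x).
Proof.
move=> l0 [L0 mF FM]; rewrite normrM [X in X * _]ger0_norm//.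
have [xc|xc] := boolP (x \in ucube); last first.
  apply: (@le_trans _ _ (\1_(slab c l) z * 0)); last by rewrite mulr0 !mulr_ge0.
  apply: ler_wpM2l => //; apply: (le_trans (FM _ _)).
  by rewrite [X in _ * (X * _)]indicE (negbTE xc) mul0r mulr0.
have [zs|zs] := boolP (z \in slab0 c l L).
  rewrite [in leRHS]indicE zs [in leRHS]indicE xc !mulr1.
  rewrite -[leRHS]mul1r; apply: ler_pM => //.
  by apply: (@fibre_data_bound F M L).
have [zc|zc] := boolP (z \in slab c l); last first.
  by rewrite indicE (negbTE zc) mul0r !mulr_ge0.
suff -> : F (x, kplane_point z x) = 0 by rewrite normr0 mulr0 !mulr_ge0.
apply/eqP; rewrite -normr_le0; apply: (le_trans (FM _ _)).
rewrite [X in _ * (_ * X)]indicE memNset ?mulr0// => h.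
move/negP: zs; apply; rewrite inE; split; last by have := set_mem zc.
move: h zc; rewrite inE; rewrite -{1 2}(mx_unconsK z).
move: (mx_uncons z) => [w z'] /=.
rewrite kplane_point_cons /slab /mkset mx_consK /= => /cube0P h zc.
apply/cube0P => j; have := h j; rewrite mxE => hj.
have := @mx_cube_shear _ _ _ c l x z' j l0 (set_mem xc) zc.
set a := w ord0 j in hj *; set b := (x *m z') ord0 j in hj *.
have := ler_normB (a + b) b; rewrite addrK; lra.
Qed.

Definition slab_energy (c : 'M[R]_(k, m)) (l : R) (G : 'M[R]_(k.+1, m) -> R) : \bar R :=
  (\int[lamb]_z (\1_(slab c l) z * G z ^+ 2)%R%:E)%E.

Definition fibre_pairing c l (F : 'rV[R]_k * 'rV[R]_m -> R) (x x' : 'rV[R]_k) : R :=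
  \int[lamb]_z (\1_(slab c l) z * (F (x, kplane_point z x) * F (x', kplane_point z x'))).

(** The square of the transform is a double integral over (x, x'), and two applications of Fubini
    bring it outside the integral over the slab. The sets [slab0] and [unit_cube] supply the
    rectangles of finite measure. *)
Lemma slab_energyE F M L c l : 0 <= l -> fibre_data F M L ->
  slab_energy c l (ktransform F) = (\int[lebk]_x \int[lebk]_x' fibre_pairing c l F x x')%:E.
Proof.
move=> l0 FD; have [L0 mF FM] := FD.
have mS := measurable_slab c l.
have mS0 := measurable_slab0 c l L.
have S0oo := lebesgue_slab0_lty c l0 L0.
have mU := measurable_unit_cube; have Uoo := lebesgue_unit_cube_lty.
set G := ktransform F.
have mG : measurable_fun setT (G : Y -> R) by exact: measurable_ktransform FD.
have GM z : `|G z| <= `|M| by exact: ktransform_bounded FD.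
have mInt := fibre_data_integrand FD.
have mSY : measurable_fun setT (fun p : Y * X => \1_(slab c l) p.1 : R).
  exact: (measurableT_comp (measurable_indic mS) measurable_fst).
have mGY : measurable_fun setT (fun p : Y * X => G p.1).
  exact: (measurableT_comp mG measurable_fst).
(* the integral is finite, hence real *)
have SG z : \1_(slab c l) z * G z = \int[lebk]_x (\1_(slab c l) z * F (x, kplane_point z x)).
  by rewrite RintegralZl//; exact: fibre_data_integrable FD.
have SGle z : `|\1_(slab c l) z * G z| <= `|M| * \1_(slab0 c l L) z.
  rewrite SG.
  have mz : measurable_fun setT (fun x : X => \1_(slab c l) z * F (x, kplane_point z x) : R).
    by apply: measurable_funM => //; exact: (fibre_data_integrand_fst z FD).
  have := @Rintegral_bounded_support _ _ _ lebk _ ucube (`|M| * \1_(slab0 c l L) z) mz mU Uoo.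
  rewrite [X in fine X]lebesgue_unit_cube mulr1; apply => x.
  by rewrite -mulrA; exact: slab_integrand_le.
have iSG : lamb.-integrable setT (EFin \o (fun z => \1_(slab c l) z * G z ^+ 2)).
  apply: (integrable_bounded_support _ mS0 S0oo (M := `|M| * `|M|)).
    by apply: measurable_funM; [exact: measurable_indic|exact: measurable_funX].
  move=> z; rewrite expr2 mulrA normrM mulrC -mulrA.
  by apply: ler_pM.
have -> : slab_energy c l G = (\int[lamb]_z (\1_(slab c l) z * G z ^+ 2))%:E.
  by rewrite /slab_energy /Rintegral fineK//; exact: (integrable_fin_num measurableT iSG).
congr EFin.
transitivity (\int[lamb]_z \int[lebk]_x (\1_(slab c l) z * (F (x, kplane_point z x) * G z))).
  apply: eq_Rintegral => z _.
  rewrite expr2 mulrA SG -RintegralZr//; last first.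
    have /= := integrableZl measurableT (\1_(slab c l) z) (fibre_data_integrable z FD).
    by apply: eq_integrable.
  by apply: eq_Rintegral => x _; rewrite mulrA.
have mf1 : measurable_fun setT (fun p : Y * X =>
    \1_(slab c l) p.1 * (F (p.2, kplane_point p.1 p.2) * G p.1)).
  by apply: measurable_funM => //; apply: measurable_funM.
have b1 z x : `|\1_(slab c l) z * (F (x, kplane_point z x) * G z)| <=
    `|M| * `|M| * (\1_(slab0 c l L) z * \1_ucube x).
  rewrite mulrA normrM mulrAC; apply: ler_pM => //.
  exact: slab_integrand_le.
have [-> _] := @Rintegral_Fubini _ _ _ _ _ lamb lebk _ _ _ _ mf1 mS0 mU S0oo Uoo b1.
apply: eq_Rintegral => x _.
have mFx : measurable_fun setT (fun z : Y => F (x, kplane_point z x)).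
  by apply: (@measurableT_comp _ _ _ _ _ _ (fun p : Y * X => F (p.2, kplane_point p.1 p.2)) _
    (fun z : Y => (z, x))).
transitivity (\int[lamb]_z \int[lebk]_x' (\1_(slab c l) z *
    (F (x, kplane_point z x) * F (x', kplane_point z x')))).
  apply: eq_Rintegral => z _; rewrite mulrA -RintegralZl//; last exact: fibre_data_integrable FD.
  by apply: eq_Rintegral => x' _; rewrite mulrA.
have mf2 : measurable_fun setT (fun p : Y * X =>
    \1_(slab c l) p.1 * (F (x, kplane_point p.1 x) * F (p.2, kplane_point p.1 p.2))).
  by apply: measurable_funM => //; apply: measurable_funM => //;
    exact: (measurableT_comp mFx measurable_fst).
have b2 z x' : `|\1_(slab c l) z * (F (x, kplane_point z x) * F (x', kplane_point z x'))| <=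
    `|M| * `|M| * (\1_(slab0 c l L) z * \1_ucube x').
  rewrite mulrCA normrM -mulrA; apply: ler_pM => //; first exact: fibre_data_bound FD.
  exact: slab_integrand_le.
by have [-> _] := @Rintegral_Fubini _ _ _ _ _ lamb lebk _ _ _ _ mf2 mS0 mU S0oo Uoo b2.
Qed.

End energy.

(** Holds without integrability because [fine] sends infinite values to 0. *)
Lemma abs_Rintegral_le d (T : measurableType d) (R : realType)
    (mu : {measure set T -> \bar R}) (f : T -> R) : measurable_fun setT f ->
  ((`|\int[mu]_x f x|%R)%:E <= \int[mu]_x (`|f x|%R)%:E)%E.
Proof.
move=> mf; apply: (@le_trans _ _ `|\int[mu]_x (f x)%:E|%E); last first.
  by apply: le_abse_integral => //; exact/measurable_EFinP.
by rewrite /Rintegral; case: (\int[mu]_x (f x)%:E)%E => [r||]//=; rewrite ?normr0 ?leey.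
Qed.

(** * Schur's test *)

Section schur.
Context (R : realType) (k m : nat).
Local Notation lebk := (lebesgue_rV R k).
Local Notation leb := (lebesgue_rV R m).
Local Notation V := (borel 'rV[R]_m).
Local Notation X := (borel 'rV[R]_k).
Local Notation Y := (borel 'M[R]_(k.+1, m)).
Local Notation lamb := (lebesgue_mx R m k.+1).
Local Notation ucube := (@unit_cube R k : set X).
Implicit Types F : 'rV[R]_k * 'rV[R]_m -> R.

Lemma fibre_data0 F M L x u : fibre_data F M L -> ~ ucube x -> F (x, u) = 0.
Proof.
move=> [_ _ FM] xU; apply/eqP; rewrite -normr_le0; apply: (le_trans (FM _ _)).
by rewrite [X in _ * (X * _)]indicE memNset// mul0r mulr0.
Qed.

Lemma fibre_pairing0 c l F M L x x' : fibre_data F M L -> ~ (ucube x /\ ucube x') ->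
  fibre_pairing c l F x x' = 0.
Proof.
move=> FD xU; rewrite /fibre_pairing.
under eq_Rintegral => z _.
  have -> : F (x, kplane_point z x) * F (x', kplane_point z x') = 0.
    have [h|h] := pselect (ucube x); last by rewrite (fibre_data0 _ FD h) mul0r.
    have h' : ~ ucube x' by move=> h'; apply: xU.
    by rewrite (fibre_data0 _ FD h') mulr0.
  rewrite mulr0; over.
by rewrite /Rintegral integral0.
Qed.

Lemma measurable_fibre_pairing c l F M L : fibre_data F M L ->
  measurable_fun setT (fun p : X * X => fibre_pairing c l F p.1 p.2).
Proof.
move=> FD; have [_ mF _] := FD.
apply: (measurable_Rintegral2 lamb (f := fun q : (X * X) * Y => \1_(slab c l) q.2 *
  (F (q.1.1, kplane_point q.2 q.1.1) * F (q.1.2, kplane_point q.2 q.1.2)))).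
apply: measurable_funM.
  exact: (measurableT_comp (measurable_indic (measurable_slab c l)) measurable_snd).
have mp (s : (X * X) * Y -> X) : measurable_fun setT s ->
    measurable_fun setT (fun q : (X * X) * Y => F (s q, kplane_point q.2 (s q))).
  move=> ms; apply: (@measurableT_comp _ _ _ _ _ _ (F : X * V -> R) _
    (fun q : (X * X) * Y => (s q, kplane_point q.2 (s q)) : X * V)) => //.
  apply: measurable_fun_pair => //.
  by apply: (@measurable_kplane_point _ _ _ _ ((X * X) * Y)%type snd s).
apply: measurable_funM; apply: mp; apply: measurableT_comp => //.
Qed.

(** Schur's test with the pairing bound already symmetrised: s(x) + s(x') takes the place of a
    product. Each of the two terms is integrated first in the variable on which s does not depend
    and costs K, whence 2 K. *)
Lemma slab_energy_le c l F M L (kap : X -> X -> R) (s : X -> R) (K : R) :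
  0 <= l -> fibre_data F M L ->
  measurable_fun setT (fun p : X * X => kap p.1 p.2) -> measurable_fun setT s ->
  (forall x x', 0 <= kap x x') -> (forall x, 0 <= s x) ->
  (forall x, (\int[lebk]_x' (\1_ucube x' * kap x x')%R%:E <= K%:E)%E) ->
  (forall x', (\int[lebk]_x (\1_ucube x * kap x x')%R%:E <= K%:E)%E) ->
  (forall x x', ucube x -> ucube x' ->
     `|fibre_pairing c l F x x'| <= kap x x' * (s x + s x')) ->
  (slab_energy c l (ktransform F) <= (2 * K)%:E * \int[lebk]_x (\1_ucube x * s x)%R%:E)%E.
Proof.
move=> l0 FD mk ms k0 s0 K1 K2 J.
have mU := @measurable_unit_cube R k.
have mJ := measurable_fibre_pairing c l FD.
have mJx x : measurable_fun setT (fun x' : X => fibre_pairing c l F x x').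
  by apply: (@measurableT_comp _ _ _ _ _ _ (fun p : X * X => fibre_pairing c l F p.1 p.2) _ (pair x)).
have mkx x : measurable_fun setT (fun x' : X => kap x x').
  by apply: (@measurableT_comp _ _ _ _ _ _ (fun p : X * X => kap p.1 p.2) _ (pair x)).
have mkx' x' : measurable_fun setT (fun x : X => kap x x').
  by apply: (@measurableT_comp _ _ _ _ _ _ (fun p : X * X => kap p.1 p.2) _ (fun x => (x, x'))).
rewrite (slab_energyE c l0 FD).
have K0 : 0 <= K.
  rewrite -lee_fin; apply: le_trans (K1 0).
  by apply: integral_ge0 => x _; rewrite lee_fin mulr_ge0.
have mi : measurable_fun setT (\1_ucube : X -> R) by exact: measurable_indic.
have mi1 : measurable_fun setT (fun p : X * X => \1_ucube p.1 : R).
  exact: (measurableT_comp mi measurable_fst).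
have mi2 : measurable_fun setT (fun p : X * X => \1_ucube p.2 : R).
  exact: (measurableT_comp mi measurable_snd).
have ms1 : measurable_fun setT (fun p : X * X => s p.1) by exact: (measurableT_comp ms measurable_fst).
have ms2 : measurable_fun setT (fun p : X * X => s p.2) by exact: (measurableT_comp ms measurable_snd).
(* A carries s(x) and B carries s(x'). A is integrated first in x', while B needs Tonelli in order
   to be integrated first in x. *)
pose A (p : X * X) : R := \1_ucube p.1 * s p.1 * (\1_ucube p.2 * kap p.1 p.2).
pose B (p : X * X) : R := \1_ucube p.2 * s p.2 * (\1_ucube p.1 * kap p.1 p.2).
have mA : measurable_fun setT A by do 2 apply: measurable_funM => //; apply: measurable_funM.
have mB : measurable_fun setT B by do 2 apply: measurable_funM => //; apply: measurable_funM.
have A0 p : 0 <= A p by rewrite !mulr_ge0.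
have B0 p : 0 <= B p by rewrite !mulr_ge0.
have JAB x x' : `|fibre_pairing c l F x x'| <= A (x, x') + B (x, x').
  have [[h h']|h] := pselect (ucube x /\ ucube x'); last first.
    by rewrite (fibre_pairing0 _ _ FD h) normr0 addr_ge0.
  by apply: (le_trans (J _ _ h h')); rewrite /A /B /= !indicE !mem_set//= !mul1r mulrDr mulrC (mulrC (s x')).
have mAe : measurable_fun setT (fun p => (A p)%:E) by exact/measurable_EFinP.
have mBe : measurable_fun setT (fun p => (B p)%:E) by exact/measurable_EFinP.
have mAx x : measurable_fun setT (fun x' : X => (A (x, x'))%:E).
  by apply: (@measurableT_comp _ _ _ _ _ _ (fun p => (A p)%:E) _ (pair x)).
have mBx x : measurable_fun setT (fun x' : X => (B (x, x'))%:E).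
  by apply: (@measurableT_comp _ _ _ _ _ _ (fun p => (B p)%:E) _ (pair x)).
have mIA : measurable_fun setT (fun x : X => \int[lebk]_x' (A (x, x'))%:E)%E.
  by apply: (@measurable_fun_fubini_tonelli_F _ _ _ _ _ lebk (fun p => (A p)%:E)) => // p; rewrite lee_fin.
have mIB : measurable_fun setT (fun x : X => \int[lebk]_x' (B (x, x'))%:E)%E.
  by apply: (@measurable_fun_fubini_tonelli_F _ _ _ _ _ lebk (fun p => (B p)%:E)) => // p; rewrite lee_fin.
have IA0 x : (0 <= \int[lebk]_x' (A (x, x'))%:E)%E by apply: integral_ge0 => x' _; rewrite lee_fin.
have IB0 x : (0 <= \int[lebk]_x' (B (x, x'))%:E)%E by apply: integral_ge0 => x' _; rewrite lee_fin.
set S := (\int[lebk]_x (\1_ucube x * s x)%R%:E)%E.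
have mS : measurable_fun setT (fun x : X => (\1_ucube x * s x)%R%:E).
  by apply/measurable_EFinP; apply: measurable_funM.
have S0 x : (0 <= (\1_ucube x * s x)%R%:E :> \bar R)%E by rewrite lee_fin mulr_ge0.
have IAE : (\int[lebk]_x \int[lebk]_x' (A (x, x'))%:E <= K%:E * S)%E.
  rewrite /S muleC -ge0_integralZr//.
  apply: ge0_le_integralT => // [|x]; first by apply: emeasurable_funM.
  rewrite /A /=; under eq_integral do rewrite EFinM.
  rewrite ge0_integralZl//; [|by apply/measurable_EFinP; apply: measurable_funM|by move=> x' _; rewrite lee_fin mulr_ge0].
  by apply: lee_wpmul2l.
have IBE : (\int[lebk]_x \int[lebk]_x' (B (x, x'))%:E <= K%:E * S)%E.
  rewrite (@fubini_tonelli _ _ _ _ _ lebk lebk (fun p => (B p)%:E))//.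
  rewrite /fubini_G /S muleC -ge0_integralZr//.
  apply: ge0_le_integralT => //; last move=> x'.
  - by move=> x'; apply: integral_ge0 => x _; rewrite lee_fin.
  - by apply: (@measurable_fun_fubini_tonelli_G _ _ _ _ _ lebk (fun p => (B p)%:E)) => // p; rewrite lee_fin.
  - by apply: emeasurable_funM.
  rewrite /B /=; under eq_integral do rewrite EFinM.
  rewrite ge0_integralZl//; [|by apply/measurable_EFinP; apply: measurable_funM|by move=> x _; rewrite lee_fin mulr_ge0].
  by apply: lee_wpmul2l.
apply: (@le_trans _ _ (\int[lebk]_x (\int[lebk]_x' (A (x, x'))%:E + \int[lebk]_x' (B (x, x'))%:E))%E); last first.
  by rewrite ge0_integralD// mulrDl mul1r EFinD ge0_muleDl ?lee_fin//; exact: leeD.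
have mRJ := measurable_Rintegral2 lebk mJ.
apply: (@le_trans _ _ (`|\int[lebk]_x \int[lebk]_x' fibre_pairing c l F x x'|%R)%:E).
  by rewrite lee_fin ler_norm.
apply: (le_trans (abs_Rintegral_le _ mRJ)).
apply: ge0_le_integralT => //.
- by apply/measurable_EFinP; apply: measurableT_comp.
- by apply: emeasurable_funD.
move=> x; apply: (le_trans (abs_Rintegral_le _ (mJx x))).
rewrite -ge0_integralD//; try by move=> x' _; rewrite lee_fin.
apply: ge0_le_integralT => //.
- by apply/measurable_EFinP; apply: measurableT_comp.
- by apply: emeasurable_funD.
- by move=> x'; rewrite -EFinD lee_fin.
Qed.

End schur.

(** * Differences of the transform have small energy *)

Section smoothing.
Context (R : realType) (k m : nat).
Local Notation lebk := (lebesgue_rV R k).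
Local Notation leb := (lebesgue_rV R m).
Local Notation V := (borel 'rV[R]_m).
Local Notation X := (borel 'rV[R]_k).
Local Notation Y := (borel 'M[R]_(k.+1, m)).
Local Notation lamb := (lebesgue_mx R m k.+1).
Local Notation ucube := (@unit_cube R k : set X).
Implicit Types F : 'rV[R]_k * 'rV[R]_m -> R.

(** The counterpart on F of differences in y. Since [kplane_point] is additive in y, a step h in y
    translates the fibre over x by [kplane_point h x], and T intertwines the two kinds of
    differences ([ktransform_diffs]). *)
Fixpoint fibre_diffs (hs : seq 'M[R]_(k.+1, m)) F : 'rV[R]_k * 'rV[R]_m -> R :=
  if hs is h :: hs' then fun p =>
    fibre_diffs hs' F p - fibre_diffs hs' F (p.1, p.2 + kplane_point h p.1)
  else F.

Fixpoint mx_diffs (hs : seq 'M[R]_(k.+1, m)) (g : 'M[R]_(k.+1, m) -> R) :=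
  if hs is h :: hs' then fun y => mx_diffs hs' g y - mx_diffs hs' g (y + h) else g.

Lemma fibre_diffsE hs F x u :
  fibre_diffs hs F (x, u) = diffs [seq kplane_point h x | h <- hs] (fun v => F (x, v)) u.
Proof. by elim: hs u => //= h hs ih u; rewrite !ih. Qed.

Lemma fibre_diffs_cat hs hs' F : fibre_diffs (hs ++ hs') F = fibre_diffs hs (fibre_diffs hs' F).
Proof. by elim: hs => //= h hs ->. Qed.

Lemma mx_diffs_cat hs hs' g : mx_diffs (hs ++ hs') g = mx_diffs hs (mx_diffs hs' g).
Proof. by elim: hs => //= h hs ->. Qed.

Lemma kplane_point_le (h : 'M[R]_(k.+1, m)) x (b : R) j : 0 <= b -> ucube x ->
  (forall i j, `|h i j| <= b) -> `|(kplane_point h x : 'rV[R]_m) ord0 j| <= k.+1%:R * b.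
Proof.
move=> b0 xU hb; rewrite mxE; apply: (le_trans (ler_normD _ _)).
rewrite -natr1 mulrDl mul1r addrC; apply: lerD => //.
apply: (le_trans (ler_norm_sum _ _ _)).
apply: (@le_trans _ _ (\sum_(i < k) b)); last by rewrite sumr_const card_ord mulr_natl.
apply: ler_sum => i _; rewrite normrM -[leRHS]mul1r; apply: ler_pM => //.
by have := xU i; rewrite /= in_itv /= => /andP[x0 x1]; rewrite ger0_norm.
Qed.

Lemma fibre_data_diff F M L h : fibre_data F M L ->
  fibre_data (fibre_diffs [:: h] F) (2 * M) (L + k.+1%:R * \sum_i \sum_j `|h i j|).
Proof.
move=> FD; have [L0 mF FM] := FD.
set b := \sum_i \sum_j `|h i j|.
have hb i j : `|h i j| <= b.
  rewrite /b (bigD1 i)//= (bigD1 j)//= -addrA lerDl addr_ge0//.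
    by apply: sumr_ge0.
  by apply: sumr_ge0 => i' _; apply: sumr_ge0.
have b0 : 0 <= b by apply: sumr_ge0 => i' _; apply: sumr_ge0.
have M0 : 0 <= M.
  have := FM 0 0; rewrite !indicE !mem_set ?mulr1.
  - exact: le_trans.
  - by apply/cube0P => j; rewrite mxE normr0.
  - by move=> i; rewrite /= in_itv /= mxE lexx ler01.
split; first by rewrite addr_ge0// mulr_ge0.
  apply: measurable_funB => //.
  apply: (@measurableT_comp _ _ _ _ _ _ (F : X * V -> R) _
    (fun p : X * V => (p.1, p.2 + kplane_point h p.1) : X * V)) => //.
  apply: measurable_fun_pair => //; apply: measurable_addV => //.
  by apply: (@measurable_kplane_point _ _ _ _ (X * V)%type (fun=> h) fst).
move=> x u /=; apply: (le_trans (ler_normB _ _)).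
have [xU|xU] := pselect (ucube x); last first.
  by rewrite !(fibre_data0 _ FD xU) normr0 addr0 !mulr_ge0.
have wide u' : cube0 L u' -> cube0 (L + k.+1%:R * b) u'.
  move/cube0P => h'; apply/cube0P => j; apply: (le_trans (h' j)).
  by rewrite lerDl mulr_ge0.
have shift : cube0 L (u + kplane_point h x) -> cube0 (L + k.+1%:R * b) u.
  move/cube0P => h'; apply/cube0P => j.
  have := h' j; rewrite mxE => h1.
  have := kplane_point_le j b0 xU hb => h2.
  set a := u ord0 j in h1 *; set e := kplane_point h x ord0 j in h1 h2.
  have := ler_normB (a + e) e; rewrite addrK; lra.
have [uC|uC] := pselect (cube0 (L + k.+1%:R * b) u); last first.
  suff F0 u' : ~ cube0 L u' -> F (x, u') = 0.
    by rewrite !F0 ?normr0 ?addr0 ?mulr_ge0//; [move/shift|move/wide].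
  move=> u'C; apply/eqP; rewrite -normr_le0; apply: (le_trans (FM _ _)).
  by rewrite [X in _ * (_ * X)]indicE memNset// !mulr0.
rewrite !indicE !mem_set// !mulr1 mulr_natl mulr2n.
by apply: lerD; rewrite -[leRHS](ger0_norm M0); exact: fibre_data_bound FD.
Qed.

Lemma fibre_data_diffs F M L hs : fibre_data F M L ->
  exists M' L', fibre_data (fibre_diffs hs F) M' L'.
Proof.
elim: hs => [|h hs ih] FD; first by exists M, L.
have [M' [L' FD']] := ih FD.
by eexists; eexists; exact: (fibre_data_diff h FD').
Qed.

Lemma ktransform_diffs F M L hs y : fibre_data F M L ->
  ktransform (fibre_diffs hs F) y = mx_diffs hs (ktransform F) y.
Proof.
move=> FD; elim: hs y => //= h hs ih y.
have [M' [L' FD']] := fibre_data_diffs hs FD.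
rewrite -!ih /ktransform -RintegralB//; try exact: fibre_data_integrable FD'.
by apply: eq_Rintegral => x _ /=; rewrite kplane_pointD.
Qed.

Lemma sqnorm_diffs_le vs (H : 'rV[R]_m -> R) : measurable_fun setT (H : V -> R) ->
  (sqnorm (diffs vs H) <= (4 ^+ size vs)%:E * sqnorm H)%E.
Proof.
move=> mH; elim: vs => [|v vs ih] /=; first by rewrite mul1e.
have mD := measurable_diffs vs mH.
apply: (le_trans (sqnormB_le mD (measurableT_comp mD (measurable_translate v)))).
rewrite (sqnorm_translate v mD) -ge0_muleDl ?lee_fin// -EFinD exprS EFinM -muleA.
rewrite (_ : 2 + 2 = 4 :> R); last by ring.
by apply: lee_wpmul2l => //; rewrite lee_fin.
Qed.

Definition fibre_sqnorm F : \bar R := (\int[lebk]_x sqnorm (fun u => F (x, u)))%E.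

Lemma sqnorm_fibre_fin F M L x : fibre_data F M L -> sqnorm (fun u => F (x, u)) \is a fin_num.
Proof.
move=> FD; have [L0 mF FM] := FD.
rewrite ge0_fin_numE ?sqnorm_ge0//.
have mFx := fibre_data_fst x FD.
have mF2 : measurable_fun setT (fun u : V => F (x, u) ^+ 2) by exact: measurable_funX.
have : leb.-integrable setT (EFin \o (fun u : V => F (x, u) ^+ 2)).
  have := @integrable_bounded_support _ _ _ leb _ _ (`|M| ^+ 2) mF2 (@measurable_cube0 R m L) (@lebesgue_cube0_lty R m L L0).
  apply.
  move=> u; rewrite normrX.
  apply: (@le_trans _ _ ((`|M| * \1_(cube0 L) u) ^+ 2)).
    rewrite ler_sqr ?nnegrE ?mulr_ge0//; apply: (le_trans (FM _ _)).
    rewrite !indicE; have := ler_norm M; have := normr_ge0 M.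
    by case: (x \in _); case: (_ \in _); rewrite /= ?(mulr1, mulr0, mul0r).
  by rewrite exprMn ler_wpM2l ?sqr_ge0// indicE; case: (_ \in _); rewrite ?expr1n ?expr0n.
move=> /integrableP[_]; apply: le_lt_trans.
apply: ge0_le_integralT.
- by move=> u; rewrite lee_fin sqr_ge0.
- exact/measurable_EFinP.
- by apply/measurable_EFinP; apply: measurableT_comp.
- by move=> u; rewrite lee_fin ler_norm.
Qed.

Lemma measurable_sqnorm_fibre F M L : fibre_data F M L ->
  measurable_fun setT (fun x : X => sqnorm (fun u => F (x, u))).
Proof.
move=> [_ mF _].
apply: (@measurable_fun_fubini_tonelli_F _ _ _ _ _ leb (fun p : X * V => (F p ^+ 2)%:E)).
  by apply/measurable_EFinP; exact: measurable_funX.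
by move=> p; rewrite lee_fin sqr_ge0.
Qed.

Section main.
Variables (F : 'rV[R]_k * 'rV[R]_m -> R) (M L : R).
Hypothesis FD : fibre_data F M L.
Variables (c : 'M[R]_(k, m)) (l b : R) (j : nat).
Hypotheses (l0 : 0 < l) (b0 : 0 <= b).
Variable hs : seq 'M[R]_(k.+1, m).
Hypothesis size_hs : size hs = k.
Hypothesis hsb : forall h i i', h \in hs -> `|h i i'| <= b * 2^-1 ^+ j.

Let r : R := 2^-1 ^+ j.
(** Over a point x of the unit cube, a step h with entries at most b r translates the fibre by at
    most (k+1) b r in each coordinate ([kplane_point_le]). *)
Let C : R := row_const m (k.+1%:R * b) l.

(** Only the differences on the fibre over x' are exploited, through [sqnorm_cube_average]; those
    over x are paid for by 2^k in norm. Cauchy-Schwarz yields the geometric mean of the two squared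
    norms, which the arithmetic mean bounds in the form required by Schur's test. *)
Lemma slab_pairing_le x x' : ucube x -> ucube x' ->
  `|fibre_pairing c l (fibre_diffs hs F) x x'| <=
  2^-1 * 2 ^+ k * (\prod_i (C * gain r (x' ord0 i - x ord0 i))) *
   (fine (sqnorm (fun u => F (x, u))) + fine (sqnorm (fun u => F (x', u)))).
Proof.
move=> xU x'U.
have r0 : 0 < r by rewrite exprn_gt0// invr_gt0.
have [M' [L' FD']] := fibre_data_diffs hs FD.
have [L'0 mF' F'M] := FD'.
have mFx := fibre_data_fst x FD; have mFx' := fibre_data_fst x' FD.
have mDx := fibre_data_fst x FD'; have mDx' := fibre_data_fst x' FD'.
have [L0 _ _] := FD.
pose W := cube_average c l (x' - x) (fun u => fibre_diffs hs F (x', u)).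
have -> : fibre_pairing c l (fibre_diffs hs F) x x' =
    \int[leb]_u (fibre_diffs hs F (x, u) * W u).
  apply: (slab_pairing c x' l0 L'0 xU mDx mDx' (M1 := M') (M2 := `|M'|)).
    by move=> u; apply: (le_trans (F'M x u)); rewrite [X in _ * (X * _)]indicE mem_set// mul1r.
  by move=> u; exact: fibre_data_bound FD'.
set P := \prod_i _.
have P0 : 0 <= P.
  apply: prodr_ge0 => i _; rewrite mulr_ge0 ?gain_ge0// row_const_ge0//.
  by rewrite mulr_ge0.
have WE : W = cube_average c l (x' - x) (diffs [seq kplane_point h x' | h <- hs] (fun u => F (x', u))).
  by congr cube_average; apply/funext => u; rewrite fibre_diffsE.
have mW : measurable_fun setT (W : V -> R) by exact: measurable_cube_average.
set s := sqnorm (fun u => F (x, u)); set s' := sqnorm (fun u => F (x', u)).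
have sf : s \is a fin_num by exact: sqnorm_fibre_fin FD.
have s'f : s' \is a fin_num by exact: sqnorm_fibre_fin FD.
have s0 : 0 <= fine s by apply: fine_ge0; exact: sqnorm_ge0.
have s'0 : 0 <= fine s' by apply: fine_ge0; exact: sqnorm_ge0.
have hW : (sqnorm W <= (P ^+ 2)%:E * s')%E.
  rewrite WE; apply: (le_trans (sqnorm_cube_average c (x' - x) (B := k.+1%:R * b) (r := r) (M := `|M|)
    l0 _ r0 _ _ mFx' _)) => //.
  - by rewrite mulr_ge0.
  - by rewrite size_map.
  - move=> v i /mapP[h hh ->]; rewrite -mulrA.
    apply: kplane_point_le => //; first by rewrite mulr_ge0// ltW.
    by move=> i1 i2; exact: hsb.
  - by move=> u; exact: fibre_data_bound FD.
  by under eq_bigr do rewrite !mxE.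
have hF : (sqnorm (fun u => fibre_diffs hs F (x, u)) <= (4 ^+ k)%:E * s)%E.
  have := sqnorm_diffs_le [seq kplane_point h x | h <- hs] mFx; rewrite size_map size_hs.
  by apply: le_trans; rewrite (eq_sqnorm (g := diffs [seq kplane_point h x | h <- hs] (fun v => F (x, v))))// => u;
    rewrite fibre_diffsE.
have mFW : measurable_fun setT (fun u : V => fibre_diffs hs F (x, u) * W u) by exact: measurable_funM.
have key : (((\int[leb]_u (fibre_diffs hs F (x, u) * W u)) ^+ 2)%:E <=
    (4 ^+ k * fine s * (P ^+ 2 * fine s'))%:E)%E.
  have h1 := abs_Rintegral_le leb mFW.
  rewrite -real_normK ?num_real// EFin_expe.
  apply: (@le_trans _ _ ((\int[leb]_u (`|fibre_diffs hs F (x, u) * W u|%R)%:E) ^+ 2)%E).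
    by rewrite lee_sqr//; apply: integral_ge0.
  apply: (le_trans (integral_cauchy_schwarz leb mDx mW)).
  rewrite EFinM; apply: lee_pmul; try exact: sqnorm_ge0.
    by rewrite EFinM fineK.
  by rewrite EFinM fineK.
move: key; rewrite lee_fin => key.
rewrite -(ler_sqr _ _) ?nnegrE//; last by rewrite !mulr_ge0 ?addr_ge0.
rewrite real_normK ?num_real//; apply: (le_trans key).
rewrite (_ : 4 ^+ k = (2 ^+ k) ^+ 2 :> R); last by rewrite -exprM mulnC exprM expr2 -natrM.
set A := 2 ^+ k; set a := fine s; set a' := fine s'.
(* The gap in the arithmetic-geometric mean inequality is itself a square. *)
rewrite -subr_ge0 (_ : _ - _ = (2^-1 * A * P * (a - a')) ^+ 2); first exact: sqr_ge0.
by field.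
Qed.

(** The kernel of [slab_pairing_le] is a product over the k coordinates, so its integral over the
    unit cube factors, and [integral_gain] bounds each factor. The resulting 2^(-j k), up to a power
    of j+1, expresses that T gains k/2 derivatives in L^2. *)
Lemma slab_energy_diffs_le :
  (slab_energy c l (ktransform (fibre_diffs hs F)) <=
   ((2 * C * (4 * j.+1%:R * 2^-1 ^+ j)) ^+ k)%:E * fibre_sqnorm F)%E.
Proof.
have r0 : 0 < r by rewrite exprn_gt0// invr_gt0.
have C0 : 0 <= C by rewrite row_const_ge0// mulr_ge0.
have [M' [L' FD']] := fibre_data_diffs hs FD.
pose kap (x x' : X) : R := 2^-1 * 2 ^+ k * (\prod_i (C * gain r (x' ord0 i - x ord0 i))).
pose s (x : X) : R := fine (sqnorm (fun u => F (x, u))).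
(* The 2^k of the kernel is distributed over the k coordinates, and 2^-1 cancels the 2 of
   [slab_energy_le]. *)
pose K : R := 2^-1 * (2 * C * (4 * j.+1%:R * 2^-1 ^+ j)) ^+ k.
have s0 x : 0 <= s x by apply: fine_ge0; exact: sqnorm_ge0.
have k0 x x' : 0 <= kap x x'.
  by rewrite mulr_ge0//; apply: prodr_ge0 => i _; rewrite mulr_ge0 ?gain_ge0.
have ms : measurable_fun setT s.
  by apply: measurableT_comp => //; exact: measurable_sqnorm_fibre FD.
have mk : measurable_fun setT (fun p : X * X => kap p.1 p.2).
  apply: measurable_funM => //; apply: measurable_prod => i _; apply: measurable_funM => //.
  apply: (measurableT_comp (measurable_gain r)); apply: measurable_funB.
    exact: (measurableT_comp (measurable_coord _ _) measurable_snd).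
  exact: (measurableT_comp (measurable_coord _ _) measurable_fst).
pose G (a : R) (t : R) : R := \1_`[0, 1]%classic t * (2 * C * gain r (t - a)).
have kapE (x x' : X) : \1_ucube x' * kap x x' = 2^-1 * \prod_i G (x ord0 i) (x' ord0 i).
  have -> : \1_ucube x' = \prod_(i < k) \1_`[0, 1]%classic (x' ord0 i) :> R.
    rewrite indicE; have [h|h] := pselect (ucube x').
      by rewrite mem_set//= big1// => i _; rewrite indicE mem_set//; exact: h.
    rewrite memNset//=; have [i hi] : exists i, ~ `[0, 1]%classic (x' ord0 i).
      by apply/existsNP => h'; apply: h.
    by rewrite (bigD1 i)//= indicE memNset// mul0r.
  rewrite /kap mulrCA -!mulrA; congr (_ * _).
  rewrite (_ : 2 ^+ k = \prod_(i < k) 2 :> R); last by rewrite prodr_const card_ord.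
  by rewrite -!big_split; apply: eq_bigr => i _ /=; rewrite /G; ring.
have m01 : measurable (`[0, 1]%classic : set (measurableTypeR R)) by exact: measurable_itv.
have msub (a : R) : measurable_fun setT (fun s : measurableTypeR R => s - a : measurableTypeR R).
  exact: measurable_funB.
have mg (a : R) : measurable_fun setT (fun s : measurableTypeR R => \1_`[0, 1]%classic s * gain r (s - a) : R).
  apply: measurable_funM; first exact: measurable_indic.
  exact: (measurableT_comp (measurable_gain r) (msub a)).
have mG (a : R) : measurable_fun setT (G a : measurableTypeR R -> R).
  rewrite (_ : G a = fun s => (2 * C) * (\1_`[0, 1]%classic s * gain r (s - a))).
    by apply: measurable_funM => //; exact: mg.
  by apply/funext => s'; rewrite /G; ring.
have Q0 : 0 <= 2 * C * (4 * j.+1%:R * 2^-1 ^+ j).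
  by apply: mulr_ge0; [exact: mulr_ge0|apply: mulr_ge0; [exact: mulr_ge0|exact: (ltW r0)]].
have Gge0 a t : 0 <= G a t.
  apply: mulr_ge0 => //; apply: mulr_ge0; last exact: gain_ge0.
  exact: mulr_ge0.
have KE (y : 'I_k -> R) : (\int[lebk]_x' (\prod_i G (y i) (x' ord0 i))%R%:E <=
    ((2 * C * (4 * j.+1%:R * 2^-1 ^+ j)) ^+ k)%:E)%E.
  apply: (integral_rV_prod_le (g := fun i => G (y i))).
  - by move=> i; exact: mG.
  - by move=> i t; exact: Gge0.
  - exact: Q0.
  - move=> i; rewrite EFinM.
    have GE t : (G (y i) t)%:E = ((2 * C)%:E * (\1_`[0, 1]%classic t * gain r (t - y i))%R%:E)%E.
      by rewrite -EFinM; congr EFin; rewrite /G; ring.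
    under eq_integral do rewrite GE.
    rewrite ge0_integralZl//.
    + apply: lee_wpmul2l; first by rewrite lee_fin mulr_ge0.
      exact: integral_gain.
    + by apply/measurable_EFinP; exact: mg.
    + by move=> t _; rewrite lee_fin mulr_ge0 ?gain_ge0.
    + by rewrite lee_fin mulr_ge0.
have kapC x x' : kap x x' = kap x' x.
  rewrite /kap; congr (_ * _); apply: eq_bigr => i _; congr (_ * _).
  by rewrite /gain distrC.
have G0 (y : 'I_k -> R) (x' : X) : 0 <= \prod_i G (y i) (x' ord0 i).
  by apply: prodr_ge0 => i _; exact: Gge0.
have K1 x : (\int[lebk]_x' (\1_ucube x' * kap x x')%R%:E <= K%:E)%E.
  under eq_integral do rewrite kapE EFinM.
  rewrite ge0_integralZl//.
  - rewrite /K EFinM; apply: lee_wpmul2l; first by rewrite lee_fin invr_ge0.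
    exact: (KE (fun i => x ord0 i)).
  - apply/measurable_EFinP; apply: measurable_prod => i _.
    exact: (measurableT_comp (mG _) (measurable_coord _ _)).
  - by move=> x' _; rewrite lee_fin; exact: (G0 (fun i => x ord0 i)).
have K2 x' : (\int[lebk]_x (\1_ucube x * kap x x')%R%:E <= K%:E)%E.
  by under eq_integral do rewrite kapC; exact: K1.
apply: (le_trans (slab_energy_le (ltW l0) FD' mk ms k0 s0 K1 K2 slab_pairing_le)).
rewrite /K mulrA mulfV// mul1r.
apply: lee_wpmul2l; first by rewrite lee_fin exprn_ge0.
apply: ge0_le_integralT => //.
- by move=> x; rewrite lee_fin mulr_ge0.
- by apply/measurable_EFinP; apply: measurable_funM => //; apply: measurable_indic; exact: measurable_unit_cube.
- exact: measurable_sqnorm_fibre FD.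
- move=> x; rewrite -[leRHS](fineK (sqnorm_fibre_fin x FD)) lee_fin -[leRHS]mul1r.
  by apply: ler_wpM2r => //; exact: s0.
Qed.

End main.

End smoothing.

(** * Uniform averages and the operators built from them *)

Section box_probability.
Context (R : realType) (n m : nat).
Local Notation Y := (borel 'M[R]_(n, m)).
Local Notation lamb := (lebesgue_mx R m n).

(** Lebesgue measure restricted to [0, r]^(n m) and normalised, presented through its integrals of
    nonnegative functions, the form in which it is used below. *)
Lemma exists_cube_probability (r : R) : 0 < r ->
  exists P : probability Y R, forall f : Y -> \bar R,
    measurable_fun setT f -> (forall h, 0 <= f h)%E ->
    (\int[P]_h f h = ((r ^+ (n * m))^-1)%:E *
       \int[lamb]_h ((\1_(mx_cube 0 r) h)%:E * f h))%E.
Proof.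
move=> r0.
have mD : measurable (mx_cube (0 : 'M[R]_(n, m)) r) by exact: measurable_mx_cube.
set D := mx_cube _ _ in mD *.
have rN : 0 < r ^+ (n * m) by exact: exprn_gt0.
have De : lamb D = (r ^+ (n * m))%:E by apply: lebesgue_mx_cube; exact: ltW.
pose nu := mrestr lamb mD.
have nuT : nu setT = (r ^+ (n * m))%:E by rewrite /nu /mrestr setTI.
pose P : probability Y R := mnormalize nu (@dirac _ Y (0 : 'M[R]_(n, m)) R).
have PE A : P A = (lamb (A `&` D) * ((r ^+ (n * m))^-1)%:E)%E.
  rewrite /P /= /mnormalize.
  rewrite [X in (X == 0%R) || _]nuT eqe gt_eqF//=.
  by rewrite [X in X == +oo%E]nuT [X in fine X]nuT.
have rNV : 0 <= (r ^+ (n * m))^-1 by rewrite invr_ge0 ltW.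
pose q : {nonneg R} := NngNum rNV.
exists P => f mf f0.
have P0 : P (~` D) = 0%E by rewrite PE setICl measure0 mul0e.
have mDC : measurable (~` D) by exact: measurableC.
rewrite (ge0_negligible_integral mDC measurableT mf _ P0)// setDE setCK setTI.
rewrite (@eq_measure_integral _ _ _ D (mscale q lamb)); last first.
  by move=> A mA AD; rewrite [LHS]PE setIidl// muleC.
rewrite ge0_integral_mscale//; last exact: measurable_funTS.
congr (_ * _)%E; rewrite integral_mkcond; apply: eq_integral => h _.
by rewrite patchE indicE; case: ifP => _; rewrite ?mul1e ?mul0e.
Qed.

End box_probability.

Section averages.
Context (R : realType) (n m : nat).
Local Notation Y := (borel 'M[R]_(n, m)).
Implicit Types (P Q : probability Y R) (f g : 'M[R]_(n, m) -> R).

Definition bounded_measurable g :=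
  measurable_fun setT (g : Y -> R) /\ exists M : R, forall y, `|g y| <= M.

Definition avg P g (y : 'M[R]_(n, m)) : R := \int[P]_h g (y + h).

Definition diff1 (v : 'M[R]_(n, m)) g (y : 'M[R]_(n, m)) : R := g y - g (y + v).

(** With A = [avg P] this is 1 - A^2. The square leaves two averages in each term of [smoothE]: one
    is spent on the measure mu, the other on the exponent p. *)
Definition bias P g (y : 'M[R]_(n, m)) : R := g y - avg P (avg P g) y.

Lemma measurable_addY d (T : measurableType d) (s t : T -> Y) :
  measurable_fun setT s -> measurable_fun setT t -> measurable_fun setT (fun x => (s x + t x : Y)).
Proof.
move=> ms mt; apply: measurable_mx => i j; under eq_fun do rewrite mxE.
apply: measurable_funD; first exact: (measurableT_comp (measurable_coord i j) ms).
exact: (measurableT_comp (measurable_coord i j) mt).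
Qed.

Lemma bounded_measurableB f g : bounded_measurable f -> bounded_measurable g ->
  bounded_measurable (fun y => f y - g y).
Proof.
move=> [mf [M fM]] [mg [M' gM]]; split; first exact: measurable_funB.
by exists (M + M') => y; apply: (le_trans (ler_normB _ _)); exact: lerD.
Qed.

Lemma bounded_measurable_translate g v : bounded_measurable g ->
  bounded_measurable (fun y => g (y + v)).
Proof.
move=> [mg [M gM]]; split; last by exists M => y; exact: gM.
exact: (measurableT_comp mg (measurable_translate v)).
Qed.

Lemma bounded_measurable_diff1 v g : bounded_measurable g -> bounded_measurable (diff1 v g).
Proof. by move=> gB; apply: bounded_measurableB => //; exact: bounded_measurable_translate. Qed.

Lemma prob_bounded_integrable d (T : measurableType d) (P : probability T R) (w : T -> R) (M : R) :
  measurable_fun setT w -> (forall h, `|w h| <= M) -> P.-integrable setT (EFin \o w).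
Proof.
move=> mw wM; apply: (integrable_bounded_support mw measurableT (M := M)).
  by rewrite [X in (X < _)%E]probability_setT ltry.
by move=> h; rewrite indicT mulr1.
Qed.

Lemma prob_Rintegral_le d (T : measurableType d) (P : probability T R) (w : T -> R) (M : R) :
  measurable_fun setT w -> (forall h, `|w h| <= M) -> `|\int[P]_h w h| <= M.
Proof.
move=> mw wM.
have P1 : (P setT < +oo)%E by rewrite [X in (X < _)%E]probability_setT ltry.
have := @Rintegral_bounded_support _ _ _ P w setT M mw measurableT P1.
rewrite [X in fine X]probability_setT mulr1; apply => h.
by rewrite indicT mulr1.
Qed.

Lemma measurable_shift2 g : measurable_fun setT (g : Y -> R) ->
  measurable_fun setT (fun p : Y * Y => g (p.1 + p.2)).
Proof. by move=> mg; apply: (measurableT_comp mg); exact: measurable_addY. Qed.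

Lemma measurable_shift1 g y : measurable_fun setT (g : Y -> R) ->
  measurable_fun setT (fun h : Y => g (y + h)).
Proof. by move=> mg; apply: (measurableT_comp mg); exact: measurable_addY. Qed.

Lemma bounded_measurable_avg P g : bounded_measurable g -> bounded_measurable (avg P g).
Proof.
move=> [mg [M gM]]; split.
  exact: (measurable_Rintegral2 P (measurable_shift2 mg)).
exists M => y; apply: prob_Rintegral_le; first exact: measurable_shift1.
by move=> h; exact: gM.
Qed.

Lemma bounded_measurable_bias P g : bounded_measurable g -> bounded_measurable (bias P g).
Proof. by move=> gB; apply: bounded_measurableB => //; do 2 apply: bounded_measurable_avg. Qed.

Lemma bounded_measurable_iter_bias P i g : bounded_measurable g ->
  bounded_measurable (iter i (bias P) g).
Proof. by move=> gB; elim: i => //= i; exact: bounded_measurable_bias. Qed.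

Lemma avgB P f g : bounded_measurable f -> bounded_measurable g ->
  avg P (fun y => f y - g y) = fun y => avg P f y - avg P g y.
Proof.
move=> [mf [M fM]] [mg [M' gM]]; apply/funext => y; rewrite /avg RintegralB//.
  exact: (prob_bounded_integrable P (measurable_shift1 y mf) (fun h => fM _)).
exact: (prob_bounded_integrable P (measurable_shift1 y mg) (fun h => gM _)).
Qed.

Lemma avg_translate P g v : avg P (fun y => g (y + v)) = fun y => avg P g (y + v).
Proof.
by apply/funext => y; apply: eq_Rintegral => h _; rewrite addrAC.
Qed.

Lemma avgC P Q g : bounded_measurable g -> avg P (avg Q g) = avg Q (avg P g).
Proof.
move=> [mg [M gM]]; apply/funext => y; rewrite /avg.
have m3 : measurable_fun setT (fun p : Y * Y => g (y + p.1 + p.2)).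
  apply: (measurableT_comp mg); apply: measurable_addY => //.
  exact: measurable_addY.
have oo (P' : probability Y R) : (P' setT < +oo)%E.
  by rewrite [X in (X < _)%E]probability_setT ltry.
have b h h' : `|g (y + h + h')| <= M * (\1_setT h * \1_setT h') by rewrite !indicT !mulr1.
have [-> _] := @Rintegral_Fubini _ _ _ _ _ P Q _ _ _ _ m3 measurableT measurableT (oo P) (oo Q) b.
by apply: eq_Rintegral => h _; apply: eq_Rintegral => h' _; rewrite addrAC.
Qed.

Lemma biasB P f g : bounded_measurable f -> bounded_measurable g ->
  bias P (fun y => f y - g y) = fun y => bias P f y - bias P g y.
Proof.
move=> fB gB; apply/funext => y; rewrite /bias.
have aB := bounded_measurable_avg P.
by rewrite avgB// avgB; [lra|exact: aB|exact: aB].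
Qed.

Lemma bias_diff1 P v g : bounded_measurable g -> bias P (diff1 v g) = diff1 v (bias P g).
Proof.
move=> gB; rewrite /diff1 biasB//; last exact: bounded_measurable_translate.
by apply/funext => y; rewrite /bias !avg_translate.
Qed.

Lemma avg_bias P Q g : bounded_measurable g -> avg Q (bias P g) = bias P (avg Q g).
Proof.
move=> gB; rewrite /bias avgB//; last by do 2 apply: bounded_measurable_avg.
apply/funext => y; rewrite avgC; last exact: bounded_measurable_avg.
by rewrite (avgC Q P).
Qed.

Lemma biasC P Q g : bounded_measurable g -> bias Q (bias P g) = bias P (bias Q g).
Proof.
move=> gB; have aB := bounded_measurable_avg Q.
transitivity (bias P (fun y => g y - avg Q (avg Q g) y)); last by [].
rewrite biasB; [|exact: gB|exact/aB/aB].
rewrite -!avg_bias//; last exact: aB.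
Qed.

Lemma iter_bias_comm P (op : ('M[R]_(n, m) -> R) -> 'M[R]_(n, m) -> R) i g :
  (forall f, bounded_measurable f -> bounded_measurable (op f)) ->
  (forall f, bounded_measurable f -> op (bias P f) = bias P (op f)) ->
  bounded_measurable g -> op (iter i (bias P) g) = iter i (bias P) (op g).
Proof.
move=> opB opC gB; elim: i => //= i ih.
by rewrite opC ?ih//; exact: bounded_measurable_iter_bias.
Qed.

(** This is 1 - (1 - A^2)^i, an approximate identity at the scale of P; in the expansion [smoothE]
    each term contains A^2. *)
Definition smooth P i g (y : 'M[R]_(n, m)) : R := g y - iter i (bias P) g y.

Lemma smoothE P i g y : smooth P i g y = \sum_(j < i) avg P (avg P (iter j (bias P) g)) y.
Proof.
elim: i => [|i ih]; first by rewrite big_ord0 /smooth /= subrr.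
by rewrite big_ord_recr /= -ih /smooth /= /bias; lra.
Qed.

(* 1 - (1 - S_Q)^i minus 1 - (1 - S_P)^i, written so that each term is both
   averaged at one scale and has i cancellations at the other. *)
Lemma smoothB P Q i g y : bounded_measurable g ->
  smooth Q i g y - smooth P i g y =
  smooth Q i (iter i (bias P) g) y - smooth P i (iter i (bias Q) g) y.
Proof.
move=> gB; rewrite /smooth.
have -> : iter i (bias Q) (iter i (bias P) g) = iter i (bias P) (iter i (bias Q) g).
  apply: (iter_bias_comm (op := iter i (bias Q))) => //.
    by move=> f; exact: bounded_measurable_iter_bias.
  move=> f fB; rewrite -(iter_bias_comm (op := bias P))//.
    by move=> f'; exact: bounded_measurable_bias.
  by move=> f' f'B; rewrite biasC.
by lra.
Qed.

End averages.

(** * The energy of averages and of iterated biases *)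

Section energy_averages.
Context (R : realType) (k m : nat).
Local Notation lebk := (lebesgue_rV R k).
Local Notation leb := (lebesgue_rV R m).
Local Notation V := (borel 'rV[R]_m).
Local Notation X := (borel 'rV[R]_k).
Local Notation Y := (borel 'M[R]_(k.+1, m)).
Local Notation lamb := (lebesgue_mx R m k.+1).
Variables (c : 'M[R]_(k, m)) (l : R).
Local Notation energy := (slab_energy c l).

(** P lives on B, in the form used: a bound valid on B bounds the mean. *)
Definition concentrated (P : probability Y R) (B : set Y) :=
  forall (f : Y -> \bar R) (K : R), measurable_fun setT f -> (forall h, 0 <= f h)%E ->
    (forall h, B h -> f h <= K%:E)%E -> (\int[P]_h f h <= K%:E)%E.

(** Convexity of the energy: Cauchy-Schwarz under P bounds the square of a mean by the mean of the
    squares, and Tonelli exchanges that mean with the integral over the slab. *)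
Lemma energy_average P B (W : 'M[R]_(k.+1, m) -> 'M[R]_(k.+1, m) -> R) (M K : R) :
  concentrated P B ->
  measurable_fun setT (fun p : Y * Y => W p.1 p.2) -> (forall z h, `|W z h| <= M) ->
  (forall h, B h -> (energy (W^~ h) <= K%:E)%E) ->
  (energy (fun z => \int[P]_h W z h)%R <= K%:E)%E.
Proof.
move=> PB mW WM WK.
have mS := measurable_slab c l.
have mi : measurable_fun setT (\1_(slab c l) : Y -> R) by exact: measurable_indic.
have mWz z : measurable_fun setT (fun h : Y => W z h).
  by apply: (@measurableT_comp _ _ _ _ _ _ (fun p : Y * Y => W p.1 p.2) _ (pair z)).
have mf : measurable_fun setT (fun p : Y * Y => (\1_(slab c l) p.1 * W p.1 p.2 ^+ 2)%R%:E).
  apply/measurable_EFinP; apply: measurable_funM; last exact: measurable_funX.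
  exact: (measurableT_comp mi measurable_fst).
have f0 p : (0 <= (\1_(slab c l) p.1 * W p.1 p.2 ^+ 2)%R%:E :> \bar R)%E.
  by rewrite lee_fin mulr_ge0// sqr_ge0.
apply: (@le_trans _ _ (\int[lamb]_z \int[P]_h (\1_(slab c l) z * W z h ^+ 2)%R%:E)%E).
  apply: ge0_le_integralT.
  - by move=> z; rewrite lee_fin mulr_ge0// sqr_ge0.
  - apply/measurable_EFinP; apply: measurable_funM => //; apply: measurable_funX.
    exact: (measurable_Rintegral2 P (f := fun p : Y * Y => W p.1 p.2)).
  - exact: (@measurable_fun_fubini_tonelli_F _ _ _ _ _ P _ mf f0).
  move=> z.
  have m1 : measurable_fun setT ((fun=> 1) : Y -> R) by exact: measurable_cst.
  have := @integral_cauchy_schwarz_weight _ _ _ P _ (W z) m1 (mWz z) (fun=> ler01).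
  under eq_Rintegral do rewrite mul1r.
  rewrite [X in (_ <= X * _)%E -> _](_ : _ = 1%E); last first.
    by rewrite integral_cst// mul1e; exact: probability_setT.
  rewrite mul1e; under [X in (_ <= X)%E -> _]eq_integral do rewrite mul1r.
  rewrite expe2 -EFinM -expr2 => h.
  under eq_integral do rewrite EFinM.
  rewrite ge0_integralZl//.
  - by rewrite EFinM; apply: lee_wpmul2l.
  - by apply/measurable_EFinP; apply: measurable_funX.
  - by move=> x _; rewrite lee_fin sqr_ge0.
rewrite (@fubini_tonelli _ _ _ _ _ lamb P _ mf f0).
apply: PB => //.
- exact: (@measurable_fun_fubini_tonelli_G _ _ _ _ _ lamb _ mf f0).
- by move=> h; apply: integral_ge0 => z _; exact: (f0 (z, h)).
Qed.

Implicit Types (hs : seq 'M[R]_(k.+1, m)) (g : 'M[R]_(k.+1, m) -> R).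

Section concentration.
Variables (P : probability Y R) (B : set Y).
Hypothesis PB : concentrated P B.

(** (1 - A^2) g is the mean of the differences g(z) - g(z + h + h') over independent h and h', so
    [energy_average] applies twice. *)
Lemma energy_bias g (K : R) : bounded_measurable g ->
  (forall h h', B h -> B h' -> (energy (diff1 (h + h') g) <= K%:E)%E) ->
  (energy (bias P g) <= K%:E)%E.
Proof.
move=> gB gK; have aB := bounded_measurable_avg P gB.
have [mg [M gM]] := gB; have [ma [M' aM]] := aB.
have M2 (a b : R) (A A' : R) : `|a| <= A -> `|b| <= A' -> `|a - b| <= A + A'.
  by move=> h h'; apply: (le_trans (ler_normB _ _)); exact: lerD.
have i1 z : P.-integrable setT (EFin \o (fun h : Y => avg P g (z + h))).
  exact: (prob_bounded_integrable P (measurable_shift1 z ma) (fun h => aM _)).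
have i2 z : P.-integrable setT (EFin \o (fun h : Y => g (z + h))).
  exact: (prob_bounded_integrable P (measurable_shift1 z mg) (fun h => gM _)).
have i0 z : P.-integrable setT (EFin \o (fun h : Y => g z)).
  exact: (prob_bounded_integrable P (measurable_cst (g z)) (fun h => gM z)).
have cst_int z : \int[P]_h g z = g z.
  by rewrite Rintegral_cst// [X in fine X]probability_setT mulr1.
have -> : bias P g = fun z => \int[P]_h (g z - avg P g (z + h)).
  by apply/funext => z; rewrite RintegralB// cst_int.
apply: (energy_average (M := M + M') PB).
- apply: measurable_funB; first exact: (measurableT_comp mg measurable_fst).
  exact: measurable_shift2.
- by move=> z h; exact: M2.
move=> h Bh.
have -> : (fun z => g z - avg P g (z + h)) = fun z => \int[P]_h' (g z - g (z + (h + h'))).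
  apply/funext => z; rewrite RintegralB// ?cst_int; last first.
    by under eq_fun do rewrite addrA; exact: i2.
  by congr (_ - _); apply: eq_Rintegral => h' _; rewrite addrA.
apply: (energy_average (M := M + M) PB).
- apply: measurable_funB; first exact: (measurableT_comp mg measurable_fst).
  under eq_fun do rewrite addrA.
  apply: (measurableT_comp mg); apply: measurable_addY => //.
  exact: (measurableT_comp (measurable_translate h) measurable_fst).
- by move=> z h'; exact: M2.
by move=> h' Bh'; exact: gK.
Qed.

Lemma mx_diffs_rcons hs (v : 'M[R]_(k.+1, m)) g : mx_diffs hs (diff1 v g) = mx_diffs (rcons hs v) g.
Proof. by elim: hs => //= h hs ->. Qed.

Lemma bounded_measurable_mx_diffs hs g : bounded_measurable g ->
  bounded_measurable (mx_diffs hs g).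
Proof.
move=> gB; elim: hs => //= h hs ih.
exact: (bounded_measurable_diff1 h ih).
Qed.

Lemma mx_diffs_iter_bias Q hs i g : bounded_measurable g ->
  mx_diffs hs (iter i (bias Q) g) = iter i (bias Q) (mx_diffs hs g).
Proof.
move=> gB; apply: (iter_bias_comm (op := mx_diffs hs)) => //.
  by move=> f; exact: bounded_measurable_mx_diffs.
move=> f fB; elim: hs => //= h hs ->.
by rewrite -[LHS]/(diff1 h (bias Q (mx_diffs hs f))) -bias_diff1//; exact: bounded_measurable_mx_diffs.
Qed.

(** Biases commute with differences, so i of them unfold into i-fold differences with steps in B +
    B. *)
Lemma energy_iter_bias i g (K : R) : bounded_measurable g ->
  (forall hs, size hs = i ->
     (forall h, h \in hs -> exists a b, [/\ B a, B b & h = a + b]) ->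
     (energy (mx_diffs hs g) <= K%:E)%E) ->
  (energy (iter i (bias P) g) <= K%:E)%E.
Proof.
elim: i g => [|i ih] g gB gK; first by have := gK [::] erefl; apply.
rewrite iterS; apply: energy_bias; first exact: bounded_measurable_iter_bias.
move=> a b Ba Bb.
rewrite (iter_bias_comm (op := diff1 (a + b)))//; last 2 first.
- by move=> f; exact: bounded_measurable_diff1.
- by move=> f fB; rewrite bias_diff1.
apply: ih; first exact: bounded_measurable_diff1.
move=> hs shs hsB; rewrite mx_diffs_rcons; apply: gK; first by rewrite size_rcons shs.
move=> h; rewrite mem_rcons in_cons => /predU1P[->|]; last exact: hsB.
by exists a, b.
Qed.

End concentration.

(** Cauchy-Schwarz in x over the unit cube, which has measure 1, then translation invariance in the
    base point; the direction rows contribute their volume. There is no decay here, and the bound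
    serves the coarsest scale. *)
Lemma slab_energy_trivial F M L : 0 <= l -> fibre_data F M L ->
  (energy (ktransform F) <= (l ^+ (k * m))%:E * fibre_sqnorm F)%E.
Proof.
move=> l0 FD; have [L0 mF FM] := FD.
have mU := @measurable_unit_cube R k.
have mS := measurable_slab c l.
have mInt := fibre_data_integrand FD.
have mi : measurable_fun setT (\1_(slab c l) : Y -> R) by exact: measurable_indic.
have mf : measurable_fun setT (fun p : Y * X =>
    (\1_(slab c l) p.1 * F (p.2, kplane_point p.1 p.2) ^+ 2)%R%:E).
  apply/measurable_EFinP; apply: measurable_funM; last exact: measurable_funX.
  exact: (measurableT_comp mi measurable_fst).
have f0 p : (0 <= (\1_(slab c l) p.1 * F (p.2, kplane_point p.1 p.2) ^+ 2)%R%:E :> \bar R)%E.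
  by rewrite lee_fin mulr_ge0// sqr_ge0.
apply: (@le_trans _ _ (\int[lamb]_z \int[lebk]_x (\1_(slab c l) z * F (x, kplane_point z x) ^+ 2)%R%:E)%E).
  apply: ge0_le_integralT.
  - by move=> z; rewrite lee_fin mulr_ge0// sqr_ge0.
  - apply/measurable_EFinP; apply: measurable_funM => //; apply: measurable_funX.
    exact: measurable_ktransform FD.
  - exact: (@measurable_fun_fubini_tonelli_F _ _ _ _ _ lebk _ mf f0).
  move=> z.
  have mz := fibre_data_integrand_fst z FD.
  have := @integral_cauchy_schwarz_weight _ _ _ lebk \1_(@unit_cube R k : set X)
    (fun x => F (x, kplane_point z x)) (measurable_indic mU) mz (fun _ => ler0n _ _).
  have e x : \1_(@unit_cube R k : set X) x * F (x, kplane_point z x) = F (x, kplane_point z x).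
    rewrite indicE; have [h|h] := pselect ((@unit_cube R k : set X) x).
      by rewrite mem_set// mul1r.
    by rewrite (fibre_data0 _ FD h) mulr0.
  under eq_Rintegral do rewrite e.
  rewrite (integral_indic _ measurableT mU) setIT [X in (_ <= X * _)%E]lebesgue_unit_cube mul1e.
  under [X in (_ <= X)%E -> _]eq_integral do rewrite expr2 mulrA e -expr2.
  rewrite expe2 -EFinM -expr2 => h.
  under eq_integral do rewrite EFinM.
  rewrite ge0_integralZl//.
  - by rewrite EFinM; apply: lee_wpmul2l.
  - by apply/measurable_EFinP; apply: measurable_funX.
  - by move=> x _; rewrite lee_fin sqr_ge0.
rewrite (@fubini_tonelli _ _ _ _ _ lamb lebk _ mf f0).
rewrite /fibre_sqnorm -ge0_integralZl//; last 3 first.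
- exact: measurable_sqnorm_fibre FD.
- by move=> x _; exact: sqnorm_ge0.
- by rewrite lee_fin exprn_ge0.
rewrite /fubini_G le_eqVlt; apply/orP; left; apply/eqP; apply: eq_integral => x _ /=.
have mFx := fibre_data_fst x FD.
have mFx2 v : measurable_fun setT (fun w : V => (F (x, w + v) ^+ 2)%:E).
  apply/measurable_EFinP; apply: measurable_funX.
  exact: (measurableT_comp mFx (measurable_translate v)).
have mz : measurable_fun setT (fun z : Y => (\1_(slab c l) z * F (x, kplane_point z x) ^+ 2)%R%:E).
  by apply: (@measurableT_comp _ _ _ _ _ _ (fun p : Y * X =>
    (\1_(slab c l) p.1 * F (p.2, kplane_point p.1 p.2) ^+ 2)%R%:E) _ (fun z : Y => (z, x))).
rewrite (ge0_integral_lebesgue_mxS mz (fun z => f0 (z, x))).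
have mC := measurable_mx_cube c l.
have mg : measurable_fun setT (fun p : V * borel 'M[R]_(k, m) =>
    (\1_(mx_cube c l) p.2 * F (x, p.1 + x *m p.2) ^+ 2)%R%:E).
  apply/measurable_EFinP; apply: measurable_funM.
    exact: (measurableT_comp (measurable_indic mC) measurable_snd).
  apply: measurable_funX; apply: (measurableT_comp mFx); apply: measurable_addV => //.
  by apply: (@measurable_mulmxr _ _ _ (V * borel 'M[R]_(k, m))%type k (fun=> x) snd).
have g0 p : (0 <= (\1_(mx_cube c l) p.2 * F (x, p.1 + x *m p.2) ^+ 2)%R%:E :> \bar R)%E.
  by rewrite lee_fin mulr_ge0// sqr_ge0.
under eq_integral do under eq_integral do rewrite indic_slab kplane_point_cons.
rewrite (@fubini_tonelli _ _ _ _ _ leb (lebesgue_mx R m k) _ mg g0) /fubini_G /=.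
have step z : (\int[leb]_w (\1_(mx_cube c l) z * F (x, w + x *m z) ^+ 2)%R%:E =
   (\1_(mx_cube c l) z)%:E * sqnorm (fun u => F (x, u)))%E.
  rewrite -(sqnorm_translate (x *m z) mFx) /sqnorm -ge0_integralZl//.
  by move=> u _; rewrite lee_fin sqr_ge0.
under eq_integral do rewrite step.
rewrite ge0_integralZr//; [|exact/measurable_EFinP/measurable_indic|exact: sqnorm_ge0].
by rewrite (integral_indic _ measurableT mC) setIT [X in (X * _)%E]lebesgue_mx_cube.
Qed.

End energy_averages.

(** * From mu to Lebesgue measure: the ball condition *)

Section frostman.
Context (R : realType) (k m : nat).
Local Notation Y := (borel 'M[R]_(k.+1, m)).
Local Notation lamb := (lebesgue_mx R m k.+1).
Local Notation N := (k.+1 * m)%N.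

Lemma measurable_enorm n p (y : 'M[R]_(n, p)) :
  measurable_fun setT (fun z : borel 'M[R]_(n, p) => enorm (z - y)).
Proof.
rewrite /enorm; apply: (@measurableT_comp _ _ _ _ _ _ (@Num.sqrt R) _
  (fun z : borel 'M[R]_(n, p) => \sum_i \sum_j (z - y) i j ^+ 2)).
  by apply: continuous_measurable_fun; exact: sqrt_continuous.
apply: measurable_sum => i; apply: measurable_sum => j; apply: measurable_funX.
under eq_fun do rewrite !mxE.
by apply: measurable_funB => //; exact: measurable_coord.
Qed.

Lemma measurable_eball n p (y : 'M[R]_(n, p)) (r : R) :
  measurable (eball y r : set (borel 'M[R]_(n, p))).
Proof.
rewrite (_ : eball y r = (fun z : borel 'M[R]_(n, p) => enorm (z - y)) @^-1` `]-oo, r[%classic).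
  by rewrite -[X in measurable X]setTI; apply: (measurable_enorm y) => //; exact: measurable_itv.
by apply/seteqP; split => z; rewrite /eball /= in_itv.
Qed.

(** The constant np + 1 exceeds the sharp sqrt(np) and makes the inequality strict, as open balls
    require. *)
Lemma enorm_lt n p (y : 'M[R]_(n, p)) (r : R) : 0 < r -> (forall i j, `|y i j| <= r) ->
  enorm y < (n * p).+1%:R * r.
Proof.
move=> r0 yr; have X0 : 0 < (n * p).+1%:R * r by rewrite mulr_gt0.
rewrite /enorm -[ltRHS]ger0_norm ?(ltW X0)// -sqrtr_sqr ltr_sqrt ?exprn_gt0//.
apply: (@le_lt_trans _ _ (\sum_(i < n) \sum_(j < p) r ^+ 2)).
  apply: ler_sum => i _; apply: ler_sum => j _.
  by rewrite -real_normK ?num_real// ler_sqr ?nnegrE ?(ltW r0).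
have -> : \sum_(i < n) \sum_(j < p) r ^+ 2 = (n * p)%:R * r ^+ 2.
  under eq_bigr do rewrite sumr_const card_ord.
  by rewrite sumr_const card_ord -mulrnA mulnC mulr_natl.
rewrite exprMn ltr_pM2r ?exprn_gt0//.
rewrite -natrX ltr_nat; nia.
Qed.

Variables (mu : {finite_measure set Y -> \bar R}) (c2 alpha : R).
Hypothesis frost : forall (y : 'M[R]_(k.+1, m)) (r : R), 0 < r ->
  (mu (eball y r) <= (c2 * r `^ alpha)%:E)%E.

(** By Cauchy-Schwarz the square of the average at y is at most r^-N times the integral of H^2 over
    y + [0, r]^N. After Tonelli, the weight at z is the mu-measure of the points y with z in y +
    [0, r]^N; these lie in the ball of radius (N+1) r about z, to which the hypothesis on mu
    applies. Taking y in the set [S0] of full measure keeps z in the slab. *)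
Lemma frostman_average (P : probability Y R) (r : R) (S0 : set Y) (c : 'M[R]_(k, m)) (l : R)
    (H : 'M[R]_(k.+1, m) -> R) :
  0 < r ->
  (forall f : Y -> \bar R, measurable_fun setT f -> (forall h, 0 <= f h)%E ->
    (\int[P]_h f h = ((r ^+ N)^-1)%:E * \int[lamb]_h ((\1_(mx_cube 0 r) h)%:E * f h))%E) ->
  measurable S0 -> mu (~` S0) = 0%E ->
  (forall y h, S0 y -> mx_cube 0 r h -> slab c l (y + h)) ->
  bounded_measurable H ->
  (\int[mu]_y ((avg P H y ^+ 2)%R%:E) <=
   ((r ^+ N)^-1 * (c2 * (N.+1%:R * r) `^ alpha))%:E * slab_energy c l H)%E.
Proof.
move=> r0 PE mS0 S00 S0slab [mH [M HM]].
have rN0 : 0 < r ^+ N by exact: exprn_gt0.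
have mbox : measurable (mx_cube (0 : 'M[R]_(k.+1, m)) r) by exact: measurable_mx_cube.
set box := mx_cube _ r in PE S0slab mbox.
have mS := measurable_slab c l.
have mib : measurable_fun setT (\1_box : Y -> R) by exact: measurable_indic.
have miS0 : measurable_fun setT (\1_S0 : Y -> R) by exact: measurable_indic.
have mavg : measurable_fun setT (fun y : Y => (avg P H y ^+ 2)%:E).
  apply/measurable_EFinP; apply: measurable_funX.
  exact: (measurable_Rintegral2 P (measurable_shift2 mH)).
have msub : measurable_fun setT (fun p : Y * Y => (p.2 - p.1 : Y)).
  apply: measurable_mx => i j; under eq_fun do rewrite !mxE.
  by apply: measurable_funB; [exact: (measurableT_comp (measurable_coord _ _) measurable_snd)|
    exact: (measurableT_comp (measurable_coord _ _) measurable_fst)].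
pose g (p : Y * Y) : R := (r ^+ N)^-1 * (\1_S0 p.1 * \1_box (p.2 - p.1) * H p.2 ^+ 2).
have mg : measurable_fun setT g.
  apply: measurable_funM => //; apply: measurable_funM; last first.
    by apply: measurable_funX; exact: (measurableT_comp mH measurable_snd).
  apply: measurable_funM; first exact: (measurableT_comp miS0 measurable_fst).
  exact: (measurableT_comp mib msub).
have iN0 : 0 <= (r ^+ N)^-1 by rewrite invr_ge0 ltW.
have g0 p : 0 <= g p.
  by apply: mulr_ge0 => //; apply: mulr_ge0; [exact: mulr_ge0|exact: sqr_ge0].
have mge : measurable_fun setT (fun p => (g p)%:E) by exact/measurable_EFinP.
have ge0 p : (0 <= (g p)%:E :> \bar R)%E by rewrite lee_fin.
have sub2 z : measurable_fun setT (fun y : Y => (z - y : Y)).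
  by apply: (@measurableT_comp _ _ _ _ _ _ (fun p : Y * Y => (p.2 - p.1 : Y)) _ (fun y : Y => (y, z))).
apply: (@le_trans _ _ (\int[mu]_y \int[lamb]_z (g (y, z))%:E)%E).
  rewrite (ge0_negligible_integral (measurableC mS0) measurableT mavg _ S00); last first.
    by move=> y _; rewrite lee_fin sqr_ge0.
  rewrite setDE setCK setTI integral_mkcond; apply: ge0_le_integralT.
  - by move=> y; rewrite patchE; case: ifP => // _; rewrite lee_fin sqr_ge0.
  - by apply/(measurable_restrictT _ mS0); exact: measurable_funTS.
  - exact: (@measurable_fun_fubini_tonelli_F _ _ _ _ _ lamb _ mge ge0).
  move=> y; rewrite patchE; case: ifPn => [yS0|_]; last exact: integral_ge0.
  have mHy := measurable_shift1 y mH.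
  have m1 : measurable_fun setT ((fun=> 1) : Y -> R) by exact: measurable_cst.
  have := @integral_cauchy_schwarz_weight _ _ _ P _ _ m1 mHy (fun=> ler01).
  under eq_Rintegral do rewrite mul1r.
  rewrite [X in (_ <= X * _)%E -> _](_ : _ = 1%E); last first.
    by rewrite integral_cst// mul1e; exact: probability_setT.
  rewrite mul1e; under [X in (_ <= X)%E -> _]eq_integral do rewrite mul1r.
  rewrite expe2 -EFinM -expr2 => /le_trans; apply.
  rewrite PE; last 2 first.
  - by apply/measurable_EFinP; exact: measurable_funX.
  - by move=> h; rewrite lee_fin sqr_ge0.
  have mq : measurable_fun setT (fun h : Y => ((\1_box h)%:E * (H (y + h) ^+ 2)%R%:E)%E).
    by apply: emeasurable_funM; apply/measurable_EFinP => //; exact: measurable_funX.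
  have q0 (h : Y) : (0 <= (\1_box h)%:E * (H (y + h) ^+ 2)%R%:E :> \bar R)%E.
    by rewrite mule_ge0// lee_fin// sqr_ge0.
  rewrite -(ge0_integralZl _ measurableT mq (fun h _ => q0 h)) ?lee_fin//.
  have mgy : measurable_fun setT (fun z : Y => (g (y, z))%:E).
    by apply: (@measurableT_comp _ _ _ _ _ _ (fun p => (g p)%:E) _ (pair y)).
  rewrite -(ge0_integral_preserving (lebesgue_mx_translate y) mgy)//.
  rewrite le_eqVlt; apply/orP; left; apply/eqP; apply: eq_integral => h _.
  have y1 : \1_S0 y = 1 :> R by rewrite indicE yS0.
  by rewrite /g /= y1 mul1r addrK -!EFinM (addrC h y).
rewrite (@fubini_tonelli _ _ _ _ _ mu lamb _ mge ge0) /fubini_G /=.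
have C0 : 0 <= (r ^+ N)^-1 * (c2 * (N.+1%:R * r) `^ alpha).
  rewrite mulr_ge0 ?invr_ge0 ?(ltW rN0)//.
  by rewrite -lee_fin; apply: le_trans (frost 0 _); rewrite ?mulr_gt0.
have mq : measurable_fun setT (fun z : Y => (\1_(slab c l) z * H z ^+ 2)%R%:E).
  apply/measurable_EFinP; apply: measurable_funM; last exact: measurable_funX.
  exact: measurable_indic.
have q0 (z : Y) : (0 <= (\1_(slab c l) z * H z ^+ 2)%R%:E :> \bar R)%E.
  by rewrite lee_fin mulr_ge0// sqr_ge0.
rewrite /slab_energy -(ge0_integralZl _ measurableT mq (fun z _ => q0 z)) ?lee_fin//.
apply: ge0_le_integralT.
- by move=> z; apply: integral_ge0.
- exact: (@measurable_fun_fubini_tonelli_G _ _ _ _ _ mu _ mge ge0).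
- exact: emeasurable_funM.
move=> z.
set B := eball z (N.+1%:R * r).
have mB : measurable (B : set Y) by exact: measurable_eball.
pose A := (r ^+ N)^-1 * (\1_(slab c l) z * H z ^+ 2).
have A0 : 0 <= A by apply: mulr_ge0 => //; apply: mulr_ge0 => //; exact: sqr_ge0.
apply: (@le_trans _ _ (\int[mu]_y (A%:E * (\1_B y)%:E))%E).
  apply: ge0_le_integralT => //.
  - by apply: (@measurableT_comp _ _ _ _ _ _ (fun p => (g p)%:E) _ (fun y : Y => (y, z))).
  - by apply: emeasurable_funM => //; apply/measurable_EFinP; exact: measurable_indic.
  move=> y; rewrite -EFinM lee_fin /g /A /=.
  rewrite -[leRHS]mulrA ler_wpM2l ?invr_ge0 ?(ltW rN0)//.
  rewrite [leLHS]mulrC -[leRHS]mulrA [leRHS]mulrC -[leRHS]mulrA ler_wpM2l ?sqr_ge0//.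
  have [yS|yS] := boolP (y \in S0); last by rewrite indicE (negbTE yS) !mul0r mulr_ge0.
  have [zb|zb] := boolP (z - y \in box); last first.
    by rewrite [X in _ * X]indicE (negbTE zb) !mulr0 mulr_ge0.
  have zs : slab c l z by rewrite -[z](subrK y) addrC; apply: S0slab; [exact: set_mem|exact: set_mem].
  have yB : B y.
    rewrite /B /eball /=; apply: enorm_lt => // i j.
    have := set_mem zb i j; rewrite /= in_itv /= !mxE add0r => /andP[h1 h2].
    by rewrite distrC ger0_norm.
  by rewrite !indicE yS zb !mem_set.
have mBi : measurable_fun setT (fun y : Y => (\1_B y)%:E : \bar R).
  by apply/measurable_EFinP; exact: measurable_indic.
rewrite (ge0_integralZl _ measurableT mBi) ?lee_fin//.
rewrite (integral_indic mu measurableT mB) setIT.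
rewrite /A EFinM -muleA [leRHS]muleC [leRHS](_ : _ = ((r ^+ N)^-1)%:E * (((\1_(slab c l) z * H z ^+ 2)%R)%:E * (c2 * (N.+1%:R * r) `^ alpha)%:E))%E; last first.
  by rewrite EFinM muleCA.
apply: lee_wpmul2l; first by rewrite lee_fin invr_ge0 ltW.
apply: lee_wpmul2l; first by rewrite lee_fin mulr_ge0// sqr_ge0.
by apply: frost; rewrite mulr_gt0.
Qed.

End frostman.

(** * A Bernstein inequality along the fibres *)

Section bernstein.
Context (R : realType) (k m : nat).
Local Notation lebk := (lebesgue_rV R k).
Local Notation leb := (lebesgue_rV R m).
Local Notation V := (borel 'rV[R]_m).
Local Notation X := (borel 'rV[R]_k).
Local Notation Y := (borel 'M[R]_(k.+1, m)).
Local Notation lamb := (lebesgue_mx R m k.+1).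
Local Notation N := (k.+1 * m)%N.
Local Notation ucube := (@unit_cube R k : set X).
Implicit Types F : 'rV[R]_k * 'rV[R]_m -> R.

Definition fibre_avg (P : probability Y R) F (p : 'rV[R]_k * 'rV[R]_m) : R :=
  \int[P]_h F (p.1, p.2 + kplane_point h p.1).

Lemma measurable_fibre_shift F : measurable_fun setT (F : X * V -> R) ->
  measurable_fun setT (fun q : (X * V) * Y => F (q.1.1, q.1.2 + kplane_point q.2 q.1.1)).
Proof.
move=> mF; apply: (@measurableT_comp _ _ _ _ _ _ (F : X * V -> R) _
  (fun q : (X * V) * Y => (q.1.1, q.1.2 + kplane_point q.2 q.1.1) : X * V)) => //.
apply: measurable_fun_pair; first exact: measurableT_comp.
apply: measurable_addV; first exact: measurableT_comp.
apply: (@measurable_kplane_point _ _ _ _ ((X * V) * Y)%type snd (fun q => q.1.1)) => //.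
exact: measurableT_comp.
Qed.

Lemma measurable_fibre_shift1 F x u : measurable_fun setT (F : X * V -> R) ->
  measurable_fun setT (fun h : Y => F (x, u + kplane_point h x)).
Proof.
move=> /measurable_fibre_shift mF.
by apply: (@measurableT_comp _ _ _ _ _ _
  (fun q : (X * V) * Y => F (q.1.1, q.1.2 + kplane_point q.2 q.1.1)) _ (pair (x, u))).
Qed.

(** As for differences, a translation of y acts on each fibre as a translation, so averaging T F in
    y is the transform of a fibrewise average of F. *)
Lemma avg_ktransform P F M L : fibre_data F M L ->
  avg P (ktransform F) = ktransform (fibre_avg P F).
Proof.
move=> FD; have [L0 mF FM] := FD; apply/funext => y.
have mU := @measurable_unit_cube R k.
have mf : measurable_fun setT (fun p : Y * X => F (p.2, kplane_point (y + p.1) p.2)).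
  apply: (@measurableT_comp _ _ _ _ _ _ (F : X * V -> R) _
    (fun p : Y * X => (p.2, kplane_point (y + p.1) p.2) : X * V)) => //.
  apply: measurable_fun_pair => //.
  apply: (@measurable_kplane_point _ _ _ _ (Y * X)%type (fun p => y + p.1) snd) => //.
  exact: measurable_addY.
have b h x : `|F (x, kplane_point (y + h) x)| <= `|M| * (\1_setT h * \1_ucube x).
  by rewrite indicT mul1r; exact: fibre_data_integrand_le FD.
have P1 : (P setT < +oo)%E by rewrite [X in (X < _)%E]probability_setT ltry.
have [e _] := @Rintegral_Fubini _ _ _ _ _ P lebk _ _ _ _ mf measurableT mU P1 (lebesgue_unit_cube_lty R k) b.
rewrite /avg /ktransform e; apply: eq_Rintegral => x _.
by apply: eq_Rintegral => h _; rewrite /= kplane_pointD.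
Qed.

Lemma fibre_data_avg P F M L (r : R) : 0 <= r -> concentrated P (mx_cube 0 r) ->
  fibre_data F M L -> fibre_data (fibre_avg P F) M (L + k.+1%:R * r).
Proof.
move=> r0 PB FD; have [L0 mF FM] := FD; split.
- by rewrite addr_ge0// mulr_ge0.
- exact: (measurable_Rintegral2 P (measurable_fibre_shift mF)).
move=> x u; rewrite /fibre_avg /=.
have mh := measurable_fibre_shift1 x u mF.
rewrite -lee_fin; apply: (le_trans (abs_Rintegral_le P mh)); apply: PB.
- by apply/measurable_EFinP; apply: measurableT_comp.
- by move=> h; rewrite lee_fin.
move=> h hB; rewrite lee_fin; apply: (le_trans (FM _ _)).
have M0 : 0 <= M.
  have := FM 0 0; rewrite !indicE !mem_set ?mulr1.
  - exact: le_trans.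
  - by apply/cube0P => j; rewrite mxE normr0.
  - by move=> i; rewrite /= in_itv /= mxE lexx ler01.
apply: ler_wpM2l => //.
have [xU|xU] := pselect (ucube x); last by rewrite indicE memNset// !mul0r.
apply: ler_wpM2l => //.
have [uC|uC] := pselect (cube0 (L + k.+1%:R * r) u).
  by rewrite [leRHS]indicE mem_set// indicE lern1 leq_b1.
rewrite indicE memNset// => /cube0P h'; apply: uC; apply/cube0P => j.
have hb i i' : `|h i i'| <= r.
  by have := hB i i'; rewrite /= in_itv /= mxE add0r => /andP[h1 h2]; rewrite ger0_norm.
have := h' j; rewrite mxE => h1.
have := kplane_point_le j r0 xU hb => h2.
set a := u ord0 j in h1 *; set e := kplane_point h x ord0 j in h1 h2.
by have := ler_normB (a + e) e; rewrite addrK; lra.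
Qed.

Section power.
Variables (P : probability Y R) (r p : R).
Hypotheses (r0 : 0 < r) (p1 : 1 <= p) (p2 : p <= 2).
Hypothesis PE : forall f : Y -> \bar R, measurable_fun setT f -> (forall h, 0 <= f h)%E ->
    (\int[P]_h f h = ((r ^+ N)^-1)%:E * \int[lamb]_h ((\1_(mx_cube 0 r) h)%:E * f h))%E.
Variables (F : 'rV[R]_k * 'rV[R]_m -> R) (M L : R).
Hypothesis FD : fibre_data F M L.

Definition fibre_power (x : 'rV[R]_k) : \bar R := (\int[leb]_u (`|F (x, u)| `^ p)%R%:E)%E.

Let mF : measurable_fun setT (F : X * V -> R). Proof. by case: FD. Qed.

Let mpow d (T : measurableType d) (w : T -> R) : measurable_fun setT w ->
  measurable_fun setT (fun t => (`|w t| `^ p)%R%:E).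
Proof.
move=> mw; apply/measurable_EFinP.
apply: (@measurableT_comp _ _ _ _ _ _ (fun x : R => x `^ p)); first exact: measurable_powR.
exact: measurableT_comp.
Qed.

Lemma fibre_power_ge0 x : (0 <= fibre_power x)%E.
Proof. by apply: integral_ge0 => u _; rewrite lee_fin powR_ge0. Qed.

Lemma fibre_power_fin x : fibre_power x \is a fin_num.
Proof.
have [L0 _ FM] := FD; have p0 : 0 < p by exact: lt_le_trans ltr01 p1.
rewrite ge0_fin_numE ?fibre_power_ge0//.
apply: (@le_lt_trans _ _ (\int[leb]_u ((`|M| `^ p)%:E * (\1_(cube0 L) u)%:E))%E).
  apply: ge0_le_integralT.
  - by move=> u; rewrite lee_fin powR_ge0.
  - exact: (mpow (fibre_data_fst x FD)).
  - apply: emeasurable_funM => //; apply/measurable_EFinP/measurable_indic.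
    exact: measurable_cube0.
  move=> u; rewrite -EFinM lee_fin.
  have [uC|uC] := pselect (cube0 L u).
    rewrite indicE mem_set// mulr1; apply: ge0_ler_powR; rewrite ?nnegrE ?(ltW p0)//.
    exact: (fibre_data_bound (x, u) FD).
  have -> : F (x, u) = 0.
    apply/eqP; rewrite -normr_le0; apply: (le_trans (FM _ _)).
    by rewrite [X in _ * (_ * X)]indicE memNset// !mulr0.
  by rewrite normr0 powR0 ?gt_eqF// mulr_ge0// powR_ge0.
rewrite ge0_integralZl ?lee_fin ?powR_ge0//; last first.
  by apply/measurable_EFinP/measurable_indic; exact: measurable_cube0.
rewrite integral_indic//; last exact: measurable_cube0.
rewrite setIT lte_mul_pinfty ?lee_fin ?powR_ge0//.
exact: lebesgue_cube0_lty.
Qed.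

Lemma fibre_power_translate x v :
  (\int[leb]_u (`|F (x, u + v)| `^ p)%R%:E = fibre_power x)%E.
Proof.
have mx := mpow (fibre_data_fst x FD).
rewrite /fibre_power -(ge0_integral_preserving (lebesgue_rV_translate v) mx)//.
Qed.

(** Let B(u) be the P-mean of |F|^p over the translates of u. Jensen gives |A F|^p <= B(u); the
    integral of B is the p-th power of the L^p norm of the fibre, and B is at most b, which is r^-m
    times that power, because the base point of h has density at most r^-m. Then |A F|^2, which is
    |A F|^(p (2/p - 1)) times |A F|^p, is at most b^(2/p - 1) B, and this is integrated in u. *)
Lemma sqnorm_fibre_avg x :
  (sqnorm (fun u => fibre_avg P F (x, u)) <=
   (((r ^+ m)^-1) `^ (2 / p - 1))%:E * fibre_power x `^ (2 / p))%E.
Proof.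
have p0 : 0 < p by exact: lt_le_trans ltr01 p1.
set b := (r ^+ m)^-1 * fine (fibre_power x).
pose B u := (\int[P]_h (`|F (x, u + kplane_point h x)| `^ p)%R%:E)%E.
have rm0 : 0 < r ^+ m by exact: exprn_gt0.
have mh u := mpow (measurable_fibre_shift1 x u mF).
have h0 u (h : Y) : (0 <= (`|F (x, u + kplane_point h x)| `^ p)%R%:E :> \bar R)%E.
  by rewrite lee_fin powR_ge0.
have AB u : ((`|fibre_avg P F (x, u)| `^ p)%R%:E <= B u)%E.
  apply: jensen_powR => //; first exact: probability_setT.
  exact: measurable_fibre_shift1.
have mj : measurable_fun setT (fun q : V * Y => (`|F (x, q.1 + kplane_point q.2 x)| `^ p)%R%:E).
  apply: mpow.
  apply: (@measurableT_comp _ _ _ _ _ _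
    (fun q : (X * V) * Y => F (q.1.1, q.1.2 + kplane_point q.2 q.1.1)) _
    (fun q : V * Y => ((x, q.1), q.2))); first exact: measurable_fibre_shift.
  by apply: measurable_fun_pair => //; apply: measurable_fun_pair.
have j0 (q : V * Y) : (0 <= (`|F (x, q.1 + kplane_point q.2 x)| `^ p)%R%:E :> \bar R)%E.
  by rewrite lee_fin powR_ge0.
have Bb u : (B u <= b%:E)%E.
  rewrite /B PE//.
  have mC := measurable_mx_cube (0 : 'M[R]_(k, m)) r.
  have mi : measurable_fun setT (\1_(mx_cube (0 : 'M[R]_(k.+1, m)) r) : Y -> R).
    by apply: measurable_indic; exact: measurable_mx_cube.
  have mf : measurable_fun setT (fun h : Y => ((\1_(mx_cube 0 r) h)%:E *
      (`|F (x, u + kplane_point h x)| `^ p)%R%:E)%E).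
    by apply: emeasurable_funM => //; exact/measurable_EFinP.
  have mfc := measurableT_comp mf (@measurable_mx_cons R m k).
  have f0 (h : Y) : (0 <= (\1_(mx_cube 0 r) h)%:E * (`|F (x, u + kplane_point h x)| `^ p)%R%:E :> \bar R)%E.
    by rewrite mule_ge0// lee_fin.
  rewrite (ge0_integral_lebesgue_mxS mf f0).
  have mg : measurable_fun setT (fun q : V * borel 'M[R]_(k, m) =>
      ((\1_(mx_cube 0 r) q.2)%:E * (`|F (x, q.1 + (u + x *m q.2))| `^ p)%R%:E)%E).
    apply: emeasurable_funM.
      by apply/measurable_EFinP; exact: (measurableT_comp (measurable_indic mC) measurable_snd).
    apply: mpow; apply: (measurableT_comp (fibre_data_fst x FD)).
    apply: measurable_addV => //; apply: measurable_addV => //.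
    by apply: (@measurable_mulmxr _ _ _ (V * borel 'M[R]_(k, m))%type k (fun=> x) snd).
  have g0 (q : V * borel 'M[R]_(k, m)) : (0 <= (\1_(mx_cube 0 r) q.2)%:E *
      (`|F (x, q.1 + (u + x *m q.2))| `^ p)%R%:E :> \bar R)%E.
    by rewrite mule_ge0// lee_fin// powR_ge0.
  (* The constraint on row 0 of h is dropped: integrating w over all of R^m gives the full p-th
     power, while the other k rows contribute their volume r^(k m), so that r^-N becomes r^-m. *)
  apply: (@le_trans _ _ (((r ^+ N)^-1)%:E * \int[leb]_w \int[lebesgue_mx R m k]_z
      ((\1_(mx_cube 0 r) z)%:E * (`|F (x, w + (u + x *m z))| `^ p)%R%:E))%E).
    apply: lee_wpmul2l; first by rewrite lee_fin invr_ge0 exprn_ge0// ltW.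
    apply: ge0_le_integralT.
    - by move=> w; apply: integral_ge0.
    - apply: (@measurable_fun_fubini_tonelli_F _ _ _ _ _ (lebesgue_mx R m k) _ mfc).
      by move=> q; exact: f0.
    - exact: (@measurable_fun_fubini_tonelli_F _ _ _ _ _ (lebesgue_mx R m k) _ mg g0).
    move=> w; apply: ge0_le_integralT => //.
    - by apply: (@measurableT_comp _ _ _ _ _ _ _ _ (pair w) mfc).
    - by apply: (@measurableT_comp _ _ _ _ _ _ _ _ (pair w) mg).
    move=> z; rewrite kplane_point_cons addrCA; apply: lee_pmul => //; rewrite ?lee_fin ?powR_ge0//.
    rewrite indic_mx_cubeS (_ : (mx_uncons 0).2 = 0); last by apply/matrixP => i j; rewrite !mxE.
    by rewrite -[leRHS]mul1r ler_wpM2r// indicE lern1 leq_b1.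
  rewrite (@fubini_tonelli _ _ _ _ _ leb (lebesgue_mx R m k) _ mg g0) /fubini_G /=.
  have step z : (\int[leb]_w ((\1_(mx_cube 0 r) z)%:E * (`|F (x, w + (u + x *m z))| `^ p)%R%:E) =
      (\1_(mx_cube (0 : 'M[R]_(k, m)) r) z)%:E * fibre_power x)%E.
    rewrite -(fibre_power_translate x (u + x *m z)) ge0_integralZl ?lee_fin//.
    apply: mpow; exact: (measurableT_comp (fibre_data_fst x FD) (measurable_translate _)).
  under eq_integral do rewrite step.
  rewrite ge0_integralZr//; [|exact/measurable_EFinP/measurable_indic|exact: fibre_power_ge0].
  rewrite (integral_indic _ measurableT mC) setIT [X in (_ * (X * _))%E](lebesgue_mx_cube _ (ltW r0)).
  rewrite -(fineK (fibre_power_fin x)) -!EFinM lee_fin mulSn exprD invfM mulrA mulfVK//.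
  by rewrite gt_eqF// exprn_gt0.
have intB : (\int[leb]_u B u = fibre_power x)%E.
  rewrite /B (@fubini_tonelli _ _ _ _ _ leb P _ mj j0) /fubini_G /=.
  under eq_integral do rewrite fibre_power_translate.
  by rewrite integral_cst// [X in (_ * X)%E]probability_setT mule1.
have mA : measurable_fun setT (fun u : V => fibre_avg P F (x, u)).
  have mFA := measurable_Rintegral2 P (measurable_fibre_shift mF).
  by apply: (@measurableT_comp _ _ _ _ _ _ (fibre_avg P F : X * V -> R) _ (pair x)).
have np0 : 0 <= fine (fibre_power x) by apply: fine_ge0; exact: fibre_power_ge0.
have b0 : 0 <= b by rewrite mulr_ge0// invr_ge0 ltW.
have pE : p * (2 / p - 1) + p = 2 by field; rewrite gt_eqF.
have pt u : ((fibre_avg P F (x, u) ^+ 2)%R%:E <= (b `^ (2 / p - 1))%:E * B u)%E.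
  apply: (@le_trans _ _ ((b `^ (2 / p - 1) * `|fibre_avg P F (x, u)| `^ p)%R%:E)); last first.
    by rewrite EFinM; apply: lee_wpmul2l; rewrite ?lee_fin ?powR_ge0.
  set a : R := `|fibre_avg P F (x, u)|.
  have a0 : 0 <= a by exact: normr_ge0.
  have ab : a `^ p <= b by rewrite -lee_fin; exact: le_trans (AB u) (Bb u).
  rewrite lee_fin -real_normK ?num_real// -/a -powR_mulrn// -pE powRD ?pE ?pnatr_eq0//.
  rewrite powRrM; apply: ler_wpM2r; first exact: powR_ge0.
  apply: ge0_ler_powR; rewrite ?nnegrE ?powR_ge0//.
  by rewrite subr_ge0 ler_pdivlMr// mul1r.
apply: (@le_trans _ _ (\int[leb]_u ((b `^ (2 / p - 1))%:E * B u))%E).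
  apply: ge0_le_integralT => //.
  - by move=> u; rewrite lee_fin sqr_ge0.
  - by apply/measurable_EFinP; exact: measurable_funX.
  - apply: emeasurable_funM => //.
    exact: (@measurable_fun_fubini_tonelli_F _ _ _ _ _ P _ mj j0).
rewrite ge0_integralZl ?lee_fin ?powR_ge0//; last 2 first.
- exact: (@measurable_fun_fubini_tonelli_F _ _ _ _ _ P _ mj j0).
- by move=> u _; apply: integral_ge0.
rewrite intB -(fineK (fibre_power_fin x)) poweR_EFin -!EFinM lee_fin.
set np := fine _ in b b0 np0 Bb pt *.
rewrite /b powRM ?invr_ge0 ?(ltW rm0)// -mulrA ler_wpM2l ?powR_ge0//.
have [->|np_neq0] := eqVneq np 0; first by rewrite mulr0 powR_ge0.
by rewrite -{2}(powRr1 np0) -powRD ?np_neq0 ?implybT// subrK.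
Qed.

Lemma fibre_sqnorm_avg :
  (fibre_sqnorm (fibre_avg P F) <=
   (((r ^+ m)^-1) `^ (2 / p - 1))%:E * \int[lebk]_x (fibre_power x `^ (2 / p)))%E.
Proof.
have mFA := measurable_Rintegral2 P (measurable_fibre_shift mF).
have mS : measurable_fun setT (fun x : X => sqnorm (fun u => fibre_avg P F (x, u))).
  apply: (@measurable_fun_fubini_tonelli_F _ _ _ _ _ leb (fun q : X * V => (fibre_avg P F q ^+ 2)%:E)).
    by apply/measurable_EFinP; exact: measurable_funX.
  by move=> q; rewrite lee_fin sqr_ge0.
have mN : measurable_fun setT (fun x : X => (fibre_power x `^ (2 / p))%E).
  apply: (@measurableT_comp _ _ _ X _ _ (fun e : \bar R => (e `^ (2 / p))%E) _ (fibre_power : X -> \bar R)).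
    exact: measurable_poweR.
  apply: (@measurable_fun_fubini_tonelli_F _ _ _ _ _ leb (fun q : X * V => (`|F q| `^ p)%:E)).
    exact: mpow.
  by move=> q; rewrite lee_fin powR_ge0.
rewrite -ge0_integralZl ?lee_fin ?powR_ge0//; last by move=> x _; exact: poweR_ge0.
apply: ge0_le_integralT => //.
- by move=> x; exact: sqnorm_ge0.
- exact: emeasurable_funM.
- by move=> x; exact: sqnorm_fibre_avg.
Qed.

End power.
End bernstein.

(** * Norm bounds in L^2 and their sums *)

Section L2_bounds.
Context d (T : measurableType d) (R : realType) (mu : {measure set T -> \bar R}).
Implicit Types (f g : T -> R) (a b : R).

(** Measurability travels with the bound because Minkowski's inequality needs both at each use. *)
Definition L2_le f a := measurable_fun setT f /\ ('N[mu]_2%:E[EFin \o f] <= a%:E)%E.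

Lemma L2_le_intro f a : measurable_fun setT f -> 0 <= a ->
  (\int[mu]_x ((f x ^+ 2)%R)%:E <= (a ^+ 2)%:E)%E -> L2_le f a.
Proof.
move=> mf a0 fa; split => //; rewrite Lnorm2E.
apply: (@le_trans _ _ (sqrte (a ^+ 2)%:E)).
  by rewrite lee_sqrt// lee_fin sqr_ge0.
by rewrite /= sqrtr_sqr ger0_norm.
Qed.

Lemma L2_leD f g a b : L2_le f a -> L2_le g b -> L2_le (fun x => f x + g x) (a + b).
Proof.
move=> [mf fa] [mg gb]; split; first exact: measurable_funD.
apply: (@le_trans _ _ ('N[mu]_2%:E[EFin \o f] + 'N[mu]_2%:E[EFin \o g])%E).
  by apply: (minkowski_EFin mu mf mg); rewrite ler1n.
by rewrite EFinD; exact: (leeD fa gb).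
Qed.

Lemma L2_leB f g a b : L2_le f a -> L2_le g b -> L2_le (fun x => f x - g x) (a + b).
Proof.
move=> fa [mg gb]; apply: L2_leD => //; split; first exact: measurableT_comp.
rewrite !Lnorm2E in gb *.
by under eq_integral do rewrite sqrrN.
Qed.

Lemma L2_le0 : L2_le (fun=> 0) 0.
Proof.
apply: L2_le_intro => //; under eq_integral do rewrite expr0n /=.
by rewrite integral0 expr0n.
Qed.

Lemma L2_le_sum n (f : nat -> T -> R) (a : nat -> R) : (forall i, (i < n)%N -> L2_le (f i) (a i)) ->
  L2_le (fun x => \sum_(i < n) f i x) (\sum_(i < n) a i).
Proof.
elim: n => [|n ih] fa.
  rewrite (_ : (fun=> _) = fun=> 0); last by apply/funext => x; rewrite big_ord0.
  by rewrite big_ord0; exact: L2_le0.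
rewrite (_ : (fun=> _) = fun x => \sum_(i < n) f i x + f n x); last first.
  by apply/funext => x; rewrite big_ord_recr.
rewrite big_ord_recr /=; apply: L2_leD; last exact: fa.
by apply: ih => i lin; apply: fa; exact: ltnW.
Qed.

Lemma L2_le_weaken f a b : L2_le f a -> a <= b -> L2_le f b.
Proof. by move=> [mf fa] ab; split => //; apply: (le_trans fa); rewrite lee_fin. Qed.

End L2_bounds.

(** * Energy estimates at one scale *)

Section scales.
Context (R : realType) (k m : nat).
Local Notation lebk := (lebesgue_rV R k).
Local Notation V := (borel 'rV[R]_m).
Local Notation X := (borel 'rV[R]_k).
Local Notation Y := (borel 'M[R]_(k.+1, m)).
Local Notation lamb := (lebesgue_mx R m k.+1).
Local Notation N := (k.+1 * m)%N.

Definition cube_uniform (P : probability Y R) (r : R) :=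
  forall f : Y -> \bar R, measurable_fun setT f -> (forall h, 0 <= f h)%E ->
    (\int[P]_h f h = ((r ^+ N)^-1)%:E * \int[lamb]_h ((\1_(mx_cube 0 r) h)%:E * f h))%E.

Lemma cube_uniform_concentrated P r : 0 < r -> cube_uniform P r -> concentrated P (mx_cube 0 r).
Proof.
move=> r0 PE f K mf f0 fK; rewrite PE//.
have mC := measurable_mx_cube (0 : 'M[R]_(k.+1, m)) r.
have mi : measurable_fun setT (fun h : Y => (\1_(mx_cube 0 r) h)%:E : \bar R).
  by apply/measurable_EFinP; exact: measurable_indic.
have K0 : (0 <= K%:E)%E.
  apply: (le_trans (f0 0)); apply: fK => i j.
  by rewrite /= in_itv /= !mxE lexx add0r ltW.
apply: (@le_trans _ _ (((r ^+ N)^-1)%:E * \int[lamb]_h (K%:E * (\1_(mx_cube 0 r) h)%:E))%E).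
  apply: lee_wpmul2l; first by rewrite lee_fin invr_ge0 exprn_ge0// ltW.
  apply: ge0_le_integralT.
  - by move=> h; rewrite mule_ge0// lee_fin.
  - exact: emeasurable_funM.
  - exact: emeasurable_funM.
  move=> h; rewrite muleC.
  have [hC|hC] := pselect (mx_cube (0 : 'M[R]_(k.+1, m)) r h).
    by rewrite indicE mem_set// !mule1; exact: fK.
  by rewrite indicE memNset// !mule0.
rewrite (ge0_integralZl _ measurableT mi (fun h _ => _) K0)//.
rewrite (integral_indic _ measurableT mC) setIT [X in (_ * (_ * X))%E](lebesgue_mx_cube _ (ltW r0)).
by rewrite -!EFinM lee_fin mulrCA mulVf ?mulr1// gt_eqF// exprn_gt0.
Qed.

Section one_scale.
Variables (F : 'rV[R]_k * 'rV[R]_m -> R) (M L p A : R).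
Hypotheses (FD : fibre_data F M L) (p1 : 1 <= p) (p2 : p <= 2) (A0 : 0 <= A).
Hypothesis FA : (\int[lebk]_x (fibre_power p F x `^ (2 / p)) <= A%:E)%E.
Variables (c : 'M[R]_(k, m)) (l : R) (P : probability Y R) (r : R).
Hypotheses (l0 : 0 < l) (r0 : 0 < r) (PE : cube_uniform P r).
Local Notation energy := (slab_energy c l).
Let g := ktransform F.
Let bern : R := ((r ^+ m)^-1) `^ (2 / p - 1) * A.

Let bern0 : 0 <= bern. Proof. by rewrite mulr_ge0// powR_ge0. Qed.

Lemma fibre_data_bounded_measurable (F' : 'rV[R]_k * 'rV[R]_m -> R) M' L' : fibre_data F' M' L' ->
  bounded_measurable (ktransform F' : 'M[R]_(k.+1, m) -> R).
Proof.
move=> FD'; split; first exact: measurable_ktransform FD'.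
by exists `|M'| => y; exact: ktransform_bounded FD'.
Qed.

Let bern_avg : (fibre_sqnorm (fibre_avg P F) <= bern%:E)%E.
Proof.
apply: (le_trans (fibre_sqnorm_avg r0 p1 p2 PE FD)).
by rewrite EFinM; apply: lee_wpmul2l; rewrite ?lee_fin ?powR_ge0.
Qed.

Lemma fibre_sqnorm_diffs (hs : seq 'M[R]_(k.+1, m)) (F' : 'rV[R]_k * 'rV[R]_m -> R) M' L' : fibre_data F' M' L' ->
  (fibre_sqnorm (fibre_diffs hs F') <= (4 ^+ size hs)%:E * fibre_sqnorm F')%E.
Proof.
move=> FD'; have [M'' [L'' FD'']] := fibre_data_diffs hs FD'.
rewrite /fibre_sqnorm -ge0_integralZl ?lee_fin//; last 2 first.
- exact: (measurable_sqnorm_fibre FD').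
- by move=> x _; exact: sqnorm_ge0.
apply: ge0_le_integralT.
- by move=> x; exact: sqnorm_ge0.
- exact: (measurable_sqnorm_fibre FD'').
- by apply: emeasurable_funM => //; exact: (measurable_sqnorm_fibre FD').
move=> x; rewrite (_ : (fun u => _) = diffs [seq kplane_point h x | h <- hs] (fun v => F' (x, v))).
  by rewrite -(size_map (fun h => kplane_point h x : 'rV[R]_m)); apply: sqnorm_diffs_le; exact: fibre_data_fst FD'.
by apply/funext => u; exact: fibre_diffsE.
Qed.

(** The estimate for the starting scale: each of the i differences costs 4, and the inner average
    brings the Bernstein factor. *)
Lemma energy_iter_bias_avg i : (energy (iter i (bias P) (avg P g)) <= (4 ^+ i * l ^+ (k * m) * bern)%:E)%E.
Proof.
have PB := cube_uniform_concentrated r0 PE.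
have FDa := fibre_data_avg (ltW r0) PB FD.
rewrite (avg_ktransform P FD).
apply: (energy_iter_bias PB); first exact: fibre_data_bounded_measurable FDa.
move=> hs hsi _; have [M' [L' FD']] := fibre_data_diffs hs FDa.
rewrite (_ : mx_diffs hs _ = ktransform (fibre_diffs hs (fibre_avg P F))); last first.
  by apply/funext => y; rewrite (ktransform_diffs _ _ FDa).
apply: (le_trans (slab_energy_trivial c (ltW l0) FD')).
rewrite (mulrC (4 ^+ i)) -mulrA EFinM; apply: lee_wpmul2l; first by rewrite lee_fin exprn_ge0// ltW.
apply: (le_trans (fibre_sqnorm_diffs hs FDa)).
by rewrite hsi EFinM; apply: lee_wpmul2l; rewrite // lee_fin exprn_ge0.
Qed.

(** The i biases at the scale of P only cost 4^i; the k biases at the scale of Q supply the decay of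
    [slab_energy_diffs_le], with b = 2 because their steps are sums of two points of [0, r']^N. The
    two scales are independent, as both terms of [smoothB] require. *)
Lemma energy_iter_bias2_avg (Q : probability Y R) (r' : R) i j : 0 < r' -> r' <= 2^-1 ^+ j ->
  cube_uniform Q r' ->
  (energy (iter i (bias P) (iter k (bias Q) (avg P g))) <=
   (4 ^+ i * (2 * row_const m (k.+1%:R * 2) l * (4 * j.+1%:R * 2^-1 ^+ j)) ^+ k * bern)%:E)%E.
Proof.
move=> r'0 r'j QE.
have PB := cube_uniform_concentrated r0 PE.
have QB := cube_uniform_concentrated r'0 QE.
have FDa := fibre_data_avg (ltW r0) PB FD.
rewrite (avg_ktransform P FD).
have gB := fibre_data_bounded_measurable FDa.
apply: (energy_iter_bias PB); first exact: bounded_measurable_iter_bias.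
move=> hs hsi _; rewrite mx_diffs_iter_bias//.
apply: (energy_iter_bias QB); first exact: bounded_measurable_mx_diffs.
move=> hs' hs'k hs'B.
have [M1 [L1 FD1]] := fibre_data_diffs hs FDa.
rewrite (_ : mx_diffs hs _ = ktransform (fibre_diffs hs (fibre_avg P F))); last first.
  by apply/funext => y; rewrite (ktransform_diffs _ _ FDa).
rewrite (_ : mx_diffs hs' _ = ktransform (fibre_diffs hs' (fibre_diffs hs (fibre_avg P F)))); last first.
  by apply/funext => y; rewrite (ktransform_diffs _ _ FD1).
have hb h i1 i2 : h \in hs' -> `|h i1 i2| <= 2 * 2^-1 ^+ j.
  move=> /hs'B[a [b [aB bB ->]]].
  have cb (a' : 'M[R]_(k.+1, m)) : mx_cube 0 r' a' -> `|a' i1 i2| <= r'.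
    move=> a'B; have := a'B i1 i2; rewrite /= in_itv /= mxE add0r => /andP[h1 h2].
    by rewrite ger0_norm.
  rewrite mxE; apply: (le_trans (ler_normD _ _)).
  by have := cb _ aB; have := cb _ bB; lra.
apply: (le_trans (slab_energy_diffs_le FD1 c l0 _ hs'k hb)) => //.
set K : R := (2 * row_const m (k.+1%:R * 2) l * (4 * j.+1%:R * 2^-1 ^+ j)) ^+ k.
have K0 : 0 <= K.
  apply: exprn_ge0; apply: mulr_ge0; first by rewrite mulr_ge0// row_const_ge0// mulr_ge0.
  by rewrite mulr_ge0// ?exprn_ge0// mulr_ge0.
rewrite (mulrC (4 ^+ i)) -mulrA EFinM; apply: lee_wpmul2l; first by rewrite lee_fin.
apply: (le_trans (fibre_sqnorm_diffs hs FDa)).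
by rewrite hsi EFinM; apply: lee_wpmul2l; rewrite // lee_fin exprn_ge0.
Qed.

End one_scale.
End scales.

(** * Geometric sums and powers of the scale *)

Section geometric.
Context (R : realType).
Implicit Types t : R.

Lemma geometric_sum_le t n : 0 <= t -> t < 1 -> \sum_(i < n) t ^+ i <= (1 - t)^-1.
Proof.
move=> t0 t1; have t1' : 0 < 1 - t by rewrite subr_gt0.
rewrite -[leRHS]mul1r ler_pdivlMr// mulrC -opprB mulNr -subrX1 opprB.
by rewrite gerBl exprn_ge0.
Qed.

(** The left side is j+1 copies of the smallest of the powers t^0, ..., t^j, hence at most their
    sum. *)
Lemma natr_mul_expr_le t j : 0 <= t -> t < 1 -> j.+1%:R * t ^+ j <= (1 - t)^-1.
Proof.
move=> t0 t1; apply: le_trans (geometric_sum_le j.+1 t0 t1).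
rewrite mulr_natl -[in leLHS](card_ord j.+1) -sumr_const; apply: ler_sum => i _.
by apply: ler_wiXn2l => //; [exact: ltW|rewrite -ltnS].
Qed.

(** The general term is ((j+1) t^j)^k t^j: k of the k+1 factors t^j absorb the polynomial by
    [natr_mul_expr_le], and the last one is summed. *)
Lemma polynomial_geometric_sum_le t k n : 0 <= t -> t < 1 ->
  \sum_(j < n) j.+1%:R ^+ k * (t ^+ k.+1) ^+ j <= ((1 - t)^-1) ^+ k.+1.
Proof.
move=> t0 t1; have t1' : 0 <= (1 - t)^-1 by rewrite invr_ge0 subr_ge0 ltW.
apply: (@le_trans _ _ (\sum_(j < n) ((1 - t)^-1) ^+ k * t ^+ j)).
  apply: ler_sum => j _; rewrite -exprM mulnC exprM exprSr mulrA -exprMn.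
  apply: ler_wpM2r; first exact: exprn_ge0.
  by apply: lerXn2r; rewrite ?nnegrE ?mulr_ge0// ?exprn_ge0//; exact: natr_mul_expr_le.
rewrite -mulr_sumr exprSr; apply: ler_wpM2l; first exact: exprn_ge0.
exact: geometric_sum_le.
Qed.

(* The powers of r cancel up to r^eps. *)
Lemma scale_constant_le (N m k j : nat) (r c2 alpha eps e C A : R) :
  0 <= c2 -> 0 <= C -> 0 <= A -> 0 < eps -> alpha <= N%:R ->
  m%:R * e = alpha - N%:R + k%:R - eps ->
  0 < r -> r <= 2^-1 ^+ j -> 2^-1 ^+ j <= 2 * r ->
  (r ^+ N)^-1 * (c2 * (N.+1%:R * r) `^ alpha) *
    ((C * (j.+1%:R * 2^-1 ^+ j)) ^+ k * (((r ^+ m)^-1) `^ e * A)) <=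
  c2 * N.+1%:R ^+ N * (2 * C) ^+ k * A * (j.+1%:R ^+ k * (2^-1 `^ eps) ^+ j).
Proof.
move=> c20 C0 A0 eps0 aN me r0 rj jr; set rho := 2^-1 ^+ j in rj jr *.
have rho0 : 0 < rho by rewrite exprn_gt0// invr_gt0.
have r1 := ltW r0.
have rr x y : r `^ (x + y) = r `^ x * r `^ y by rewrite powRD// (gt_eqF r0) implybT.
have e1 : (r ^+ N)^-1 = r `^ (- N%:R) by rewrite -powR_mulrn// -powR_inv1 ?powR_ge0// -powRrM mulrN1.
have e2 : ((r ^+ m)^-1) `^ e = r `^ (- (m%:R * e)).
  by rewrite -powR_mulrn// -powR_inv1 ?powR_ge0// -!powRrM; congr (_ `^ _); ring.
have e3 : r ^+ k = r `^ k%:R by rewrite powR_mulrn.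
(* Normalisation of the average, ball condition, smoothing and Bernstein: -N + alpha + k - m e =
   eps. *)
have e4 : r `^ (- N%:R) * r `^ alpha * r `^ k%:R * r `^ (- (m%:R * e)) = r `^ eps.
  by rewrite -!rr me; congr (_ `^ _); lra.
have e5 : (2^-1 `^ eps) ^+ j = rho `^ eps.
  by rewrite -powR_mulrn ?powR_ge0// -powRrM mulrC powRrM powR_mulrn.
(* The bound [alpha <= N] removes [alpha] from the constant. *)
have h1 : N.+1%:R `^ alpha <= N.+1%:R ^+ N :> R.
  by rewrite -powR_mulrn//; apply: ler_powR => //; rewrite ler1n.
have h2 : (C * (j.+1%:R * rho)) ^+ k <= (2 * C) ^+ k * j.+1%:R ^+ k * r ^+ k.
  have rho1 := ltW rho0.
  rewrite -!exprMn; apply: lerXn2r; rewrite ?nnegrE ?mulr_ge0//.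
  have : 0 <= C * j.+1%:R by exact: mulr_ge0.
  by move=> /ler_wpM2l/(_ _ _ jr); rewrite (_ : _ * (2 * r) = 2 * C * j.+1%:R * r) ?mulrA//; ring.
have h3 : r `^ eps <= rho `^ eps.
  by apply: ge0_ler_powR; rewrite ?nnegrE// ltW.
rewrite e5 e2 e1 powRM//.
apply: (@le_trans _ _ (r `^ (- N%:R) * (c2 * (N.+1%:R ^+ N * r `^ alpha)) *
   ((2 * C) ^+ k * j.+1%:R ^+ k * r ^+ k * (r `^ (- (m%:R * e)) * A)))).
  have q1 : 0 <= r `^ (- N%:R) by exact: powR_ge0.
  have q2 : 0 <= r `^ alpha by exact: powR_ge0.
  have q3 : 0 <= r `^ (- (m%:R * e)) by exact: powR_ge0.
  have q4 : 0 <= N.+1%:R `^ alpha by exact: powR_ge0.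
  have rho1 := ltW rho0.
  apply: ler_pM; rewrite ?mulr_ge0// ?exprn_ge0// ?mulr_ge0//.
    by apply: ler_wpM2l => //; apply: ler_wpM2l => //; exact: ler_wpM2r.
  by apply: ler_wpM2r => //; exact: mulr_ge0.
rewrite [leLHS](_ : _ = c2 * N.+1%:R ^+ N * (2 * C) ^+ k * A * j.+1%:R ^+ k *
    (r `^ (- N%:R) * r `^ alpha * r `^ k%:R * r `^ (- (m%:R * e)))); last by rewrite e3; ring.
rewrite e4 [leRHS]mulrA; apply: ler_wpM2l => //.
by rewrite !mulr_ge0// exprn_ge0// mulr_ge0.
Qed.

End geometric.

(** * Summation over the scales *)

Section summation.
Context (R : realType) (k m : nat).
Local Notation lebk := (lebesgue_rV R k).
Local Notation Y := (borel 'M[R]_(k.+1, m)).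
Local Notation N := (k.+1 * m)%N.

Lemma mx_cube_le n p (r r' : R) (h : 'M[R]_(n, p)) : r <= r' -> mx_cube 0 r h -> mx_cube 0 r' h.
Proof.
move=> rr' hr i j; have := hr i j; rewrite /= !in_itv /= mxE !add0r => /andP[-> hr'] /=.
exact: le_trans rr'.
Qed.

Variables (mu : {finite_measure set Y -> \bar R}) (c2 alpha : R).
Hypothesis frost : forall (y : 'M[R]_(k.+1, m)) (r : R), 0 < r ->
  (mu (eball y r) <= (c2 * r `^ alpha)%:E)%E.
Hypotheses (c20 : 0 <= c2) (alphaN : alpha <= N%:R).
Variables (S0 : set Y) (c : 'M[R]_(k, m)) (l : R).
Hypotheses (mS0 : measurable S0) (S00 : mu (~` S0) = 0%E) (l0 : 0 < l).
Hypothesis S0slab : forall y h, S0 y -> mx_cube 0 1 h -> slab c l (y + h).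
Variables (F : 'rV[R]_k * 'rV[R]_m -> R) (M L p A eps : R).
Hypotheses (FD : fibre_data F M L) (p1 : 1 <= p) (p2 : p <= 2) (A0 : 0 <= A).
Hypothesis FA : (\int[lebk]_x (fibre_power p F x `^ (2 / p)) <= A%:E)%E.
Hypotheses (eps0 : 0 < eps) (pe : m%:R * (2 / p - 1) = alpha - N%:R + k%:R - eps).
Variable P : nat -> probability Y R.
Hypothesis PE : forall j, cube_uniform (P j) (2^-1 ^+ j).
Let g := ktransform F.

Let scale0 j : 0 < 2^-1 ^+ j :> R. Proof. by rewrite exprn_gt0// invr_gt0. Qed.

Let scale1 j : 2^-1 ^+ j <= 1 :> R.
Proof. by rewrite exprn_ile1// ?invr_ge0// invf_le1// ler1n. Qed.

Let gB : bounded_measurable (g : 'M[R]_(k.+1, m) -> R).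
Proof. exact: fibre_data_bounded_measurable FD. Qed.

Lemma L2_le_avg j H (K a : R) : bounded_measurable H -> (slab_energy c l H <= K%:E)%E -> 0 <= a ->
  ((2^-1 ^+ j) ^+ N)^-1 * (c2 * (N.+1%:R * 2^-1 ^+ j) `^ alpha) * K <= a ^+ 2 ->
  L2_le mu (avg (P j) H : Y -> R) a.
Proof.
move=> HB HK a0 Ka; have [mA _] := bounded_measurable_avg (P j) HB.
apply: L2_le_intro => //.
have Sslab y h : S0 y -> mx_cube 0 (2^-1 ^+ j) h -> slab c l (y + h).
  by move=> Sy hj; apply: S0slab => //; exact: mx_cube_le hj.
apply: (le_trans (frostman_average frost (scale0 j) (PE j) mS0 S00 Sslab HB)).
apply: (@le_trans _ _ ((((2^-1 ^+ j) ^+ N)^-1 * (c2 * (N.+1%:R * 2^-1 ^+ j) `^ alpha))%:E * K%:E)%E).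
  apply: lee_wpmul2l => //; rewrite lee_fin.
  by rewrite mulr_ge0// ?invr_ge0 ?exprn_ge0 ?(ltW (scale0 j))// mulr_ge0// powR_ge0.
by rewrite -EFinM lee_fin.
Qed.

Definition start_const : R := c2 * N.+1%:R ^+ N * 4 ^+ k * l ^+ (k * m).

(** The 4^k pays for the differences at the averaging scale, 8 = 2 * 4 collects the constants of
    [slab_energy_diffs_le], and the 2 before it compares 2^-j with the actual scale, which may be
    2^-(j+1). *)
Definition increment_const : R :=
  c2 * N.+1%:R ^+ N * 4 ^+ k * (2 * (8 * row_const m (k.+1%:R * 2) l)) ^+ k.

(** Its power of order 2 (k+1) is 2^-eps: the 2 accounts for the square root in the norm, the k+1
    for [polynomial_geometric_sum_le]. *)
Definition scale_ratio : R := 2^-1 `^ (eps / (2 * k.+1%:R)).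

Lemma scale_ratio_ge0 : 0 <= scale_ratio. Proof. exact: powR_ge0. Qed.

Lemma scale_ratio_lt1 : scale_ratio < 1.
Proof.
have -> : 1 = 1 `^ (eps / (2 * k.+1%:R)) :> R by rewrite powR1.
by apply: gt0_ltr_powR; rewrite ?nnegrE// ?invf_lt1// ?ltr1n// divr_gt0// mulr_gt0.
Qed.

Let scale_ratioE : 2^-1 `^ eps = (scale_ratio ^+ k.+1) ^+ 2.
Proof.
rewrite -exprM -[RHS]powR_mulrn ?scale_ratio_ge0// /scale_ratio -powRrM natrM (mulrC k.+1%:R) divfK//.
Qed.

Let four_le i : (i < k)%N -> 4 ^+ i <= 4 ^+ k :> R.
Proof. by move=> /ltnW; apply: ler_weXn2l; rewrite ler1n. Qed.

(** One average stays outermost for [frostman_average]; the other is moved next to the transform,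
    where [avg_ktransform] hands it over to the fibres. *)
Lemma avg_avg_iter_bias j i f : bounded_measurable f ->
  avg (P j) (avg (P j) (iter i (bias (P j)) f)) = avg (P j) (iter i (bias (P j)) (avg (P j) f)).
Proof.
move=> fB; congr avg; apply: (iter_bias_comm (op := avg (P j))) => //.
  by move=> f'; exact: bounded_measurable_avg.
by move=> f' f'B; exact: avg_bias.
Qed.

Lemma L2_le_start i : (i < k)%N ->
  L2_le mu (avg (P 0) (avg (P 0) (iter i (bias (P 0)) g)) : Y -> R) (Num.sqrt (start_const * A)).
Proof.
move=> ik; rewrite avg_avg_iter_bias//.
have gAB := bounded_measurable_avg (P 0) gB.
apply: (L2_le_avg _ (energy_iter_bias_avg FD p1 p2 FA c l0 (scale0 0) (PE 0) i)).
- exact: bounded_measurable_iter_bias.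
- exact: sqrtr_ge0.
rewrite sqr_sqrtr; last first.
  by rewrite !mulr_ge0// exprn_ge0// (ltW l0).
rewrite expr0 !expr1n invr1 powR1 !mul1r mulr1 /start_const.
have N1 : N.+1%:R `^ alpha <= N.+1%:R ^+ N :> R.
  by rewrite -powR_mulrn//; apply: ler_powR => //; rewrite ler1n.
rewrite mulrA -(mulrA (c2 * _)) -(mulrA (c2 * _)) mulrA ler_wpM2r// -!mulrA ler_wpM2l//.
apply: ler_pM => //; rewrite ?powR_ge0// ?mulr_ge0// ?exprn_ge0// ?(ltW l0)//.
by rewrite ler_wpM2r ?exprn_ge0 ?(ltW l0)//; exact: four_le.
Qed.

(** Here the three estimates meet: [frostman_average] is applied to the energy bound of
    [energy_iter_bias2_avg], which contains the smoothing and the Bernstein factor, and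
    [scale_constant_le] evaluates the product. Letting a and b each be j or j+1 covers both terms of
    [smoothB]. *)
Lemma L2_le_increment j a b i : (i < k)%N -> (a == j) || (a == j.+1) -> (b == j) || (b == j.+1) ->
  L2_le mu (avg (P a) (avg (P a) (iter i (bias (P a)) (iter k (bias (P b)) g))) : Y -> R)
    (Num.sqrt (increment_const * A) * (j.+1%:R ^+ k * (scale_ratio ^+ k.+1) ^+ j)).
Proof.
move=> ik aj bj.
have scl a' : (a' == j) || (a' == j.+1) -> 2^-1 ^+ a' <= 2^-1 ^+ j :> R /\ 2^-1 ^+ j <= 2 * 2^-1 ^+ a' :> R.
  case/orP=> /eqP ->; first by split => //; rewrite ler_peMl// ?(ltW (scale0 j))// ler1n.
  rewrite exprS mulrA mulfV// mul1r lexx; split => //.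
  by rewrite ler_piMl// ?(ltW (scale0 j))// invf_le1// ler1n.
have [aj1 aj2] := scl _ aj; have [bj1 _] := scl _ bj.
have gbB := bounded_measurable_iter_bias (P b) k gB.
rewrite avg_avg_iter_bias// (@iter_bias_comm _ _ _ (P b) (avg (P a)) k)//; last 2 first.
- by move=> f; exact: bounded_measurable_avg.
- by move=> f fB; exact: avg_bias.
have gAB := bounded_measurable_avg (P a) gB.
apply: (L2_le_avg _ (energy_iter_bias2_avg FD p1 p2 FA c l0 (scale0 a) (PE a) i (scale0 b) bj1 (PE b))).
- by do 2 apply: bounded_measurable_iter_bias.
- by rewrite mulr_ge0 ?sqrtr_ge0// mulr_ge0// !exprn_ge0// scale_ratio_ge0.
set rc := row_const _ _ _.
have rc0 : 0 <= rc by rewrite row_const_ge0// mulr_ge0.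
have rc8 : 0 <= 8 * rc by rewrite mulr_ge0.
have := scale_constant_le c20 rc8 A0 eps0 alphaN pe (scale0 a) aj1 aj2.
set X := _ * _ `^ alpha.
rewrite (_ : 8 * rc * (j.+1%:R * 2^-1 ^+ j) = 2 * rc * (4 * j.+1%:R * 2^-1 ^+ j)); last by ring.
set D := (2 * rc * _) ^+ k; set B := _ `^ _ * A => h.
rewrite (_ : _ * X * (4 ^+ i * D * B) = 4 ^+ i * (((2^-1 ^+ a) ^+ N)^-1 * X * (D * B))); last by ring.
have D0 : 0 <= c2 * N.+1%:R ^+ N * (2 * (8 * rc)) ^+ k * A.
  by rewrite !mulr_ge0// !exprn_ge0// mulr_ge0.
have t0 := scale_ratio_ge0.
have j0 : 0 <= j.+1%:R ^+ k * ((scale_ratio ^+ k.+1) ^+ 2) ^+ j.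
  by rewrite mulr_ge0// !exprn_ge0.
rewrite exprMn sqr_sqrtr; last first.
  by rewrite /increment_const -/rc !mulr_ge0// !exprn_ge0// mulr_ge0.
rewrite scale_ratioE in h.
apply: (@le_trans _ _ (4 ^+ k * (c2 * N.+1%:R ^+ N * (2 * (8 * rc)) ^+ k * A *
   (j.+1%:R ^+ k * ((scale_ratio ^+ k.+1) ^+ 2) ^+ j)))).
  apply: (@le_trans _ _ (4 ^+ i * (c2 * N.+1%:R ^+ N * (2 * (8 * rc)) ^+ k * A *
   (j.+1%:R ^+ k * ((scale_ratio ^+ k.+1) ^+ 2) ^+ j)))).
    by apply: ler_wpM2l; rewrite ?exprn_ge0.
  by apply: ler_wpM2r; [exact: mulr_ge0|exact: four_le].
rewrite /increment_const -/rc.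
rewrite [leLHS](_ : _ = (c2 * N.+1%:R ^+ N * (2 * (8 * rc)) ^+ k * A * 4 ^+ k) *
  (j.+1%:R ^+ k * ((scale_ratio ^+ k.+1) ^+ 2) ^+ j)); last by ring.
(* The square of the claimed bound contains (j+1)^(2k) where (j+1)^k would do; the surplus factor
   avoids a square root. *)
rewrite [leRHS](_ : _ = (c2 * N.+1%:R ^+ N * (2 * (8 * rc)) ^+ k * A * 4 ^+ k) *
  (j.+1%:R ^+ k * (j.+1%:R ^+ k * ((scale_ratio ^+ k.+1) ^+ 2) ^+ j))); last first.
  by rewrite [X in _ = _ * (_ * (_ * X))]exprAC; ring.
apply: ler_wpM2l; first by rewrite mulr_ge0// exprn_ge0.
by apply: ler_peMl => //; rewrite exprn_ege1// ler1n.
Qed.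

Definition increment_bound j : R :=
  2 * k%:R * Num.sqrt (increment_const * A) * (j.+1%:R ^+ k * (scale_ratio ^+ k.+1) ^+ j).

Lemma L2_le_smooth J : L2_le mu (smooth (P J) k g : Y -> R)
  (k%:R * Num.sqrt (start_const * A) + \sum_(j < J) increment_bound j).
Proof.
elim: J => [|J ih].
  rewrite big_ord0 addr0 mulr_natl -[in X in L2_le _ _ X](card_ord k) -sumr_const.
  rewrite (_ : smooth _ _ _ = fun y => \sum_(i < k) avg (P 0) (avg (P 0) (iter i (bias (P 0)) g)) y); last first.
    by apply/funext => y; exact: smoothE.
  apply: (@L2_le_sum _ _ _ mu k (fun i => avg (P 0) (avg (P 0) (iter i (bias (P 0)) g)) : Y -> R)
    (fun=> Num.sqrt (start_const * A))).
  exact: L2_le_start.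
rewrite big_ord_recr /= addrA.
(* Telescoping: by [smoothB] the increment is a difference of two terms, each a sum of k pieces
   controlled by [L2_le_increment]. *)
rewrite (_ : smooth (P J.+1) k g = fun y => smooth (P J) k g y +
  (smooth (P J.+1) k (iter k (bias (P J)) g) y - smooth (P J) k (iter k (bias (P J.+1)) g) y)); last first.
  by apply/funext => y; rewrite -smoothB//; lra.
apply: L2_leD => //.
set e := Num.sqrt (increment_const * A) * (J.+1%:R ^+ k * (scale_ratio ^+ k.+1) ^+ J).
have half a b : (a == J) || (a == J.+1) -> (b == J) || (b == J.+1) ->
    L2_le mu (smooth (P a) k (iter k (bias (P b)) g) : Y -> R) (k%:R * e).
  move=> aJ bJ; rewrite mulr_natl -[in X in L2_le _ _ X](card_ord k) -sumr_const.
  rewrite (_ : smooth _ _ _ = fun y =>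
      \sum_(i < k) avg (P a) (avg (P a) (iter i (bias (P a)) (iter k (bias (P b)) g))) y); last first.
    by apply/funext => y; exact: smoothE.
  apply: (@L2_le_sum _ _ _ mu k (fun i =>
    avg (P a) (avg (P a) (iter i (bias (P a)) (iter k (bias (P b)) g))) : Y -> R) (fun=> e)).
  by move=> i ik; exact: L2_le_increment.
rewrite (_ : increment_bound J = k%:R * e + k%:R * e); last by rewrite /increment_bound /e; ring.
by apply: L2_leB; apply: half; rewrite eqxx ?orbT.
Qed.

End summation.

(** * The remainder at fine scales *)

Section remainder.
Context (R : realType) (k m : nat).
Local Notation Y := (borel 'M[R]_(k.+1, m)).

Definition mx_uniformly_continuous (g : 'M[R]_(k.+1, m) -> R) :=
  forall e : R, 0 < e -> exists2 d : R, 0 < d &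
    forall y h : 'M[R]_(k.+1, m), (forall i j, `|h i j| <= d) -> `|g (y + h) - g y| <= e.

Lemma bias_le (P : probability Y R) g (B : R) : bounded_measurable g ->
  (forall y, `|g y| <= B) -> forall y, `|bias P g y| <= 2 * B.
Proof.
move=> gB gle y; have [mg _] := gB; have [ma _] := bounded_measurable_avg P gB.
have ale z : `|avg P g z| <= B.
  by apply: prob_Rintegral_le => [|h]; [exact: measurable_shift1|exact: gle].
have aale : `|avg P (avg P g) y| <= B.
  by apply: prob_Rintegral_le => [|h]; [exact: measurable_shift1|exact: ale].
by apply: (le_trans (ler_normB _ _)); have := gle y; lra.
Qed.

(** The first bias is small: A g - g and A A g - A g are both at most e in absolute value. Each
    further bias at most doubles the bound. *)
Lemma iter_bias_le (P : probability Y R) (r e : R) g i : concentrated P (mx_cube 0 r) ->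
  bounded_measurable g ->
  (forall y h, mx_cube 0 r h -> `|g (y + h) - g y| <= e) ->
  (0 < i)%N -> forall y, `|iter i (bias P) g y| <= 2 ^+ i * e.
Proof.
move=> PB gB ge; case: i => // i _; have [mg [M gM]] := gB.
have aB := bounded_measurable_avg P gB; have [ma [M' aM']] := aB.
have ag y : `|avg P g y - g y| <= e.
  have P1 : (P setT < +oo)%E by rewrite [X in (X < _)%E]probability_setT ltry.
  have mh := measurable_shift1 y mg.
  have i1 := prob_bounded_integrable P mh (fun h => gM _).
  have i2 := prob_bounded_integrable P (measurable_cst (g y)) (fun=> gM y).
  have e1 : avg P g y - g y = \int[P]_h (g (y + h) - g y).
    rewrite RintegralB// [X in _ = _ - X]/Rintegral integral_cst// [X in (_ * X)%E]probability_setT mule1.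
    by [].
  rewrite e1 -lee_fin.
  have md : measurable_fun setT (fun h : Y => g (y + h) - g y) by exact: measurable_funB.
  apply: (le_trans (abs_Rintegral_le P md)); apply: PB.
  - by apply/measurable_EFinP; exact: measurableT_comp.
  - by move=> h; rewrite lee_fin.
  - by move=> h hr; rewrite lee_fin; exact: ge.
have aag y : `|avg P (avg P g) y - avg P g y| <= e.
  have dB := bounded_measurableB aB gB.
  rewrite (_ : _ - _ = avg P (fun z => avg P g z - g z) y); last by rewrite avgB.
  exact: (prob_Rintegral_le P (measurable_shift1 y dB.1) (fun h => ag _)).
elim: i => [|i ih] y.
  rewrite /= /bias expr1 (_ : _ - _ = - (avg P (avg P g) y - avg P g y) - (avg P g y - g y)); last by ring.
  by apply: (le_trans (ler_normB _ _)); rewrite normrN; have := aag y; have := ag y; lra.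
rewrite iterS exprS -mulrA; apply: bias_le => //.
exact: (bounded_measurable_iter_bias P i.+1 gB).
Qed.

Lemma L2_le_bounded (mu : {finite_measure set Y -> \bar R}) g (e : R) : 0 <= e ->
  measurable_fun setT (g : Y -> R) -> (forall y, `|g y| <= e) ->
  L2_le mu (g : Y -> R) (e * Num.sqrt (fine (mu setT))).
Proof.
move=> e0 mg ge.
have mu1 : mu setT \is a fin_num by exact: fin_num_measure.
apply: L2_le_intro => //; first by rewrite mulr_ge0// sqrtr_ge0.
rewrite exprMn sqr_sqrtr ?fine_ge0// EFinM fineK// -integral_cst//.
apply: ge0_le_integralT.
- by move=> y; rewrite lee_fin sqr_ge0.
- by apply/measurable_EFinP; exact: measurable_funX.
- exact: measurable_cst.
by move=> y; rewrite lee_fin -real_normK ?num_real// lerXn2r ?nnegrE.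
Qed.

End remainder.

(** * The estimate for real data *)

Section ktransform_bound.
Context (R : realType) (k m : nat).
Local Notation lebk := (lebesgue_rV R k).
Local Notation Y := (borel 'M[R]_(k.+1, m)).
Local Notation N := (k.+1 * m)%N.
Variables (mu : {finite_measure set Y -> \bar R}) (c2 alpha : R).
Hypothesis frost : forall (y : 'M[R]_(k.+1, m)) (r : R), 0 < r ->
  (mu (eball y r) <= (c2 * r `^ alpha)%:E)%E.
Hypotheses (c20 : 0 <= c2) (alphaN : alpha <= N%:R).
Variables (S0 : set Y) (c : 'M[R]_(k, m)) (l : R).
Hypotheses (mS0 : measurable S0) (S00 : mu (~` S0) = 0%E) (l0 : 0 < l).
Hypothesis S0slab : forall y h, S0 y -> mx_cube 0 1 h -> slab c l (y + h).
Variables (F : 'rV[R]_k * 'rV[R]_m -> R) (M L p A eps : R).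
Hypotheses (FD : fibre_data F M L) (p1 : 1 <= p) (p2 : p <= 2) (A0 : 0 <= A).
Hypothesis FA : (\int[lebk]_x (fibre_power p F x `^ (2 / p)) <= A%:E)%E.
Hypotheses (eps0 : 0 < eps) (pe : m%:R * (2 / p - 1) = alpha - N%:R + k%:R - eps).
Hypotheses (k0 : (0 < k)%N) (gU : mx_uniformly_continuous (ktransform F : 'M[R]_(k.+1, m) -> R)).

Definition ktransform_const : R :=
  k%:R * Num.sqrt (start_const k m c2 l) +
  2 * k%:R * Num.sqrt (increment_const k m c2 l) * ((1 - scale_ratio k eps)^-1) ^+ k.+1.

(** T F is its smoothed version at scale 2^-J plus the k-fold bias of T F. The former is bounded in
    L^2(mu) uniformly in J; the latter tends to 0, since T F is uniformly continuous, k >= 1 and mu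
    is finite. Neither the bounds M and L nor the mass of mu enter the constant. *)
Lemma L2_le_ktransform : L2_le mu (ktransform F : Y -> R) (ktransform_const * Num.sqrt A).
Proof.
have scale0 j : 0 < 2^-1 ^+ j :> R by rewrite exprn_gt0// invr_gt0.
have /choice[P PE] : forall j, exists P : probability Y R, cube_uniform P (2^-1 ^+ j).
  by move=> j; exact: exists_cube_probability.
have gB := fibre_data_bounded_measurable FD.
split; first by case: gB.
apply/lee_addgt0Pr => e e0.
pose V := Num.sqrt (fine (mu setT)).
have V0 : 0 <= V by exact: sqrtr_ge0.
(* The remainder will be at most 2^k e' V; dividing by 1 + V instead of V also covers a null
   measure. *)
have [d d0 gd] := gU (divr_gt0 e0 (mulr_gt0 (exprn_gt0 k (ltr0n R 2)) (ltr_pwDl ltr01 V0))).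
set e' := e / _ in gd.
have [J _ /(_ J (leqnn J)) /= Jd] := near_infty_natSinv_expn_lt (PosNum d0).
have Jd' : 2^-1 ^+ J <= d by rewrite exprVn ltW// -div1r.
have PB := cube_uniform_concentrated (scale0 J) (PE J).
have small y : `|iter k (bias (P J)) (ktransform F) y| <= 2 ^+ k * e'.
  apply: (iter_bias_le PB gB) => // z h hJ; apply: gd => i j.
  have := hJ i j; rewrite /= in_itv /= mxE add0r => /andP[h1 h2].
  by rewrite ger0_norm// (le_trans h2).
have e'0 : 0 <= e' by rewrite divr_ge0 ?(ltW e0)// mulr_ge0// ?addr_ge0// exprn_ge0.
have [mb _] := bounded_measurable_iter_bias (P J) k gB.
have rem := L2_le_bounded mu (mulr_ge0 (exprn_ge0 k (ler0n R 2)) e'0) mb small.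
have main := L2_le_smooth frost c20 alphaN mS0 S00 l0 S0slab FD p1 p2 A0 FA eps0 pe PE J.
have [_] := L2_leD main rem.
rewrite (_ : (fun x => _) = ktransform F); last by apply/funext => y; rewrite /smooth subrK.
move=> /le_trans; apply; rewrite -EFinD lee_fin; apply: lerD; last first.
  rewrite -/V /e' mulrCA -mulrA invfM.
  rewrite (_ : e * _ = e * ((2 ^+ k * (2 ^+ k)^-1) * (V / (1 + V)))); last by ring.
  rewrite divff ?expf_neq0// mul1r ler_piMr ?(ltW e0)// ler_pdivrMr ?mul1r ?lerDr//.
  by rewrite ltr_pwDl.
rewrite /ktransform_const mulrDl; apply: lerD.
  have sc0 : 0 <= start_const k m c2 l by rewrite !mulr_ge0// exprn_ge0// (ltW l0).
  by rewrite sqrtrM// mulrA.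
rewrite /increment_bound -mulr_sumr.
have rc0 : 0 <= row_const m (k.+1%:R * 2) l by rewrite row_const_ge0// mulr_ge0.
have rc8 : 0 <= 8 * row_const m (k.+1%:R * 2) l by rewrite mulr_ge0.
have ic0 : 0 <= increment_const k m c2 l.
  by rewrite /increment_const; move: rc8; set rc := 8 * _ => rc8; rewrite !mulr_ge0// !exprn_ge0// mulr_ge0.
rewrite sqrtrM//.
rewrite (_ : 2 * k%:R * Num.sqrt (increment_const k m c2 l) * _ * Num.sqrt A =
  2 * k%:R * (Num.sqrt (increment_const k m c2 l) * Num.sqrt A) *
  ((1 - scale_ratio k eps)^-1) ^+ k.+1); last by ring.
apply: ler_wpM2l; first by rewrite !mulr_ge0// sqrtr_ge0.
apply: polynomial_geometric_sum_le; first exact: scale_ratio_ge0.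
exact: scale_ratio_lt1.
Qed.

End ktransform_bound.

(** * Uniform continuity under fibre translations *)

Section uniform_continuity.
Context (R : realType) (k m : nat).
Implicit Types f : 'rV[R]_k * 'rV[R]_m -> R.

(** Only the fibre variable moves, as it does when y varies at fixed x. Compactness of K makes
    continuity uniform at the points of K. *)
Lemma compact_support_uniform f (K : set ('rV[R]_k * 'rV[R]_m)) (e : R) :
  continuous f -> compact K -> (forall z, ~ K z -> f z = 0) -> 0 < e ->
  exists2 d : R, 0 < d & forall (x : 'rV[R]_k) (u v : 'rV[R]_m), (forall j, `|v ord0 j| <= d) ->
    `|f (x, u + v) - f (x, u)| <= e.
Proof.
move=> cf cK fK e0.
have nK : \forall v \near (0 : 'rV[R]_m), K `<=` [set z | `|f (z.1, z.2 + v) - f z| < e].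
  have := (compact_near_coveringP K).1 cK _ (nbhs (0 : 'rV[R]_m))
    (fun v z => `|f (z.1, z.2 + v) - f z| < e) (@nbhs_filter _ _).
  apply => -[x u] _.
  have c1 : (fun q : ('rV[R]_k * 'rV[R]_m) * 'rV[R]_m => f (q.1.1, q.1.2 + q.2) - f q.1)
      @ ((x, u), (0 : 'rV[R]_m)) --> (f (x, u + 0) - f (x, u)).
    have Fx := @nbhs_filter _ x; have Fu := @nbhs_filter _ u.
    have F0 := @nbhs_filter _ (0 : 'rV[R]_m); have Fxu := @nbhs_filter _ (x, u).
    have Fu0 := @nbhs_filter _ (u + 0).
    have Fp := filter_prod_filter Fxu F0.
    have h0 := @cvg_fst _ _ (nbhs (x, u)) (nbhs (0 : 'rV[R]_m)) F0.
    have h1 := cvg_comp _ _ h0 (@cvg_fst _ _ (nbhs x) (nbhs u) Fu).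
    have h2 := cvg_comp _ _ h0 (@cvg_snd _ _ (nbhs x) (nbhs u) Fx).
    have h3 := cvgD h2 (@cvg_snd _ _ (nbhs (x, u)) (nbhs (0 : 'rV[R]_m)) Fxu).
    have {}h3 := h3 Fp.
    have h4 := @cvg_pair _ _ _ _ (nbhs x) (nbhs (u + 0)) Fp Fx Fu0 _ _ h1 h3.
    exact: (cvgB (cvg_comp _ _ h4 (cf (x, u + 0))) (cvg_comp _ _ h0 (cf (x, u)))).
  rewrite addr0 subrr in c1.
  have /cvgr0Pnorm_lt/(_ e e0) := c1.
  by [].
have [d /= d0 dK] := (nbhs_ballP _ _).1 nK.
have small (v : 'rV[R]_m) : (forall j, `|v ord0 j| <= d / 2) -> ball (0 : 'rV[R]_m) d v.
  move=> vd; split => // i j; rewrite (ord1 i) mxE /ball /= sub0r normrN.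
  by apply: (le_lt_trans (vd j)); rewrite ltr_pdivrMr// ltr_pMr// ltr1n.
exists (d / 2); first by rewrite divr_gt0.
move=> x u v vd.
have [Kz|Kz] := pselect (K (x, u)); first by have /ltW := dK _ (small _ vd) _ Kz.
(* When only the translated point lies in K, the estimate is used there with -v; when neither does,
   both values vanish. *)
have [Kz'|Kz'] := pselect (K (x, u + v)); last by rewrite !fK// subrr normr0 ltW.
have vd' j : `|(- v) ord0 j| <= d / 2 by rewrite mxE normrN.
have /ltW := dK _ (small _ vd') _ Kz'.
by rewrite /= addrK distrC.
Qed.

End uniform_continuity.

(** * The support of a measure and its diameter *)

Section support.
Context (R : realType) (a b : nat).
Local Notation T := 'M[R]_(a, b).
Variable mu : {measure set (borel T) -> \bar R}.

Lemma not_measure_support y : ~ measure_support mu y ->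
  exists U : set T, [/\ open U, U y & mu U = 0%E].
Proof.
move=> /existsNP[U /not_implyP[oU /not_implyP[Uy U0]]]; exists U; split => //.
by apply/eqP; rewrite eq_le measure_ge0 andbT leNgt; exact/negP.
Qed.

Lemma closed_measure_support : closed (measure_support mu).
Proof.
rewrite -[measure_support mu]setCK; apply: open_closedC.
rewrite (_ : ~` _ = \bigcup_(U in [set U : set T | open U /\ mu U = 0%E]) U); last first.
  apply/seteqP; split => [y /not_measure_support[U [oU Uy U0]]|y [U [oU U0] Uy] yS]; first by exists U.
  by have := yS U oU Uy; rewrite U0 ltxx.
by apply: bigcup_open => U [].
Qed.

Lemma measurable_measure_support : measurable (measure_support mu : set (borel T)).
Proof.
rewrite -[measure_support mu]setCK; apply: measurableC; apply: sub_sigma_algebra.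
exact/closed_openC/closed_measure_support.
Qed.

(** Second countability: the complement is covered by null open sets, hence by the countably many
    rational cubes that are null. These are enumerated through [pickle] after flattening the
    matrices. *)
Lemma measure_supportC : mu (~` measure_support mu) = 0%E.
Proof.
pose V (i : 'rV[rat]_(a * b) * nat) : set T :=
  mxvec @^-1` (ball (map_mx ratr i.1 : 'rV[R]_(a * b)) (i.2.+1%:R^-1)).
have cvec : continuous (mxvec : T -> 'rV[R]_(a * b)).
  apply: mx_continuous => i j; rewrite (ord1 i).
  case/mxvec_indexP: j => i' j'; under eq_fun do rewrite mxvecE.
  exact: coord_continuous.
have cvecV : continuous (vec_mx : 'rV[R]_(a * b) -> T).
  apply: mx_continuous => i j; under eq_fun do rewrite mxE.
  exact: coord_continuous.
have oV i : open (V i) by move/continuousP: cvec; apply; exact: ball_open.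
pose W n : set (borel T) := if unpickle n is Some i then (if mu (V i) == 0%E then V i else set0) else set0.
have W0 n : mu.-negligible (W n).
  rewrite /W; case: unpickle => [i|]; last exact: negligible_set0.
  case: ifPn => [/eqP Vi0|_]; last exact: negligible_set0.
  by apply/negligibleP => //; apply: sub_sigma_algebra; exact: oV.
have [B [mB B0 WB]] := negligible_bigcup W0.
apply/eqP; rewrite eq_le measure_ge0 andbT -B0; apply: le_measure; rewrite ?inE//.
  by apply: measurableC; exact: measurable_measure_support.
move=> y /not_measure_support[U [oU Uy U0]]; apply: WB.
have oU' : open (vec_mx @^-1` U : set 'rV[R]_(a * b)) by move/continuousP: cvecV; exact.
have : (vec_mx @^-1` U) (mxvec y) by rewrite /= mxvecK.
rewrite (open_rVE oU') => -[i /= iU iy]; exists (pickle i) => //.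
rewrite /W pickleK (_ : mu (V i) = 0%E) ?eqxx//.
apply/eqP; rewrite eq_le measure_ge0 andbT -U0; apply: le_measure; rewrite ?inE//.
- by apply: sub_sigma_algebra; exact: oV.
- exact: sub_sigma_algebra.
by move=> z /iU; rewrite /= mxvecK.
Qed.

(** Compactness bounds the set of distances, without which its [sup] would carry no information. *)
Lemma ediam_ge y z : compact (measure_support mu) -> measure_support mu y -> measure_support mu z ->
  enorm (y - z) <= ediam (measure_support mu).
Proof.
move=> /compact_bounded[M [_ MS]] Sy Sz; apply: ub_le_sup; last by exists y, z.
have M0 : 0 < `|M| + 1 by rewrite ltr_pwDr.
exists ((a * b).+1%:R * (2 * (`|M| + 1))) => _ [y' [z' [Sy' Sz' ->]]].
have le w i j : measure_support mu w -> `|w i j| <= `|M| + 1.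
  move=> Sw; apply: le_trans (MS (`|M| + 1) _ w Sw); last by rewrite ltr_pwDr// ler_norm.
  rewrite [leRHS](_ : _ = mx_norm w)// mx_normrE.
  by apply/bigmax_geP; right => /=; exists (i, j).
apply/ltW/enorm_lt; first by rewrite mulr_gt0.
move=> i j; rewrite !mxE; apply: (le_trans (ler_normB _ _)).
by rewrite mulr2n mulrDl mul1r; apply: lerD; exact: le.
Qed.

Lemma normr_le_enorm (y : T) i j : `|y i j| <= enorm y.
Proof.
rewrite /enorm -sqrtr_sqr; apply: ler_wsqrtr.
rewrite (bigD1 i)//= (bigD1 j)//= -addrA lerDl addr_ge0//.
  by apply: sumr_ge0 => j' _; exact: sqr_ge0.
by apply: sumr_ge0 => i' _; apply: sumr_ge0 => j' _; exact: sqr_ge0.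
Qed.

End support.

(** * Restriction to the unit cube; real and imaginary parts *)

Section cube_cut.
Context (R : realType) (k m : nat).
Local Notation lebk := (lebesgue_rV R k).
Local Notation V := (borel 'rV[R]_m).
Local Notation X := (borel 'rV[R]_k).
Local Notation ucube := (@unit_cube R k : set X).
Implicit Types h : 'rV[R]_k * 'rV[R]_m -> R.

(** The domain of integration is put into the function, at the price of a possible jump across the
    boundary of the cube. *)
Definition cube_cut h (p : 'rV[R]_k * 'rV[R]_m) : R := \1_ucube p.1 * h p.

Lemma ktransform_cube_cut h (y : 'M[R]_(k.+1, m)) :
  ktransform (cube_cut h) y = \int[lebk]_(x in ucube) h (x, kplane_point y x).
Proof.
rewrite /ktransform [RHS]Rintegral_mkcond; apply: eq_Rintegral => x _.
by rewrite patch_indic /cube_cut /= mulrC.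
Qed.

Variables (h : 'rV[R]_k * 'rV[R]_m -> R) (K : set ('rV[R]_k * 'rV[R]_m)).
Hypotheses (ch : continuous h) (cK : compact K) (hK : forall z, ~ K z -> h z = 0).

Lemma cube_cut_data : exists M L, fibre_data (cube_cut h) M L.
Proof.
have [B [_ KB]] := compact_bounded cK.
have B0 : 0 < `|B| + 1 by rewrite ltr_pwDr.
have chK : compact (h @` K) by apply: continuous_compact => //; exact: continuous_subspaceT.
have [M [_ hM]] := compact_bounded chK.
exists (`|M| + 1), (`|B| + 1); split; first exact: ltW.
  apply: measurable_funM; last exact: continuous_borel_prod.
  exact: (measurableT_comp (measurable_indic (@measurable_unit_cube R k)) measurable_fst).
move=> x u; rewrite /cube_cut /= normrM ger0_norm// mulrCA; apply: ler_wpM2l => //.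
have [Kz|Kz] := pselect (K (x, u)); last by rewrite hK// normr0 mulr_ge0.
rewrite indicE mem_set ?mulr1.
  apply: hM; last by exists (x, u).
  by rewrite ltr_pwDr// ler_norm.
apply/cube0P => j.
have uB : `|(x, u)| <= `|B| + 1 by apply: (KB (`|B| + 1) _ (x, u) Kz); rewrite ltr_pwDr// ler_norm.
apply: le_trans uB; rewrite prod_normE le_max; apply/orP; right => /=.
rewrite [leRHS](_ : _ = mx_norm u)// mx_normrE.
by apply/bigmax_geP; right => /=; exists (ord0, j).
Qed.

(** The jump of the indicator in x does no harm: a change of y moves the point only along its fibre,
    where h is uniformly continuous, and the unit cube has measure 1. *)
Lemma cube_cut_uniform :
  mx_uniformly_continuous (ktransform (cube_cut h) : 'M[R]_(k.+1, m) -> R).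
Proof.
move=> e e0; have [d d0 dh] := compact_support_uniform ch cK hK e0.
have [M [L FD]] := cube_cut_data.
exists (d / k.+1%:R); first by rewrite divr_gt0.
move=> y v vd.
have i1 := fibre_data_integrable (y + v) FD; have i2 := fibre_data_integrable y FD.
rewrite /ktransform -(RintegralB measurableT i1 i2).
have mD : measurable_fun setT (fun x : X =>
    cube_cut h (x, kplane_point (y + v) x) - cube_cut h (x, kplane_point y x)).
  by apply: measurable_funB; exact: fibre_data_integrand_fst FD.
have := Rintegral_bounded_support mD (@measurable_unit_cube R k) (lebesgue_unit_cube_lty R k) (M := e).
rewrite [X in fine X]lebesgue_unit_cube mulr1; apply => x.
rewrite /cube_cut /= -mulrBr normrM ger0_norm// mulrC.
have [xU|xU] := pselect (ucube x); last by rewrite indicE memNset// !mulr0.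
apply: ler_wpM2r => //; rewrite kplane_pointD; apply: dh => j.
have vd0 : 0 <= d / k.+1%:R by rewrite divr_ge0// ltW.
apply: (le_trans (kplane_point_le j vd0 xU vd)).
by rewrite mulrCA divff// mulr1.
Qed.

End cube_cut.

Section complex_parts.
Context (R : realType) (T : topologicalType) (f : T -> R[i]).
Hypothesis cf : continuous (f : T -> R[i]^o).

Lemma Re_le_normc (z : R[i]) : `|complex.Re z| <= Normc.normc z.
Proof.
case: z => a b /=; rewrite -[leLHS]sqrtr_sqr; apply: ler_wsqrtr.
by rewrite lerDl sqr_ge0.
Qed.

Lemma Im_le_normc (z : R[i]) : `|complex.Im z| <= Normc.normc z.
Proof.
case: z => a b /=; rewrite -[leLHS]sqrtr_sqr; apply: ler_wsqrtr.
by rewrite lerDr sqr_ge0.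
Qed.

(** Treats real part, imaginary part and modulus together, each being 1-Lipschitz for the
    modulus. *)
Lemma continuous_normc_lipschitz (g : R[i] -> R) :
  (forall z w, `|g z - g w| <= Normc.normc (z - w)) -> continuous (g \o f).
Proof.
move=> gL x; apply/cvgrPdist_lt => e e0.
have e0' : 0 < (e%:C)%C :> R[i]^o by rewrite ltcR.
have /cvgrPdist_lt/(_ _ e0') := @cf x.
apply: filterS => t /=; rewrite normc_def ltcR => h.
by apply: le_lt_trans h; apply: (le_trans (gL _ _)); case: (f x - f t).
Qed.

Lemma continuous_Re : continuous (fun x => complex.Re (f x)).
Proof. by apply: continuous_normc_lipschitz => -[a b] [a' b']; exact: (Re_le_normc (a +i* b - (a' +i* b'))%C). Qed.

Lemma continuous_Im : continuous (fun x => complex.Im (f x)).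
Proof. by apply: continuous_normc_lipschitz => -[a b] [a' b']; exact: (Im_le_normc (a +i* b - (a' +i* b'))%C). Qed.

Lemma continuous_normc : continuous (fun x => Normc.normc (f x)).
Proof.
apply: continuous_normc_lipschitz => z w.
have nD (a b : R[i]) : Normc.normc (a + b) <= Normc.normc a + Normc.normc b := le_normcD a b.
have nN (a : R[i]) : Normc.normc (- a) = Normc.normc a := normcN a.
rewrite ler_norml lerBlDr; apply/andP; split; last by rewrite -{1}(subrK w z); exact: nD.
rewrite lerNl opprB lerBlDr -{1}(subrK z w) (le_trans (nD _ _))// lerD2r.
by rewrite -(nN (w - z)) opprB.
Qed.

End complex_parts.

(** * Exponents and the mixed norm *)

Section exponents.
Context (R : realType).

(** With 1/p = 1 - 1/q the relation says 2/p - 1 = 1 - 2/q = t. Since t > 0, a finite q is at least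
    2 and so p is at most 2; q = +oo gives p = 1 and t = 1. *)
Lemma hoelder_conjugate_exponent (q : \bar R) (t : R) : (1 <= q)%E -> 0 < t ->
  ((2^-1)%:E - q^-1 = (t / 2)%:E)%E ->
  exists p : R, [/\ hoelder_conjugate q = p%:E, 1 <= p, p <= 2 & 2 / p - 1 = t].
Proof.
case: q => [r| |]// + t0; last first.
  move=> _; rewrite invey sube0 => -[tE]; exists 1; split; rewrite ?hoelder_conjugatey ?ler1n//.
  by move: tE; lra.
rewrite lee_fin => r1; have r0 : r != 0 by rewrite gt_eqF// (lt_le_trans ltr01).
rewrite inver (negbTE r0) -EFinD => -[tE].
have rp : 0 < r by exact: lt_le_trans ltr01 r1.
have r2 : 2 <= r.
  have : r^-1 <= 2^-1 by lra.
  by rewrite lef_pV2 ?posrE.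
have r1' : 0 < r - 1 by lra.
exists (r / (r - 1)); split.
- by rewrite /hoelder_conjugate /= eqe (negbTE r0) -EFinD inver gt_eqF.
- by rewrite ler_pdivlMr// mul1r; lra.
- by rewrite ler_pdivrMr//; lra.
have -> : 2 / (r / (r - 1)) - 1 = 1 - 2 * r^-1 by field; rewrite r0 gt_eqF.
by lra.
Qed.

End exponents.

Section mixed_norm.
Context (R : realType) (k m : nat).
Local Notation lebk := (lebesgue_rV R k).
Local Notation leb := (lebesgue_rV R m).
Local Notation V := (borel 'rV[R]_m).
Local Notation X := (borel 'rV[R]_k).
Implicit Types f : 'rV[R]_k * 'rV[R]_m -> R[i].

Lemma mixed_norm_sqr (p : R) f :
  ((mixed_norm p%:E f) `^ 2 =
   \int[lebk]_x (fibre_power p (fun z => Normc.normc (f z)) x `^ (2 / p)))%E.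
Proof.
rewrite /mixed_norm poweR_Lnorm ?pnatr_eq0//; apply: eq_integral => x _.
rewrite gee0_abs ?Lnorm_ge0//.
by rewrite unlock -poweRrM (mulrC p^-1).
Qed.

Lemma fibre_power_le_mixed (p : R) (F : 'rV[R]_k * 'rV[R]_m -> R) f : 1 <= p ->
  measurable_fun setT (F : X * V -> R) ->
  measurable_fun setT ((fun z => Normc.normc (f z)) : X * V -> R) ->
  (forall z, `|F z| <= Normc.normc (f z)) ->
  (\int[lebk]_x (fibre_power p F x `^ (2 / p)) <= (mixed_norm p%:E f) `^ 2)%E.
Proof.
move=> p1 mF mf Ff; rewrite mixed_norm_sqr.
have p0 : 0 < p by exact: lt_le_trans ltr01 p1.
have mpow (w : 'rV[R]_k * 'rV[R]_m -> R) : measurable_fun setT (w : X * V -> R) ->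
    measurable_fun setT (fun z : X * V => (`|w z| `^ p)%R%:E).
  move=> mw; apply/measurable_EFinP.
  apply: (@measurableT_comp _ _ _ _ _ _ (fun x : R => x `^ p)); first exact: measurable_powR.
  exact: measurableT_comp.
have mN (w : 'rV[R]_k * 'rV[R]_m -> R) : measurable_fun setT (w : X * V -> R) ->
    measurable_fun setT (fun x : X => (fibre_power p w x `^ (2 / p))%E).
  move=> mw.
  apply: (@measurableT_comp _ _ _ X _ _ (fun e : \bar R => (e `^ (2 / p))%E) _ (fibre_power p w : X -> \bar R)).
    exact: measurable_poweR.
  apply: (@measurable_fun_fubini_tonelli_F _ _ _ _ _ leb (fun q : X * V => (`|w q| `^ p)%:E)).
    exact: mpow.
  by move=> q; rewrite lee_fin powR_ge0.
apply: ge0_le_integralT.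
- by move=> x; exact: poweR_ge0.
- exact: (mN _ mF).
- exact: (mN _ mf).
move=> x; apply: gt0_ler_poweR.
- by rewrite divr_ge0// ltW.
- by rewrite in_itv /= fibre_power_ge0 leey.
- by rewrite in_itv /= fibre_power_ge0 leey.
have sec (w : 'rV[R]_k * 'rV[R]_m -> R) : measurable_fun setT (w : X * V -> R) ->
    measurable_fun setT (fun u : V => (`|w (x, u)| `^ p)%R%:E).
  by move=> /mpow mw; apply: (@measurableT_comp _ _ _ _ _ _ (fun z : X * V => (`|w z| `^ p)%R%:E) _ (pair x)).
apply: ge0_le_integralT.
- by move=> u; rewrite lee_fin powR_ge0.
- exact: (sec _ mF).
- exact: (sec _ mf).
move=> u; rewrite lee_fin; apply: ge0_ler_powR; rewrite ?nnegrE ?(ltW p0)//.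
by rewrite [leRHS]ger0_norm// (le_trans _ (Ff _)).
Qed.

End mixed_norm.

(** * Complex data and conclusion *)

Section finite_measure.
Context (R : realType) (k m : nat).
Local Notation Y := (borel 'M[R]_(k.+1, m)).
Local Notation N := (k.+1 * m)%N.

Lemma ktransform_const_ge0 (c2 l eps : R) : 0 < eps -> 0 <= ktransform_const k m c2 l eps.
Proof.
move=> e0; apply: addr_ge0; apply: mulr_ge0 => //.
by rewrite exprn_ge0// invr_ge0 subr_ge0 ltW// scale_ratio_lt1.
Qed.

Lemma L2_le_norm d (T : measurableType d) (mu : {measure set T -> \bar R}) (g : T -> R) (a : R) :
  L2_le mu g a -> L2_le mu (fun x => `|g x|) a.
Proof.
move=> [mg ga]; split; first exact: measurableT_comp.
rewrite !Lnorm2E in ga *.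
by under eq_integral do rewrite real_normK ?num_real//.
Qed.

Variables (mu : {finite_measure set Y -> \bar R}) (c2 alpha : R).
Hypothesis frost : forall (y : 'M[R]_(k.+1, m)) (r : R), 0 < r ->
  (mu (eball y r) <= (c2 * r `^ alpha)%:E)%E.
Hypotheses (c20 : 0 <= c2) (alphaN : alpha <= N%:R).
Variables (S0 : set Y) (c : 'M[R]_(k, m)) (l : R).
Hypotheses (mS0 : measurable S0) (S00 : mu (~` S0) = 0%E) (l0 : 0 < l).
Hypothesis S0slab : forall y h, S0 y -> mx_cube 0 1 h -> slab c l (y + h).
Variables (f : 'rV[R]_k * 'rV[R]_m -> R[i]) (p eps v : R).
Hypotheses (fcs : continuous_compact_support f) (p1 : 1 <= p) (p2 : p <= 2) (v0 : 0 <= v).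
Hypothesis fv : mixed_norm p%:E f = v%:E.
Hypotheses (eps0 : 0 < eps) (pe : m%:R * (2 / p - 1) = alpha - N%:R + k%:R - eps).
Hypothesis k0 : (0 < k)%N.

Let part (h : 'rV[R]_k * 'rV[R]_m -> R) : continuous h ->
  (forall z, `|h z| <= Normc.normc (f z)) ->
  L2_le mu (ktransform (cube_cut h) : Y -> R) (ktransform_const k m c2 l eps * v).
Proof.
move=> ch hf; have [cf cK] := fcs.
have hK z : ~ closure [set x | f x != 0] z -> h z = 0.
  move=> nz; apply/eqP; rewrite -normr_le0; apply: (le_trans (hf z)).
  suff -> : f z = 0 by rewrite Normc.normc0.
  by apply/eqP; apply: contrapT => /negP fz; apply: nz; exact: subset_closure.
have [M [L FD]] := cube_cut_data ch cK hK.
have v2 : 0 <= v ^+ 2 by exact: exprn_ge0.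
have FA : (\int[lebesgue_rV R k]_x (fibre_power p (cube_cut h) x `^ (2 / p)) <= (v ^+ 2)%:E)%E.
  have [_ mF _] := FD.
  apply: (@le_trans _ _ ((mixed_norm p%:E f) `^ 2)%E); last first.
    by rewrite fv poweR_EFin powR_mulrn.
  apply: fibre_power_le_mixed => //; first by apply: continuous_borel_prod; exact: continuous_normc.
  move=> z; apply: le_trans (hf z); rewrite /cube_cut normrM -[leRHS]mul1r ler_wpM2r//.
  by rewrite ger0_norm.
have := L2_le_ktransform frost c20 alphaN mS0 S00 l0 S0slab FD p1 p2 v2 FA eps0 pe k0
  (cube_cut_uniform ch cK hK).
by rewrite sqrtr_sqr (ger0_norm v0).
Qed.

(** The modulus of T f is at most the sum of the moduli of the transforms of the real and imaginary
    parts of f. Each part is dominated by the modulus of f, hence has at most its mixed norm; the 2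
    counts the parts. *)
Lemma L2_norm_kplane_transform_le :
  (L2_norm mu (kplane_transform f) <= (2 * ktransform_const k m c2 l eps * v)%:E)%E.
Proof.
have [cf cK] := fcs.
have Pr := part (continuous_Re cf) (fun z => Re_le_normc (f z)).
have Pi := part (continuous_Im cf) (fun z => Im_le_normc (f z)).
set Gr := ktransform _ in Pr; set Gi := ktransform _ in Pi.
have [mr _] := Pr; have [mi _] := Pi.
have [_] := L2_leD (L2_le_norm Pr) (L2_le_norm Pi).
move=> sum_le; apply: le_trans (le_trans sum_le _); last by rewrite lee_fin; lra.
have TE y : kplane_transform f y = Complex (Gr y) (Gi y).
  by rewrite /kplane_transform /Gr /Gi !ktransform_cube_cut.
have nE y : Normc.normc (kplane_transform f y) ^+ 2 = Gr y ^+ 2 + Gi y ^+ 2.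
  by rewrite TE /= sqr_sqrtr// addr_ge0// sqr_ge0.
rewrite /L2_norm [leLHS](Lnorm2E mu (fun y => Normc.normc (kplane_transform f y))) Lnorm2E.
have X0 (w : Y -> R) : (0 <= \int[mu]_x ((w x ^+ 2)%R)%:E)%E.
  by apply: integral_ge0 => x _; rewrite lee_fin sqr_ge0.
rewrite lee_sqrt//; under eq_integral do rewrite nE.
apply: ge0_le_integralT.
- by move=> y; rewrite lee_fin addr_ge0// sqr_ge0.
- by apply/measurable_EFinP; apply: measurable_funD; exact: measurable_funX.
- apply/measurable_EFinP; apply: measurable_funX.
  by apply: measurable_funD; exact: measurableT_comp.
move=> y; rewrite lee_fin sqrrD !real_normK ?num_real// -addrA lerD2l addrC lerDl.
by rewrite mulrn_wge0// mulr_ge0.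
Qed.

End finite_measure.

Theorem theorem1p4 (R : realType) (d k : nat) (k_ge1 : (1 <= k)%N)
    (k_lt_d : (k < d)%N) :
  exists C : R -> R -> R -> R,
  forall (f : 'rV[R]_k * 'rV[R]_(d - k) -> R[i])
    (mu : {measure set (borel 'M[R]_(k.+1, d - k)) -> \bar R})
    (c2 alpha eps : R) (q : \bar R),
  let N : R := (k.+1 * (d - k))%:R in
  continuous_compact_support f ->
  compact (measure_support mu) ->
  N - k%:R < alpha < N ->
  0 < c2 ->
  (forall (y : 'M[R]_(k.+1, d - k)) (r : R), 0 < r ->
    (mu (eball y r) <= (c2 * r `^ alpha)%:E)%E) ->
  0 < eps < alpha - N + k%:R ->
  (1 <= q)%E ->
  ((2^-1)%:E - q^-1 = ((alpha - N + k%:R - eps) / (2 * (d - k)%:R))%:E)%E ->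
  (L2_norm mu (kplane_transform f)
    <= (C c2 eps (ediam (measure_support mu)))%:E
       * mixed_norm (hoelder_conjugate q) f)%E.
Proof.
have m0 : (0 < d - k)%N by rewrite subn_gt0.
move: (d - k)%N m0 => m m0.
(* The slab needed for a support of diameter dm has side 2 dm + 1. The final + 1 makes the constant
   positive, so that an infinite mixed norm gives an infinite right side. *)
exists (fun c2 eps dm => 2 * ktransform_const k m c2 (2 * dm + 1) eps + 1).
move=> f mu c2 alpha eps q N fcs cS /andP[alpha_gt alpha_lt] c20 frost /andP[eps0 eps1] q1 qE.
set S := measure_support mu in cS *; set dm := ediam S.
have mR : 0 < m%:R :> R by rewrite ltr0n.
(* The number t will be 2/p - 1, the exponent lost per fibre dimension in the Bernstein
   inequality. *)
pose t : R := (alpha - N + k%:R - eps) / m%:R.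
have t0 : 0 < t by rewrite divr_gt0// subr_gt0.
have tE : (alpha - N + k%:R - eps) / (2 * m%:R) = t / 2 by rewrite /t invfM mulrA mulrAC.
rewrite tE in qE; have [p [-> p1 p2 pt]] := hoelder_conjugate_exponent q1 t0 qE.
have pe : m%:R * (2 / p - 1) = alpha - N + k%:R - eps by rewrite pt mulrC divfK// gt_eqF.
have mS : measurable (S : set (borel _)) by exact: measurable_measure_support.
have S0 : mu (~` S) = 0%E by exact: measure_supportC.
(* Any point of the support serves as centre; for an empty support the diameter is [sup set0], which
   is 0, and every centre works. *)
have [dm0 [y0 Sy0]] : 0 <= dm /\ exists y0 : 'M[R]_(k.+1, m), forall y, S y -> forall i j, `|y i j - y0 i j| <= dm.
  have [[y0 Sy0]|nS] := pselect (exists y, S y).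
    split.
      by apply: le_trans (ediam_ge cS Sy0 Sy0); exact: sqrtr_ge0.
    exists y0 => y Sy i j; apply: le_trans (ediam_ge cS Sy Sy0).
    by have := normr_le_enorm (y - y0) i j; rewrite !mxE.
  split; last by exists 0 => y Sy; exfalso; apply: nS; exists y.
  rewrite /dm /ediam (_ : [set _ | _] = set0) ?sup0//.
  by apply/seteqP; split => // r [y [z [Sy _ _]]]; apply: nS; exists y.
have dm1 : 0 < dm + 1 by rewrite ltr_pwDr.
have Sball : S `<=` eball y0 ((k.+1 * m).+1%:R * (dm + 1)).
  move=> y Sy; apply: enorm_lt => // i j; rewrite !mxE.
  by apply: (le_trans (Sy0 y Sy i j)); rewrite lerDl.
(* The support carries all the mass and lies in one ball, so the ball condition makes mu finite. *)
have muoo : (mu setT < +oo)%E.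
  rewrite -(setvU S) (measureU mu (measurableC mS) mS (setICl S)).
  rewrite [X in (X + _ < _)%E]S0 add0e; apply: (@le_lt_trans _ _ (mu (eball y0 ((k.+1 * m).+1%:R * (dm + 1))))).
    by apply: le_measure => //; rewrite inE//; exact: measurable_eball.
  by apply: (le_lt_trans (frost _ _ _)); rewrite ?ltry// mulr_gt0.
have fin := lty_fin_num_fun muoo.
have sigma_fin : sigma_finite setT mu by apply: fin_num_fun_sigma_finite => //; rewrite measure0.
(* Finiteness has been derived, so the structure of finite measure demanded by the estimates is
   attached to mu here. *)
pose H1 := isFinite.Build _ _ _ _ fin.
pose H2 := isSFinite.Build _ _ _ _ (sfinite_measure_sigma_finite sigma_fin).
pose H3 := isSigmaFinite.Build _ _ _ _ sigma_fin.
pose muf := HB.pack_for (FiniteMeasure.type (borel 'M[R]_(k.+1, m)) R) (Measure.sort mu) H1 H2 H3.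
have muE : mu = muf by exact: eq_measure.
(* The entries of the support lie within dm of those of y0, and the averaging steps lie in [0, 1]; a
   cube with this corner and side 2 dm + 1 contains the direction rows of all the sums. *)
pose c : 'M[R]_(k, m) := \matrix_(i, j) (y0 (lift ord0 i) j - dm).
have l0 : 0 < 2 * dm + 1 by rewrite ltr_pwDr// mulr_ge0.
have Sslab y h : S y -> mx_cube 0 1 h -> slab c (2 * dm + 1) (y + h).
  move=> Sy h1 i j; rewrite /= in_itv /= !mxE.
  have := Sy0 y Sy (lift ord0 i) j; rewrite ler_norml => /andP[y1 y2].
  by have := h1 (lift ord0 i) j; rewrite /= in_itv /= mxE => /andP[h2 h3]; lra.
have cst0 := ktransform_const_ge0 k m c2 (2 * dm + 1) eps0.
have C0 : 0 < 2 * ktransform_const k m c2 (2 * dm + 1) eps + 1 by rewrite ltr_pwDr// mulr_ge0.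
have : (0 <= mixed_norm p%:E f)%E by exact: Lnorm_ge0.
case fv : (mixed_norm p%:E f) => [v| |]// v0; last by rewrite gt0_muley ?lte_fin// leey.
apply: (@le_trans _ _ (2 * ktransform_const k m c2 (2 * dm + 1) eps * v)%:E).
  rewrite [X in L2_norm X]muE; exact: (@L2_norm_kplane_transform_le _ _ _ muf _ _ frost (ltW c20) (ltW alpha_lt) _ _ _ mS S0 l0
    Sslab _ _ _ _ fcs p1 p2 v0 fv eps0 pe k_ge1).
rewrite -EFinM lee_fin; apply: ler_wpM2r; first by rewrite -lee_fin.
by rewrite lerDl.
Qed.
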